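(* Let $\varphi:\mathbb{N}\to\mathbb{R}_{>0}$ be any function and $\ell\in\mathbb{N}$. Let \[ \mathcal{E}_{\ell}(\varphi):=\{x\in[0,1]: a_n(x)\cdots a_{n+\ell-1}(x)\geq\varphi(n)\text{ for infinitely many } n\in\mathbb{N}\}, \] \[ \mathcal{E}'_{\ell}(\varphi):=\{x\in[0,1): a_n'(x)\cdots a_{n+\ell-1}'(x)\geq\varphi(n)\text{ for infinitely many } n\in\mathbb{N}\}. \] Then $\dim_H \mathcal{E}'_{\ell}(\varphi)=\dim_H\mathcal{E}_{\ell}(\varphi)$, where $\dim_H$ denotes Hausdorff dimension.
   Context: For irrational $x\in(0,1)$ with continued fraction expansion $x=[a_1(x),a_2(x),\dots]$, the $a_n(x)\in\mathbb{N}$ are its partial quotients. Define $a_n'(x)=a_n(x)$ if $a_n(x)$ is prime, and $a_n'(x)=0$ otherwise. *)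

(* Defs.v *)
From Stdlib Require Import Reals ZArith Znumtheory.
From Coquelicot Require Import Coquelicot.
Open Scope R_scope.

Definition gauss (x : R) : R := / x - IZR (Int_part (/ x)).

(* n-th partial quotient (n >= 1): a_n(x) = floor(1 / T^(n-1) x). *)
Definition pq (n : nat) (x : R) : Z := Int_part (/ (Nat.iter (n - 1) gauss x)).

Definition pq' (n : nat) (x : R) : Z :=
  if prime_dec (pq n x) then pq n x else 0%Z.

Fixpoint block_prod (f : nat -> Z) (n l : nat) : R :=
  match l with
  | O => 1
  | S l' => IZR (f n) * block_prod f (S n) l'
  end.

Definition irrational (x : R) : Prop :=
  ~ exists p q : Z, q <> 0%Z /\ x = IZR p / IZR q.

Definition infinitely_often (P : nat -> Prop) : Prop :=
  forall N : nat, exists n, (N <= n)%nat /\ (1 <= n)%nat /\ P n.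

(* E_l(phi), restricted to the irrationals of (0,1) where a_n is defined *)
Definition E_set (phi : nat -> R) (l : nat) (x : R) : Prop :=
  0 < x < 1 /\ irrational x /\
  infinitely_often (fun n => block_prod (fun m => pq m x) n l >= phi n).

Definition E'_set (phi : nat -> R) (l : nat) (x : R) : Prop :=
  0 < x < 1 /\ irrational x /\
  infinitely_often (fun n => block_prod (fun m => pq' m x) n l >= phi n).

(* diameter; diam of the empty set is 0 (real m_infty = 0) *)
Definition diam (U : R -> Prop) : R :=
  real (Lub_Rbar (fun r => exists x y, U x /\ U y /\ r = Rabs (x - y))).

(* d^s for d >= 0, s > 0, with 0^s = 0 *)
Definition dpow (d s : R) : R := if Rlt_dec 0 d then Rpower d s else 0.

Definition hausdorff_delta (s delta : R) (E : R -> Prop) : Rbar :=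
  Glb_Rbar (fun v => exists U : nat -> R -> Prop,
    (forall i x y, U i x -> U i y -> Rabs (x - y) <= delta) /\
    (forall x, E x -> exists i, U i x) /\
    is_series (fun i => dpow (diam (U i)) s) v).

Definition hausdorff_measure (s : R) (E : R -> Prop) : Rbar :=
  Rbar_lub (fun v => exists delta, 0 < delta /\ v = hausdorff_delta s delta E).

Definition hausdorff_dim (E : R -> Prop) : Rbar :=
  Glb_Rbar (fun s => 0 < s /\ hausdorff_measure s E = Finite 0).

(* Main.v *)
(** Since a_n' is a_n or 0 and phi > 0, E' is contained in E, so only dim E <= dim E' needs a proof.  It
    follows from a dichotomy at every s: up to an arbitrarily small change of s, either E has dimension
    at most s or E' has dimension at least s.

    For 1/2 < s < 1 put rho = (1-s)/s, G = 1 + rho + ... + rho^(l-1), f = s/G, and let Z_n be the sum of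
    q(w)^(-2s) over the words w of n digits.  If n^2 Z_(n-1) <= phi(n)^f for all large n, then E is covered
    economically: stop at the first i for which the product of the first i digits of the block
    exceeds phi(n)^((1 + rho + ... + rho^(i-1))/G).  Otherwise the reverse inequality holds for infinitely many n,
    and sparsely chosen such n carry a Cantor set inside E': long runs of words with weights q(w)^(-2t),
    t < s, alternate with blocks whose i-th digit (i = 0, ..., l-1) is a prime in a short range above
    phi(n)^(rho^i/G).

    For s < 1/2 put beta = 1/s - 1 > 1.  If phi(n) <= exp(beta^n) infinitely often, take every digit a_n
    prime of size about exp(c beta^n).  If phi(n) >= exp(beta^n) eventually, then for gamma < beta the
    sequence ln(a_n)/gamma^n is unbounded and E is covered according to its records.

    Primes suffice because the central binomial coefficient gives at least N of them in [N, N^(1+eps)]; the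
    loss eps disappears in the change of s. *)

Require Import Defs.
From Stdlib Require Import Reals ZArith Znumtheory Lia Lra Classical ClassicalEpsilon FinFun.
From Coquelicot Require Import Coquelicot.
From Stdlib Require Import List.
From mathcomp Require all_boot zify.
Import ListNotations.
Open Scope R_scope.

(** * Primes *)

(** The value 1/2 is where the sum of a^(-2s) over the digits a begins to converge, so Z_n is finite
    only for s > 1/2. Below it the sizes of the digits decide: beta = 1/s - 1 is the growth rate at
    which the gains from all earlier digits, about a_n^((1-2s)/(beta-1)), just pay the price a_n^s
    of the next one. The powers of rho are forced by s alpha_i = f - (2s-1)(alpha_0 + ... +
    alpha_(i-1)), where alpha_i = rho^i/G. This relation makes the cover equally expensive wherever
    it stops in the block, and it keeps the Cantor set exactly at its limit from one block digit to
    the next. The obstacle in E' is that the primes used for a digit may cluster. Only their number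
    enters: r distinct integers spread over at least r - 1, so a set that meets r >= 2 of p equally
    likely digits of size at most N has diameter at least of order r/N^2 relative to its cylinder,
    and r/p <= (r/p)^t turns this into a bound by the t-th power of the diameter. The mass lives on
    the nodes of a tree; a point outside a too economical cover is found by greedy descent. *)

Module CentralBinomial.
Import all_boot zify.

(** By Pascal's rule and symmetry, C(2n+2, n+1) = 2 C(2n+1, n) >= 2 C(2n, n). *)
Lemma expn2_le_central_bin n : (2 ^ n <= 'C(n.*2, n))%N.
Proof.
elim: n => [|n IH] //; rewrite doubleS expnS binS.
have -> : 'C(n.*2.+1, n.+1) = 'C(n.*2.+1, n).
  by rewrite -bin_sub; [congr 'C(_, _); rewrite -addnn; lia | rewrite -addnn; lia].
rewrite addnn -muln2 mulnC leq_mul2r /=.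
apply: leq_trans IH _; case: n => [|n] //.
by rewrite (binS n.+1.*2) leq_addr.
Qed.

(** By Legendre's formula the exponent of p is the sum over k of floor(2n/p^k) - 2 floor(n/p^k).
    Each term is 0 or 1 and vanishes once p^k > 2n, so the exponent is at most [T], the largest k
    with p^k <= 2n. *)
Lemma pfactor_central_bin_le p n : prime p -> (0 < n)%N ->
  (p ^ logn p 'C(n.*2, n) <= n.*2)%N.
Proof.
move=> pp n0; set T := trunc_log p n.*2.
have n20 : (0 < n.*2)%N by rewrite double_gt0.
have lT : (p ^ T <= n.*2)%N by apply: trunc_logP (prime_gt1 pp) n20.
apply: leq_trans lT; apply: leq_pexp2l; first exact: prime_gt0.
have nn2 : (n <= n.*2)%N by rewrite -addnn leq_addr.
have := bin_fact nn2; rewrite -{2}addnn addnK => E.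
have := f_equal (logn p) E.
rewrite !lognM ?muln_gt0 ?fact_gt0 ?bin_gt0 //.
rewrite !logn_fact // => {E}.
(* Legendre's sum for n! is lengthened by zero terms, so that it runs over the same k as the sum for
   (2n)!. *)
have -> : (\sum_(1 <= k < n.+1) n %/ p ^ k = \sum_(1 <= k < n.*2.+1) n %/ p ^ k)%N.
  rewrite [RHS](@big_cat_nat _ _ _ n.+1) //=.
  have -> : (\sum_(n.+1 <= k < n.*2.+1) n %/ p ^ k = 0)%N.
    rewrite big_nat_cond; apply: big1 => k /andP[/andP[k1 k2] _].
    by apply: divn_small; apply: leq_trans k1 (ltnW (ltn_expl _ (prime_gt1 pp))).
  by rewrite addn0.
have H : (\sum_(1 <= k < n.*2.+1) n.*2 %/ p ^ k <=
   \sum_(1 <= k < n.*2.+1) (n %/ p ^ k + n %/ p ^ k + (k <= T)))%N.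
  rewrite big_nat_cond [X in (_ <= X)%N]big_nat_cond.
  apply: leq_sum => k /andP[/andP[k1 k2] _].
  have pk : (0 < p ^ k)%N by rewrite expn_gt0 prime_gt0.
  case: (leqP k T) => kT /=.
    rewrite -ltnS ltn_divLR //.
    have := divn_eq n (p ^ k); have := ltn_pmod n pk.
    set a := (n %/ _)%N; set b := (n %% _)%N; set c := (p ^ k)%N.
    rewrite -addnn; nia.
  rewrite divn_small //; apply: leq_trans (trunc_log_ltn _ (prime_gt1 pp)) _.
  by apply: leq_pexp2l => //; exact: prime_gt0.
rewrite !big_split /= in H.
have H2 : (\sum_(1 <= k < n.*2.+1) (k <= T) <= T)%N.
  rewrite (eq_bigr (fun k => if (k <= T)%N then 1%N else 0%N)); last by move=> k _; case: leqP.
  rewrite -big_mkcond /= sum1_count.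
  rewrite -size_filter.
  have /uniq_leq_size : {subset [seq k <- index_iota 1 n.*2.+1 | (k <= T)%N] <= iota 1 T}.
    by move=> k; rewrite mem_filter mem_index_iota mem_iota; lia.
  rewrite size_iota; apply; exact: filter_uniq (iota_uniq _ _).
lia.
Qed.

Lemma central_bin_le n : (0 < n)%N ->
  ('C(n.*2, n) <= n.*2 ^ size (primes 'C(n.*2, n)))%N.
Proof.
move=> n0; set c := 'C(_, _).
have c0 : (0 < c)%N by rewrite bin_gt0 -addnn leq_addr.
rewrite {1}(prod_prime_decomp c0) prime_decompE big_map /=.
have h : forall p, p \in primes c -> (p ^ logn p c <= n.*2)%N.
  by move=> p; rewrite mem_primes => /andP[pp _]; exact: pfactor_central_bin_le.
elim: (primes c) h => [|p s IH] h; first by rewrite big_nil.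
rewrite big_cons /= expnS; apply: leq_mul; first by apply: h; rewrite mem_head.
by apply: IH => r rs; apply: h; rewrite in_cons rs orbT.
Qed.

Lemma NoDup_uniq (s : seq nat) : uniq s -> List.NoDup s.
Proof.
elim: s => [|a s IH] /=; first by constructor.
case/andP => h1 h2; constructor; last exact: IH.
move=> h; move: h1; suff -> : a \in s by [].
elim: s h {IH h2} => //= b s IH [->|h]; rewrite in_cons ?eqxx // IH //; exact: orbT.
Qed.

Lemma prime_Zprime p : prime p -> Znumtheory.prime (Z.of_nat p).
Proof.
move=> pp; have p1 := prime_gt1 pp.
apply/prime_alt; split; first by lia.
move=> m hm [k hk].
have k0 : (0 < k)%Z by nia.
have : (Z.to_nat m %| p)%N by apply/dvdnP; exists (Z.to_nat k); nia.
have m1 : Z.to_nat m != 1%N by apply/eqP; lia.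
by move/(prime_nt_dvdP pp m1); lia.
Qed.

Lemma prime_dvd_fact_le p n : prime p -> (p %| n`!)%N -> (p <= n)%N.
Proof.
move=> pp; elim: n => [|n IH].
  by rewrite fact0 dvdn1 => /eqP e; move: pp; rewrite e.
rewrite factS Euclid_dvdM // => /orP[/dvdn_leq -> // | /IH]; lia.
Qed.

(** Chebyshev's lower bound, with the prime divisors of C(2n, n): they divide (2n)!, hence are at
    most 2n, and 2^n <= C(2n, n) <= (2n)^(number of them). *)
Lemma many_primes n : (1 <= n)%coq_nat -> exists P : list nat,
  [/\ List.NoDup P,
      forall p, List.In p P -> Znumtheory.prime (Z.of_nat p) /\ (p <= 2 * n)%coq_nat
    & (Nat.pow 2 n <= Nat.pow (2 * n) (length P))%coq_nat].
Proof.
move=> /leP n0; exists (primes 'C(n.*2, n)).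
have c0 : (0 < 'C(n.*2, n))%N by rewrite bin_gt0 -addnn leq_addr.
split.
- exact/NoDup_uniq/primes_uniq.
- move=> p hp.
  have {}hp : p \in primes 'C(n.*2, n).
    elim: (primes _) hp => //= b s IH [->|h]; rewrite in_cons ?eqxx // IH //; exact: orbT.
  move: hp; rewrite mem_primes => /and3P[pp _ pd]; split; first exact: prime_Zprime.
  have : (p %| n.*2`!)%N.
    rewrite -(@bin_fact n.*2 n); first exact: dvdn_mulr.
    by rewrite -addnn leq_addr.
  move=> /(prime_dvd_fact_le p n.*2 pp); lia.
- have e m k : Nat.pow m k = (m ^ k)%N by elim: k => //= k ->; rewrite expnS.
  rewrite !e; apply/leP; rewrite mul2n.
  apply: leq_trans (expn2_le_central_bin n) _.
  exact: central_bin_le.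
Qed.

End CentralBinomial.

Lemma Rpower_gt0 x y : 0 < Rpower x y.
Proof. apply exp_pos. Qed.

Lemma Rpower_le1 x y : 1 <= x -> y <= 0 -> Rpower x y <= 1.
Proof.
intros h1 h2. rewrite <- (Rpower_O x) by lra. apply Rle_Rpower; lra.
Qed.

Lemma Rpower_ge1 x y : 1 <= x -> 0 <= y -> 1 <= Rpower x y.
Proof.
intros h1 h2. rewrite <- (Rpower_O x) by lra. apply Rle_Rpower; lra.
Qed.

(* [ln x = ln (x^a) / a < x^a / a] *)
Lemma ln_le_Rpower x a : 0 < a -> ln x <= Rpower x a / a.
Proof.
intros ha. unfold Rpower.
pose proof (exp_ineq1_le (a * ln x)).
apply (Rmult_le_reg_l a); auto. field_simplify; lra.
Qed.

(** With X = N^(1+eps), Chebyshev's bound gives at least a constant times X / ln X primes up to X,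
    which is more than 6N for large N; at most N + 1 of them lie below N. *)
Lemma primes_in_range eps : 0 < eps -> exists N0, 1 <= N0 /\ forall N, N0 <= N ->
  exists P : list nat, NoDup P /\
    (forall p, In p P -> prime (Z.of_nat p) /\ N <= INR p <= Rpower N (1 + eps)) /\
    N <= INR (length P).
Proof.
intros he.
(* the ratio of N^(1+eps) to its logarithm exceeds N as soon as N^(eps/2) dominates these constants *)
set (N0 := Rpower (1 + 100 * (1 + eps) / eps) (2 / eps)).
assert (hb : 1 < 1 + 100 * (1 + eps) / eps).
{ assert (0 < 100 * (1 + eps) / eps) by (apply Rdiv_lt_0_compat; lra). lra. }
assert (hN0 : 1 <= N0).
{ apply Rpower_ge1; [lra|]. apply Rlt_le, Rdiv_lt_0_compat; lra. }
exists N0; split; auto. intros N hN.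
assert (hN1 : 1 <= N) by lra.
set (T := Rpower N (eps / 2)).
assert (hT : 1 + 100 * (1 + eps) / eps <= T).
{ unfold T. apply Rle_trans with (Rpower N0 (eps / 2)).
  - unfold N0. rewrite Rpower_mult. replace (2 / eps * (eps / 2)) with 1 by (field; lra).
    rewrite Rpower_1; lra.
  - apply Rle_Rpower_l; lra. }
set (X := Rpower N (1 + eps)).
assert (hX : X = N * T * T).
{ unfold X, T. rewrite Rmult_assoc, <- Rpower_plus. replace (eps/2+eps/2) with eps by field.
  rewrite Rpower_plus, Rpower_1; lra. }
assert (hT100 : 100 < T).
{ assert (100 < 100 * (1 + eps) / eps).
  { apply (Rmult_lt_reg_r eps); auto. field_simplify; nra. }
  lra. }
assert (hXb : 10000 <= X) by (rewrite hX; nra).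
set (n := Z.to_nat (Int_part (X / 2))).
assert (hn : X / 2 - 1 < INR n <= X / 2).
{ unfold n. pose proof (base_Int_part (X/2)) as [h1 h2].
  assert (0 <= Int_part (X/2))%Z.
  { assert (IZR (-1) < IZR (Int_part (X/2))) as h by lra. apply lt_IZR in h. lia. }
  rewrite INR_IZR_INZ, Z2Nat.id by auto. lra. }
assert (hn1 : (1 <= n)%nat).
{ apply INR_le. simpl. lra. }
destruct (CentralBinomial.many_primes n hn1) as [P [hP1 hP2 hP3]].
set (P' := filter (fun p => if Rle_dec N (INR p) then true else false) P).
exists P'. split; [apply NoDup_filter; auto|].
assert (hcut : INR (length P) <= INR (length P') + N + 1).
{ set (P2 := filter (fun p => negb (if Rle_dec N (INR p) then true else false)) P).
  assert (e : (length P = length P' + length P2)%nat)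
    by (symmetry; apply filter_length).
  rewrite e, plus_INR.
  assert (h : (length P2 <= length (seq 0 (S (Z.to_nat (Int_part N)))))%nat).
  { apply NoDup_incl_length; [apply NoDup_filter; auto|].
    intros p hp. apply filter_In in hp. destruct hp as [hp1 hp2].
    destruct (Rle_dec N (INR p)); simpl in hp2; [discriminate|].
    apply in_seq. split; [lia|].
    pose proof (base_Int_part N) as [q1 q2].
    assert (h : IZR (Z.of_nat p) < IZR (Int_part N + 1)).
    { rewrite <- INR_IZR_INZ, plus_IZR. lra. }
    apply lt_IZR in h. lia. }
  rewrite length_seq in h. apply le_INR in h. rewrite S_INR in h.
  pose proof (base_Int_part N) as [q1 q2].
  assert (0 <= Int_part N)%Z.
  { assert (IZR (-1) < IZR (Int_part N)) as hh by lra. apply lt_IZR in hh. lia. }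
  rewrite (INR_IZR_INZ (Z.to_nat _)), Z2Nat.id in h by auto. lra. }
split.
- intros p hp. apply filter_In in hp. destruct hp as [hp1 hp2].
  destruct (hP2 p hp1) as [a1 a2]. split; auto.
  destruct (Rle_dec N (INR p)); [|discriminate]. split; auto.
  apply le_INR in a2. rewrite mult_INR in a2. simpl in a2. fold X. lra.
- assert (hlog : INR n * ln 2 <= INR (length P) * ln X).
  { apply le_INR in hP3. rewrite !pow_INR in hP3.
    assert (0 < INR 2) by (simpl; lra).
    assert (0 < INR (2 * n)) by (apply lt_0_INR; lia).
    assert (ln (INR 2 ^ n) <= ln (INR (2 * n) ^ length P)) as hh.
    { apply ln_le; auto. apply pow_lt; auto. }
    rewrite !ln_pow in hh by auto. simpl (INR 2) in hh.
    replace (1 + 1) with 2 in hh by ring.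
    eapply Rle_trans; [exact hh|]. apply Rmult_le_compat_l; [apply pos_INR|].
    apply ln_le; auto. rewrite mult_INR. simpl. lra. }
  pose proof ln_lt_2.
  assert (hlX : ln X <= T * (2 * (1 + eps) / eps)).
  { unfold X, T, Rpower at 1. rewrite ln_exp.
    pose proof (ln_le_Rpower N (eps/2) ltac:(lra)) as h.
    replace (Rpower N (eps / 2) / (eps / 2)) with (Rpower N (eps/2) * (2 / eps)) in h by (field; lra).
    replace (Rpower N (eps / 2) * (2 * (1 + eps) / eps)) with ((1+eps) * (Rpower N (eps / 2) * (2 / eps))) by (field; lra).
    apply Rmult_le_compat_l; lra. }
  set (k := (1 + eps) / eps) in *.
  assert (hk : 1 < k) by (unfold k; apply (Rmult_lt_reg_r eps); auto; field_simplify; lra).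
  replace (2 * (1 + eps) / eps) with (2 * k) in hlX by (unfold k; field; lra).
  replace (100 * (1 + eps) / eps) with (100 * k) in hT by (unfold k; field; lra).
  assert (h1 : (X / 2 - 1) * / 2 <= INR (length P) * (T * (2 * k))).
  { apply Rle_trans with (INR n * ln 2); [nra|].
    apply Rle_trans with (1 := hlog). apply Rmult_le_compat_l; [apply pos_INR|auto]. }
  (* Of the two factors [T] in X = N T^2 one pays for ln X <= 2 k T; the other, being above 100 k,
     leaves 6N primes before those below N are discarded. *)
  assert (h2 : X / 8 <= INR (length P) * (T * (2 * k))) by lra.
  rewrite hX in h2.
  assert (h3 : N * T <= INR (length P) * (16 * k)) by nra.
  assert (h4 : 100 * k * N <= INR (length P) * (16 * k)) by nra.
  assert (h5 : 6 * N <= INR (length P)) by nra.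
  lra.
Qed.

(** * Finite and infinite continued fractions *)

Fixpoint cf (w : list nat) (y : R) : R :=
  match w with nil => y | a :: w => / (INR a + cf w y) end.

(* [den w y] is [q_n + y q_{n-1}], with [q_i] the continuants of [w]. *)
Fixpoint den (w : list nat) (y : R) : R :=
  match w with nil => 1 | a :: w => (INR a + cf w y) * den w y end.

Definition q (w : list nat) : R := den w 0.

Definition pos_word (w : list nat) : Prop := Forall (fun a => (1 <= a)%nat) w.

Lemma INR_ge1 a : (1 <= a)%nat -> 1 <= INR a.
Proof. intros h. apply le_INR in h. exact h. Qed.

Lemma cf_range w y : pos_word w -> 0 <= y <= 1 -> 0 <= cf w y <= 1.
Proof.
intros h hy; induction h as [|a w ha hw IH]; simpl; auto.
apply INR_ge1 in ha. split.
- apply Rlt_le, Rinv_0_lt_compat; lra.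
- rewrite <- Rinv_1. apply Rinv_le_contravar; lra.
Qed.

Lemma den_ge1 w y : pos_word w -> 0 <= y <= 1 -> 1 <= den w y.
Proof.
intros h hy; induction h as [|a w ha hw IH]; simpl; [lra|].
pose proof (cf_range w y hw hy). apply INR_ge1 in ha. nra.
Qed.

Lemma q_ge1 w : pos_word w -> 1 <= q w.
Proof. intros; apply den_ge1; auto; lra. Qed.

Lemma cf_app u v y : cf (u ++ v) y = cf u (cf v y).
Proof. induction u as [|a u IH]; simpl; congruence. Qed.

Lemma den_app u v y : den (u ++ v) y = den u (cf v y) * den v y.
Proof. induction u as [|a u IH]; simpl; [ring|]. rewrite IH, cf_app; ring. Qed.

(** The map y -> [cf w y] is a Möbius transformation of determinant 1 or -1 whose denominator at y
    is [den w y]. *)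
Lemma cf_diff w y z : pos_word w -> 0 <= y <= 1 -> 0 <= z <= 1 ->
  Rabs (cf w y - cf w z) = Rabs (y - z) / (den w y * den w z).
Proof.
intros h hy hz; induction h as [|a w ha hw IH]; simpl; [field|].
pose proof (cf_range w y hw hy). pose proof (cf_range w z hw hz).
pose proof (den_ge1 w y hw hy). pose proof (den_ge1 w z hw hz).
apply INR_ge1 in ha.
replace (/ (INR a + cf w y) - / (INR a + cf w z)) with
  (- ((cf w y - cf w z) * / ((INR a + cf w y) * (INR a + cf w z)))) by (field; lra).
rewrite Rabs_Ropp, Rabs_mult, IH, (Rabs_pos_eq (/ _)).
- field; lra.
- apply Rlt_le, Rinv_0_lt_compat; nra.
Qed.

Lemma den_cons2 a b w y : (1 <= b)%nat -> pos_word w -> 0 <= y <= 1 ->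
  den (a :: b :: w) y = INR a * den (b :: w) y + den w y.
Proof.
intros hb hw hy. simpl. pose proof (cf_range w y hw hy). apply INR_ge1 in hb.
field. lra.
Qed.

(** The recurrence [den_cons2] of the continuants has nonnegative coefficients and looks two digits
    ahead, so the bounds are proved at once for w and for every a :: w. *)
Lemma den_bounds w y : pos_word w -> 0 <= y <= 1 -> q w <= den w y <= 2 * q w.
Proof.
intros hw hy; unfold q.
cut ((den w 0 <= den w y <= 2 * den w 0) /\
  forall a, (1 <= a)%nat -> den (a :: w) 0 <= den (a :: w) y <= 2 * den (a :: w) 0).
{ tauto. }
induction hw as [|b w hb hw [IH1 IH2]].
- split; [simpl; lra|]. intros a ha; apply INR_ge1 in ha; simpl. lra.
- split; auto. intros a ha. specialize (IH2 b hb).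
  rewrite !(den_cons2 a b) by (auto; lra). apply INR_ge1 in ha. split; nra.
Qed.

Lemma pos_word_app u v : pos_word (u ++ v) <-> pos_word u /\ pos_word v.
Proof. apply Forall_app. Qed.

Lemma q_app u v : pos_word u -> pos_word v -> q u * q v <= q (u ++ v) <= 2 * q u * q v.
Proof.
intros hu hv. unfold q at 3 4. rewrite den_app. fold (q v).
pose proof (cf_range v 0 hv ltac:(lra)).
pose proof (den_bounds u (cf v 0) hu H). pose proof (q_ge1 v hv). nra.
Qed.

Lemma q_single a : q [a] = INR a.
Proof. unfold q; simpl; ring. Qed.

Fixpoint wprod (w : list nat) : R :=
  match w with nil => 1 | a :: w => INR a * wprod w end.

Lemma wprod_ge1 w : pos_word w -> 1 <= wprod w.
Proof. intros h; induction h as [|a w ha hw IH]; simpl; [lra|]. apply INR_ge1 in ha. nra. Qed.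

Lemma wprod_le_q w : pos_word w -> wprod w <= q w.
Proof.
intros h; induction h as [|a w ha hw IH]; unfold q; simpl; [lra|].
pose proof (wprod_ge1 w hw). pose proof (q_ge1 w hw).
pose proof (cf_range w 0 hw ltac:(lra)). apply INR_ge1 in ha. unfold q in *. nra.
Qed.

Lemma q_le_pow w M : pos_word w -> Forall (fun a => (a <= M)%nat) w ->
  q w <= (INR M + 1) ^ length w.
Proof.
intros h hM; induction h as [|a w ha hw IH]; unfold q; simpl; [lra|].
inversion hM; subst. specialize (IH H2). apply le_INR in H1.
pose proof (cf_range w 0 hw ltac:(lra)). pose proof (q_ge1 w hw). unfold q in *.
apply Rmult_le_compat; try lra. pose proof (pos_INR a); lra.
Qed.

(** The same two-step induction: by [den_cons2] two more digits at least double the continuant. *)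
Lemma q_ge_pow2 w : pos_word w -> 2 ^ Nat.div2 (length w) <= q w.
Proof.
intros hw.
cut (2 ^ Nat.div2 (length w) <= q w /\
  forall a, (1 <= a)%nat -> 2 ^ Nat.div2 (length (a :: w)) <= q (a :: w)).
{ tauto. }
induction hw as [|b w hb hw [IH1 IH2]].
- split; [unfold q; simpl; lra|]. intros a ha; apply INR_ge1 in ha; rewrite q_single; simpl. lra.
- split; auto. intros a ha. specialize (IH2 b hb).
  unfold q in *. rewrite den_cons2 by (auto; lra).
  assert (den w 0 <= den (b :: w) 0).
  { simpl. pose proof (cf_range w 0 hw ltac:(lra)). apply INR_ge1 in hb.
    pose proof (den_ge1 w 0 hw ltac:(lra)). nra. }
  apply INR_ge1 in ha. change (Nat.div2 (length (a :: b :: w))) with (S (Nat.div2 (length w))).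
  rewrite <- tech_pow_Rmult.
  set (X := den (b :: w) 0) in *. set (Y := den w 0) in *.
  assert (X <= INR a * X) by (pose proof (pow_lt 2 (Nat.div2 (length w)) ltac:(lra)); nra).
  lra.
Qed.

(** * Digits of a point, and the point with given digits *)

Lemma Int_part_add n y : 0 <= y < 1 -> Int_part (INR n + y) = Z.of_nat n.
Proof.
intros h. pose proof (base_Int_part (INR n + y)) as [h1 h2].
rewrite INR_IZR_INZ in h1, h2.
assert (IZR (Int_part (IZR (Z.of_nat n) + y)) < IZR (Z.of_nat n + 1)) as a1
  by (rewrite plus_IZR; lra).
assert (IZR (Z.of_nat n) < IZR (Int_part (IZR (Z.of_nat n) + y) + 1)) as a2
  by (rewrite plus_IZR; lra).
apply lt_IZR in a1. apply lt_IZR in a2. rewrite INR_IZR_INZ. lia.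
Qed.

Definition digit (x : R) (i : nat) : nat := Z.to_nat (pq (S i) x).

Definition gtail (n : nat) (x : R) : R := Nat.iter n gauss x.

Lemma irrational_inv x : irrational x -> irrational (/ x).
Proof.
intros h [a [b [hb e]]]. apply h.
destruct (Z.eq_dec a 0) as [->|ha].
- exists 0%Z, 1%Z. split; [lia|]. rewrite <- (Rinv_inv x), e. unfold Rdiv.
  rewrite !Rmult_0_l. apply Rinv_0.
- exists b, a. split; auto. rewrite <- (Rinv_inv x), e.
  apply not_0_IZR in ha. apply not_0_IZR in hb. field; auto.
Qed.

Lemma irrational_sub x n : irrational x -> irrational (x - IZR n).
Proof.
intros h [a [b [hb e]]]. apply h. exists (a + n * b)%Z, b. split; auto.
rewrite plus_IZR, mult_IZR. apply not_0_IZR in hb.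
replace x with (x - IZR n + IZR n) by ring. rewrite e. field; auto.
Qed.

Lemma gauss_irrational x : 0 < x < 1 -> irrational x ->
  0 < gauss x < 1 /\ irrational (gauss x).
Proof.
intros hx h. assert (hi : irrational (gauss x)) by (apply irrational_sub, irrational_inv, h).
split; auto. unfold gauss in *.
pose proof (base_Int_part (/ x)) as [h1 h2].
assert (/ x - IZR (Int_part (/ x)) <> 0).
{ intros e. apply hi. exists 0%Z, 1%Z. split; [lia|]. lra. }
lra.
Qed.

Lemma gtail_irrational x n : 0 < x < 1 -> irrational x ->
  0 < gtail n x < 1 /\ irrational (gtail n x).
Proof.
intros hx h; induction n as [|n [IH1 IH2]]; [auto|].
apply gauss_irrational; auto.
Qed.

Lemma digit_step x n : 0 < x < 1 -> irrational x ->
  (1 <= digit x n)%nat /\ gtail n x = / (INR (digit x n) + gtail (S n) x) /\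
  pq (S n) x = Z.of_nat (digit x n).
Proof.
intros hx h. destruct (gtail_irrational x n hx h) as [[h1 h2] hi].
assert (hp : pq (S n) x = Int_part (/ gtail n x)).
{ unfold pq, gtail. simpl Nat.sub. rewrite Nat.sub_0_r. reflexivity. }
assert (hge : (1 <= Int_part (/ gtail n x))%Z).
{ pose proof (base_Int_part (/ gtail n x)) as [g1 g2].
  assert (1 < / gtail n x) by (rewrite <- Rinv_1; apply Rinv_lt_contravar; lra).
  assert (IZR 0 < IZR (Int_part (/ gtail n x))) as g by lra. apply lt_IZR in g. lia. }
unfold digit. rewrite hp. split; [lia|]. split; [|lia].
rewrite INR_IZR_INZ, Z2Nat.id by lia.
change (gtail (S n) x) with (gauss (gtail n x)). unfold gauss.
replace (IZR (Int_part (/ gtail n x)) + (/ gtail n x - IZR (Int_part (/ gtail n x))))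
  with (/ gtail n x) by ring.
symmetry; apply Rinv_inv.
Qed.

Definition prefix (d : nat -> nat) (n : nat) : list nat := map d (seq 0 n).

Lemma prefix_S d n : prefix d (S n) = prefix d n ++ [d n].
Proof. unfold prefix. rewrite seq_S, map_app. reflexivity. Qed.

Lemma prefix_length d n : length (prefix d n) = n.
Proof. unfold prefix. rewrite length_map, length_seq; auto. Qed.

Lemma prefix_positive d n : (forall i, (1 <= d i)%nat) -> pos_word (prefix d n).
Proof. intros h. apply Forall_map, Forall_forall; auto. Qed.

Lemma cf_digits x n : 0 < x < 1 -> irrational x -> x = cf (prefix (digit x) n) (gtail n x).
Proof.
intros hx h; induction n as [|n IH]; [reflexivity|].
rewrite prefix_S, cf_app.
change (cf [digit x n] (gtail (S n) x)) with (/ (INR (digit x n) + gtail (S n) x)).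
destruct (digit_step x n hx h) as [_ [e _]]. rewrite <- e. exact IH.
Qed.

Lemma prefix_add d m n : prefix d (m + n) = prefix d m ++ map d (seq m n).
Proof. unfold prefix. rewrite seq_app, map_app. reflexivity. Qed.

Definition shift (n : nat) (d : nat -> nat) : nat -> nat := fun i => d (n + i)%nat.

Lemma map_seq_shift d m n : map d (seq m n) = prefix (shift m d) n.
Proof.
revert m. unfold prefix, shift. intros m.
rewrite <- (map_map (fun i => (m + i)%nat) d). f_equal.
induction n as [|n IH]; auto. rewrite !seq_S, map_app, IH. reflexivity.
Qed.

Lemma pow_half_small eps : 0 < eps -> exists N, forall n, (N <= n)%nat -> (/ 2) ^ n < eps.
Proof.
intros h. destruct (pow_lt_1_zero (/ 2) ltac:(rewrite Rabs_pos_eq; lra) eps h) as [N hN].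
exists N. intros n hn. specialize (hN n hn).
rewrite Rabs_pos_eq in hN; auto. apply pow_le; lra.
Qed.

Lemma cf_lip w y z : pos_word w -> 0 <= y <= 1 -> 0 <= z <= 1 ->
  Rabs (cf w y - cf w z) <= Rabs (y - z) / (q w * q w).
Proof.
intros hw hy hz. rewrite cf_diff by auto.
pose proof (den_bounds w y hw hy). pose proof (den_bounds w z hw hz).
pose proof (q_ge1 w hw).
apply Rmult_le_compat_l; [apply Rabs_pos|].
apply Rinv_le_contravar; nra.
Qed.

Lemma cf_lip_lower w y z : pos_word w -> 0 <= y <= 1 -> 0 <= z <= 1 ->
  Rabs (y - z) / (4 * (q w * q w)) <= Rabs (cf w y - cf w z).
Proof.
intros hw hy hz. rewrite cf_diff by auto.
pose proof (den_bounds w y hw hy). pose proof (den_bounds w z hw hz).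
pose proof (q_ge1 w hw).
apply Rmult_le_compat_l; [apply Rabs_pos|].
apply Rinv_le_contravar; nra.
Qed.

Lemma cf_convergents_near d n k : (forall i, (1 <= d i)%nat) ->
  Rabs (cf (prefix d (n + k)) 0 - cf (prefix d n) 0) <= (/ 2) ^ Nat.div2 n.
Proof.
intros hd. rewrite prefix_add, cf_app, map_seq_shift.
assert (h1 := prefix_positive d n hd).
assert (h2 : pos_word (prefix (shift n d) k)) by (apply prefix_positive; intros; apply hd).
pose proof (cf_range _ 0 h2 ltac:(lra)) as h3.
eapply Rle_trans; [apply cf_lip; auto; lra|].
pose proof (q_ge_pow2 _ h1) as h4. rewrite prefix_length in h4.
pose proof (q_ge1 _ h1). rewrite pow_inv.
apply Rle_trans with (1 * / q (prefix d n)).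
- apply Rmult_le_compat.
  + apply Rabs_pos.
  + apply Rlt_le, Rinv_0_lt_compat; nra.
  + apply Rabs_le; lra.
  + apply Rinv_le_contravar; nra.
- rewrite Rmult_1_l. apply Rinv_le_contravar; auto. apply pow_lt; lra.
Qed.

Definition xof (d : nat -> nat) : R := real (Lim_seq (fun n => cf (prefix d n) 0)).

Lemma xof_lim d : (forall i, (1 <= d i)%nat) ->
  is_lim_seq (fun n => cf (prefix d n) 0) (xof d).
Proof.
intros hd. apply Lim_seq_correct', ex_lim_seq_cauchy_corr.
intros eps. destruct (pow_half_small (eps / 2)) as [N hN]; [destruct eps; simpl; lra|].
exists (2 * N)%nat. intros n m hn hm.
assert (hc : forall k, (2 * N <= k)%nat ->
  Rabs (cf (prefix d k) 0 - cf (prefix d (2 * N)) 0) < eps / 2).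
{ intros k hk. replace k with (2 * N + (k - 2 * N))%nat by lia.
  eapply Rle_lt_trans; [apply cf_convergents_near; auto|].
  apply hN. rewrite Nat.div2_double; auto. }
pose proof (hc n hn). pose proof (hc m hm).
replace (_ - _) with ((cf (prefix d n) 0 - cf (prefix d (2 * N)) 0)
  - (cf (prefix d m) 0 - cf (prefix d (2 * N)) 0)) by ring.
eapply Rle_lt_trans; [apply Rabs_triang|]. rewrite Rabs_Ropp. lra.
Qed.

Lemma shift_pos n d : (forall i, (1 <= d i)%nat) -> forall i, (1 <= shift n d i)%nat.
Proof. intros h i; apply h. Qed.

Lemma xof_range0 d : (forall i, (1 <= d i)%nat) -> 0 <= xof d <= 1.
Proof.
intros hd. pose proof (xof_lim d hd) as h.
assert (hr : forall n, 0 <= cf (prefix d n) 0 <= 1)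
  by (intros; apply cf_range; [apply prefix_positive; auto|lra]).
split.
- apply (is_lim_seq_le (fun _ => 0) _ 0 (xof d)) in h; auto.
  + intros; apply hr.
  + apply is_lim_seq_const.
- apply (is_lim_seq_le _ (fun _ => 1) (xof d) 1) in h; auto.
  + intros; apply hr.
  + apply is_lim_seq_const.
Qed.

Lemma xof_cons d : (forall i, (1 <= d i)%nat) -> xof d = / (INR (d 0%nat) + xof (shift 1 d)).
Proof.
intros hd.
pose proof (xof_lim _ (shift_pos 1 d hd)) as h1.
pose proof (xof_range0 _ (shift_pos 1 d hd)) as hr.
pose proof (INR_ge1 _ (hd 0%nat)).
pose proof (xof_lim d hd) as h2. apply is_lim_seq_incr_1 in h2.
assert (h3 : is_lim_seq (fun n => cf (prefix d (S n)) 0) (/ (INR (d 0%nat) + xof (shift 1 d)))).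
{ apply is_lim_seq_ext with (fun n => / (INR (d 0%nat) + cf (prefix (shift 1 d) n) 0)).
  - intros n. rewrite <- map_seq_shift. reflexivity.
  - apply (is_lim_seq_inv _ (INR (d 0%nat) + xof (shift 1 d))).
    + apply is_lim_seq_plus'; auto. apply is_lim_seq_const.
    + intros e; injection e; lra. }
apply is_lim_seq_unique in h2. apply is_lim_seq_unique in h3.
rewrite h2 in h3. injection h3; auto.
Qed.

Lemma xof_range d : (forall i, (1 <= d i)%nat) -> 0 < xof d < 1.
Proof.
assert (h0 : forall d, (forall i, (1 <= d i)%nat) -> 0 < xof d).
{ intros d' hd. rewrite xof_cons by auto. apply Rinv_0_lt_compat.
  pose proof (xof_range0 _ (shift_pos 1 d' hd)). pose proof (INR_ge1 _ (hd 0%nat)). lra. }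
intros hd; split; [auto|].
rewrite xof_cons by auto. pose proof (h0 _ (shift_pos 1 d hd)).
pose proof (INR_ge1 _ (hd 0%nat)). apply Rlt_le_trans with (/ 1); [apply Rinv_lt_contravar; lra|lra].
Qed.

Lemma gauss_xof d : (forall i, (1 <= d i)%nat) ->
  gauss (xof d) = xof (shift 1 d) /\ Int_part (/ xof d) = Z.of_nat (d 0%nat).
Proof.
intros hd. pose proof (xof_range _ (shift_pos 1 d hd)) as h.
unfold gauss. rewrite (xof_cons d), Rinv_inv by auto.
rewrite Int_part_add by lra. split; auto. rewrite <- INR_IZR_INZ. ring.
Qed.

Lemma shift_shift m n d i : shift m (shift n d) i = shift (n + m) d i.
Proof. unfold shift. f_equal. lia. Qed.

Lemma xof_ext d d' : (forall i, d i = d' i) -> xof d = xof d'.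
Proof.
intros h. unfold xof. f_equal. apply Lim_seq_ext. intros n. unfold prefix.
f_equal. apply map_ext; auto.
Qed.

Lemma iter_gauss_xof d n : (forall i, (1 <= d i)%nat) ->
  Nat.iter n gauss (xof d) = xof (shift n d).
Proof.
intros hd; induction n as [|n IH]; simpl.
- apply xof_ext; auto.
- rewrite IH. destruct (gauss_xof (shift n d)) as [-> _]; [apply shift_pos; auto|].
  apply xof_ext. intros i. rewrite shift_shift. f_equal. lia.
Qed.

Lemma pq_xof d n : (forall i, (1 <= d i)%nat) -> pq (S n) (xof d) = Z.of_nat (d n).
Proof.
intros hd. unfold pq. simpl Nat.sub. rewrite Nat.sub_0_r, iter_gauss_xof by auto.
destruct (gauss_xof (shift n d)) as [_ ->]; [apply shift_pos; auto|].
unfold shift. rewrite Nat.add_0_r. auto.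
Qed.

Lemma xof_prefix d n : (forall i, (1 <= d i)%nat) ->
  xof d = cf (prefix d n) (xof (shift n d)).
Proof.
intros hd; induction n as [|n IH].
- simpl. apply xof_ext; auto.
- rewrite prefix_S, cf_app. simpl cf. rewrite IH. f_equal.
  rewrite xof_cons by (apply shift_pos; auto). unfold shift at 1. rewrite Nat.add_0_r.
  do 2 f_equal. apply xof_ext. intros i. rewrite shift_shift. f_equal. lia.
Qed.

(* Descent on the denominator: if [x = a/b] then the Gauss map sends [x] to a fraction with denominator [a < b]. *)
Lemma xof_irrational d : (forall i, (1 <= d i)%nat) -> irrational (xof d).
Proof.
intros hd [a [b [hb e]]].
assert (main : forall n d a b, (Z.to_nat b <= n)%nat -> (0 < b)%Z ->
  (forall i, (1 <= d i)%nat) -> xof d = IZR a / IZR b -> False).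
{ clear. induction n as [|n IH]; intros d a b hn hb hd e; [lia|].
  pose proof (xof_range d hd) as hr. pose proof (IZR_lt _ _ hb) as hb'.
  assert (ha : (0 < a)%Z).
  { apply lt_IZR. apply (Rmult_lt_reg_r (/ IZR b)); [apply Rinv_0_lt_compat; lra|].
    unfold Rdiv in e. rewrite <- e. lra. }
  assert (hab : (a < b)%Z).
  { apply lt_IZR. apply (Rmult_lt_reg_r (/ IZR b)); [apply Rinv_0_lt_compat; lra|].
    unfold Rdiv in e. rewrite <- e, Rinv_r; lra. }
  apply (IH (shift 1 d) (b - Z.of_nat (d 0%nat) * a)%Z a); auto.
  - lia.
  - apply shift_pos; auto.
  - pose proof (xof_range _ (shift_pos 1 d hd)) as h2. pose proof (IZR_lt _ _ ha) as ha'.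
    rewrite (xof_cons d hd) in e. pose proof (INR_ge1 _ (hd 0%nat)).
    rewrite minus_IZR, mult_IZR, <- INR_IZR_INZ.
    apply (f_equal Rinv) in e. rewrite Rinv_inv in e.
    replace (xof (shift 1 d)) with (INR (d 0%nat) + xof (shift 1 d) - INR (d 0%nat)) by ring.
    rewrite e. field. lra. }
destruct (Z_lt_le_dec 0 b) as [h|h].
- apply (main _ d a b (le_n _) h hd e).
- apply (main _ d (- a)%Z (- b)%Z (le_n _) ltac:(lia) hd).
  rewrite e, !opp_IZR. apply not_0_IZR in hb. field; auto.
Qed.

(* If a digit 1 is never followed by a large digit, the tails stay away from 1 *)
Definition spaced (M : nat) (d : nat -> nat) : Prop :=
  (forall i, (1 <= d i)%nat) /\ forall i, d i = 1%nat -> (d (S i) <= M)%nat.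

Lemma spaced_shift M n d : spaced M d -> spaced M (shift n d).
Proof.
intros [h1 h2]; split; [apply shift_pos; auto|]. unfold shift; intros i.
rewrite Nat.add_succ_r. auto.
Qed.

(** A first digit of at least 2 gives a value at most 1/2; after a first digit 1 comes a digit at
    most M, so the tail is at least 1/(M+1). *)
Lemma spaced_gap M d : spaced M d -> xof d <= 1 - / (INR M + 2).
Proof.
intros [h1 h2]. rewrite xof_cons by auto.
pose proof (xof_range _ (shift_pos 1 d h1)) as hr. pose proof (pos_INR M).
assert (hM : / (INR M + 2) <= / 2) by (apply Rinv_le_contravar; lra).
destruct (le_lt_dec 2 (d 0%nat)) as [h|h].
- apply le_INR in h. simpl in h.
  apply Rle_trans with (/ 2); [apply Rinv_le_contravar; lra|lra].
- assert (e : d 0%nat = 1%nat) by (specialize (h1 0%nat); lia).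
  rewrite e. simpl INR. specialize (h2 0%nat e).
  assert (hx : / (INR M + 1) <= xof (shift 1 d)).
  { rewrite xof_cons by (apply shift_pos; auto). unfold shift at 1. simpl Nat.add.
    pose proof (xof_range _ (shift_pos 1 _ (shift_pos 1 d h1))).
    apply le_INR in h2. pose proof (INR_ge1 _ (h1 1%nat)). apply Rinv_le_contravar; lra. }
  assert (0 < / (INR M + 1)) by (apply Rinv_0_lt_compat; lra).
  apply Rle_trans with (/ (1 + / (INR M + 1))); [apply Rinv_le_contravar; lra|].
  apply Req_le. field. lra.
Qed.

(** Points with neighbouring digits a and a+1 could be arbitrarily close, if the tail z behind a
    were near 1 and the tail z' behind a+1 near 0. The gap 1 - z >= 1/(M+2) excludes this: D + z' -
    z >= D/(M+2) when the digits differ by D >= 1. *)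
Lemma spaced_dist M d d' n : spaced M d -> spaced M d' ->
  prefix d n = prefix d' n -> (d n < d' n)%nat ->
  INR (d' n - d n) / (4 * (q (prefix d n) * q (prefix d n)) * (INR M + 2) *
     (INR (d n) + 1) * (INR (d' n) + 1))
  <= Rabs (xof d - xof d').
Proof.
intros h h' e hlt.
assert (hp := proj1 h). assert (hp' := proj1 h').
rewrite (xof_prefix d n hp), (xof_prefix d' n hp'), <- e.
assert (hw := prefix_positive d n hp).
pose proof (xof_range _ (shift_pos n d hp)) as r1.
pose proof (xof_range _ (shift_pos n d' hp')) as r2.
eapply Rle_trans; [|apply cf_lip_lower; auto; lra].
pose proof (q_ge1 _ hw) as hq. set (Q := q (prefix d n)) in *.
rewrite (xof_cons (shift n d)), (xof_cons (shift n d')) by (apply shift_pos; auto).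
pose proof (xof_range _ (shift_pos 1 _ (shift_pos n d hp))) as r3.
pose proof (xof_range _ (shift_pos 1 _ (shift_pos n d' hp'))) as r4.
pose proof (spaced_gap M _ (spaced_shift M 1 _ (spaced_shift M n _ h))) as g.
set (z := xof (shift 1 (shift n d))) in *. set (z' := xof (shift 1 (shift n d'))) in *.
unfold shift at 1. unfold shift at 1. rewrite Nat.add_0_r.
pose proof (INR_ge1 _ (hp n)) as a1. pose proof (INR_ge1 _ (hp' n)) as a2.
assert (a3 : 1 <= INR (d' n - d n)) by (apply INR_ge1; lia).
assert (a4 : INR (d' n) = INR (d n) + INR (d' n - d n)) by (rewrite <- plus_INR; f_equal; lia).
set (a := INR (d n)) in *. set (a' := INR (d' n)) in *. set (D := INR (d' n - d n)) in *.
pose proof (pos_INR M).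
replace (/ (a + z) - / (a' + z')) with ((D + z' - z) * / ((a + z) * (a' + z')))
  by (rewrite a4; field; rewrite a4 in *; split; lra).
assert (hM : 0 < / (INR M + 2)) by (apply Rinv_0_lt_compat; lra).
assert (hM2 : / (INR M + 2) <= / 2) by (apply Rinv_le_contravar; lra).
assert (hnum : D * / (INR M + 2) <= D + z' - z) by nra.
assert (hden : / ((a + 1) * (a' + 1)) <= / ((a + z) * (a' + z')))
  by (apply Rinv_le_contravar; nra).
assert (0 < / ((a + 1) * (a' + 1))) by (apply Rinv_0_lt_compat; nra).
rewrite Rabs_pos_eq by (apply Rmult_le_pos; nra).
replace (D / (4 * (Q * Q) * (INR M + 2) * (a + 1) * (a' + 1))) with
  ((D * / (INR M + 2)) * / ((a + 1) * (a' + 1)) / (4 * (Q * Q)))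
  by (field; repeat split; lra).
apply Rmult_le_compat_r; [apply Rlt_le, Rinv_0_lt_compat; nra|].
apply Rmult_le_compat; nra.
Qed.

(** * Sums over words *)

Fixpoint sumR {A : Type} (f : A -> R) (l : list A) : R :=
  match l with nil => 0 | a :: l => f a + sumR f l end.

Lemma sumR_ext {A} (f g : A -> R) l : (forall a, In a l -> f a = g a) -> sumR f l = sumR g l.
Proof. induction l as [|a l IH]; simpl; intros h; auto. rewrite h, IH; auto. Qed.

Lemma sumR_le {A} (f g : A -> R) l : (forall a, In a l -> f a <= g a) -> sumR f l <= sumR g l.
Proof.
induction l as [|a l IH]; simpl; intros h; [lra|]. apply Rplus_le_compat; auto.
Qed.

Lemma sumR_nonneg {A} (f : A -> R) l : (forall a, In a l -> 0 <= f a) -> 0 <= sumR f l.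
Proof.
induction l as [|a l IH]; simpl; intros h; [lra|].
pose proof (h a (or_introl eq_refl)). pose proof (IH (fun b hb => h b (or_intror hb))). lra.
Qed.

Lemma sumR_app {A} (f : A -> R) l l' : sumR f (l ++ l') = sumR f l + sumR f l'.
Proof. induction l as [|a l IH]; simpl; [|rewrite IH]; ring. Qed.

Lemma sumR_scal {A} (f : A -> R) c l : sumR (fun a => c * f a) l = c * sumR f l.
Proof. induction l as [|a l IH]; simpl; [|rewrite IH]; ring. Qed.

Lemma sumR_plus {A} (f g : A -> R) l : sumR (fun a => f a + g a) l = sumR f l + sumR g l.
Proof. induction l as [|a l IH]; simpl; [|rewrite IH]; ring. Qed.

Lemma sumR_const {A} c (l : list A) : sumR (fun _ => c) l = INR (length l) * c.
Proof.
induction l as [|a l IH]; [simpl; ring|]. cbn [sumR length]. rewrite IH, S_INR. ring.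
Qed.

Lemma sumR_map {A B} (f : B -> R) (g : A -> B) l : sumR f (map g l) = sumR (fun a => f (g a)) l.
Proof. induction l as [|a l IH]; simpl; [|rewrite IH]; auto. Qed.

Lemma sumR_flat_map {A B} (f : B -> R) (g : A -> list B) l :
  sumR f (flat_map g l) = sumR (fun a => sumR f (g a)) l.
Proof. induction l as [|a l IH]; simpl; auto. rewrite sumR_app, IH; auto. Qed.

Lemma sumR_swap {A B} (f : A -> B -> R) l l' :
  sumR (fun a => sumR (f a) l') l = sumR (fun b => sumR (fun a => f a b) l) l'.
Proof.
induction l as [|a l IH]; simpl.
- rewrite sumR_const; ring.
- rewrite IH, sumR_plus. auto.
Qed.

Lemma sumR_incl {A} (f : A -> R) l l' : NoDup l -> incl l l' ->
  (forall a, In a l' -> 0 <= f a) -> sumR f l <= sumR f l'.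
Proof.
intros h; revert l'; induction h as [|a l ha hl IH]; intros l' hi hf.
- apply sumR_nonneg; auto.
- destruct (in_split a l') as [l1 [l2 e]]; [apply hi; simpl; auto|]. subst l'.
  simpl. rewrite sumR_app. simpl.
  assert (sumR f l <= sumR f (l1 ++ l2)).
  { apply IH.
    - intros b hb. assert (hb' := hi b (or_intror hb)).
      apply in_app_iff in hb'. apply in_app_iff. destruct hb' as [|[<-|]]; tauto.
    - intros b hb. apply hf. apply in_app_iff in hb. apply in_app_iff. simpl; tauto. }
  rewrite sumR_app in H. lra.
Qed.

Fixpoint words (M n : nat) : list (list nat) :=
  match n with
  | O => [nil]
  | S n => flat_map (fun w => map (fun a => a :: w) (seq 1 M)) (words M n)
  end.

Lemma In_words M n w :
  In w (words M n) <-> length w = n /\ Forall (fun a => (1 <= a <= M)%nat) w.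
Proof.
revert w; induction n as [|n IH]; intros w; simpl.
- split; [intros [<-|[]]; auto|]. intros [h _]. destruct w; [auto|discriminate].
- rewrite in_flat_map. split.
  + intros [v [hv hw]]. apply in_map_iff in hw. destruct hw as [a [<- ha]].
    apply in_seq in ha. apply IH in hv. destruct hv as [<- hv]. split; auto.
    constructor; auto. lia.
  + intros [h1 h2]. destruct w as [|a v]; [discriminate|]. inversion h2; subst.
    exists v. split; [apply IH; auto|]. apply in_map_iff. exists a. split; auto.
    apply in_seq. lia.
Qed.

Lemma words_pos M n w : In w (words M n) -> pos_word w.
Proof.
intros h. apply In_words in h. eapply Forall_impl; [|apply h]. simpl; intros; lia.
Qed.

Lemma NoDup_flat_map {A B} (g : A -> list B) l : NoDup l -> (forall a, In a l -> NoDup (g a)) ->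
  (forall a b x, In x (g a) -> In x (g b) -> a = b) -> NoDup (flat_map g l).
Proof.
intros h; induction h as [|a l ha hl IH]; simpl; intros h1 h2; [constructor|].
apply NoDup_app; auto.
intros x hx hx'. apply in_flat_map in hx'. destruct hx' as [b [hb hx']].
rewrite (h2 a b x hx hx') in ha. auto.
Qed.

Lemma NoDup_words M n : NoDup (words M n).
Proof.
induction n as [|n IH]; simpl; [repeat constructor; auto|].
apply NoDup_flat_map; auto.
- intros w _. apply Injective_map_NoDup; [|apply seq_NoDup]. intros a b e. congruence.
- intros u v x hu hv. apply in_map_iff in hu. apply in_map_iff in hv.
  destruct hu as [a [<- _]]. destruct hv as [b [e _]]. congruence.
Qed.

Lemma sumR_words_S f M n :
  sumR f (words M (S n)) = sumR (fun w => sumR (fun a => f (a :: w)) (seq 1 M)) (words M n).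
Proof.
simpl. rewrite sumR_flat_map. apply sumR_ext. intros w _. apply sumR_map.
Qed.

Lemma sumR_words_app f M m n :
  sumR f (words M (m + n)) = sumR (fun u => sumR (fun v => f (u ++ v)) (words M n)) (words M m).
Proof.
revert f; induction m as [|m IH]; intros f.
- simpl. rewrite Rplus_0_r. apply sumR_ext; auto.
- simpl Nat.add. rewrite !sumR_words_S, IH. apply sumR_ext. intros u _.
  rewrite <- sumR_swap. auto.
Qed.

Lemma words_mono M M' n : (M <= M')%nat -> incl (words M n) (words M' n).
Proof.
intros h w hw. apply In_words in hw. apply In_words. destruct hw as [h1 h2]. split; auto.
eapply Forall_impl; [|exact h2]. simpl; intros; lia.
Qed.

Lemma Rpower_anti x y e : 0 < x <= y -> 0 <= e -> Rpower y (- e) <= Rpower x (- e).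
Proof.
intros h he. rewrite !Rpower_Ropp. apply Rinv_le_contravar; [apply Rpower_gt0|].
apply Rle_Rpower_l; lra.
Qed.

Lemma Rpower_mult_l x y e : 0 < x -> 0 < y -> Rpower (x * y) e = Rpower x e * Rpower y e.
Proof. intros. symmetry. apply Rpower_mult_distr; auto. Qed.

Lemma ln_le_sub1 x : 0 < x -> ln x <= x - 1.
Proof. intros h. pose proof (exp_ineq1_le (ln x)). rewrite exp_ln in H; lra. Qed.

(** Comparison with the integral of x^(-1-eps). *)
Lemma zeta_sum eps M : 0 < eps ->
  sumR (fun a => Rpower (INR a) (- (1 + eps))) (seq 1 M) <= 1 + / eps.
Proof.
intros he. assert (hi : 0 < / eps) by (apply Rinv_0_lt_compat; auto).
destruct M as [|M]; [simpl; lra|].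
(* Subtracting the tail of the integral makes the statement inductive; the induction step rests on
   ln(y+1) - ln y >= 1/(y+1). *)
assert (main : sumR (fun a => Rpower (INR a) (- (1 + eps))) (seq 1 (S M))
   <= 1 + / eps - / eps * Rpower (INR (S M)) (- eps)).
{ induction M as [|M IH].
  - simpl. assert (e : forall z, Rpower 1 z = 1)
      by (intros; unfold Rpower; rewrite ln_1, Rmult_0_r; apply exp_0).
    rewrite !e. lra.
  - rewrite seq_S, sumR_app. simpl Nat.add. cbn [sumR].
    enough (Rpower (INR (S (S M))) (- (1 + eps)) <=
       / eps * (Rpower (INR (S M)) (- eps) - Rpower (INR (S (S M))) (- eps))) by lra.
    assert (hy : 1 <= INR (S M)) by (apply INR_ge1; lia).
    rewrite (S_INR (S M)). set (y := INR (S M)) in *.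
    apply (Rmult_le_reg_l eps); auto. rewrite <- Rmult_assoc, Rinv_r, Rmult_1_l by lra.
    replace (- (1 + eps)) with (- (1) + - eps) by ring.
    rewrite Rpower_plus, Rpower_Ropp, Rpower_1 by lra.
    assert (hl : ln y <= ln (y + 1) - / (y + 1)).
    { replace y with ((y + 1) * (y / (y + 1))) at 1 by (field; lra).
      rewrite ln_mult; [|lra|apply Rdiv_lt_0_compat; lra].
      pose proof (ln_le_sub1 (y / (y + 1)) ltac:(apply Rdiv_lt_0_compat; lra)) as h.
      replace (y / (y + 1) - 1) with (- / (y + 1)) in h by (field; lra). lra. }
    assert (hp : Rpower (y + 1) (- eps) * (1 + eps * / (y + 1)) <= Rpower y (- eps)).
    { apply Rle_trans with (Rpower (y + 1) (- eps) * exp (eps * / (y + 1))).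
      - apply Rmult_le_compat_l; [apply Rlt_le, Rpower_gt0|apply exp_ineq1_le].
      - unfold Rpower. rewrite <- exp_plus.
        assert (hh : - eps * ln (y + 1) + eps * / (y + 1) <= - eps * ln y) by nra.
        destruct hh as [hh| ->]; [apply Rlt_le, exp_increasing; auto|lra]. }
    lra. }
pose proof (Rpower_gt0 (INR (S M)) (- eps)). nra.
Qed.

Lemma sum_words_wprod eps M n : 0 < eps ->
  sumR (fun w => Rpower (wprod w) (- (1 + eps))) (words M n) <= (1 + / eps) ^ n.
Proof.
intros he. assert (hi : 0 < / eps) by (apply Rinv_0_lt_compat; auto).
induction n as [|n IH].
- simpl. unfold Rpower. rewrite ln_1, Rmult_0_r, exp_0. lra.
- rewrite sumR_words_S. simpl pow.
  apply Rle_trans with (sumR (fun w => (1 + / eps) * Rpower (wprod w) (- (1 + eps))) (words M n)).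
  + apply sumR_le. intros w hw. apply words_pos in hw. pose proof (wprod_ge1 w hw).
    rewrite (sumR_ext _ (fun a => Rpower (wprod w) (- (1 + eps)) * Rpower (INR a) (- (1 + eps)))).
    * rewrite sumR_scal, Rmult_comm. apply Rmult_le_compat_r; [apply Rlt_le, Rpower_gt0|].
      apply zeta_sum; auto.
    * intros a ha. apply in_seq in ha. pose proof (INR_ge1 a ltac:(lia)). simpl wprod.
      rewrite Rpower_mult_l by lra. ring.
  + rewrite sumR_scal. apply Rmult_le_compat_l; lra.
Qed.

Definition wterm (Q tau : R) (w : list nat) : R :=
  if Rle_dec (wprod w) Q then Rpower (wprod w) (- tau) else 0.

Lemma wterm_nonneg Q tau w : 0 <= wterm Q tau w.
Proof. unfold wterm. destruct Rle_dec; [apply Rlt_le, Rpower_gt0|lra]. Qed.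

(** Rankin's trick: where the product P of the digits is at most Q, P^(-tau) <= Q^(1+eps-tau)
    P^(-(1+eps)), and the right side sums over all words. *)
Lemma sum_words_wterm eps M n Q tau : 0 < eps -> tau <= 1 + eps -> 1 <= Q ->
  sumR (wterm Q tau) (words M n) <= Rpower Q (1 + eps - tau) * (1 + / eps) ^ n.
Proof.
intros he ht hQ. pose proof (Rpower_gt0 Q (1 + eps - tau)).
apply Rle_trans with (sumR (fun w => Rpower Q (1 + eps - tau) * Rpower (wprod w) (- (1 + eps)))
  (words M n)).
- apply sumR_le. intros w hw. apply words_pos, wprod_ge1 in hw. unfold wterm.
  destruct Rle_dec as [h|h].
  + replace (- tau) with ((1 + eps - tau) + - (1 + eps)) by ring. rewrite Rpower_plus.
    apply Rmult_le_compat_r; [apply Rlt_le, Rpower_gt0|]. apply Rle_Rpower_l; lra.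
  + apply Rmult_le_pos; apply Rlt_le; [auto|apply Rpower_gt0].
- rewrite sumR_scal. apply Rmult_le_compat_l; [lra|]. apply sum_words_wprod; auto.
Qed.

(** The sum Z_n cut off at digits up to M. Bounds uniform in M stand for the infinite sum. *)
Definition Zsum (M n : nat) (s : R) : R := sumR (fun w => Rpower (q w) (- (2 * s))) (words M n).

Lemma Zsum_nonneg M n s : 0 <= Zsum M n s.
Proof. apply sumR_nonneg. intros; apply Rlt_le, Rpower_gt0. Qed.

Lemma Zsum_le_zeta M n s : / 2 < s -> Zsum M n s <= (1 + / (2 * s - 1)) ^ n.
Proof.
intros h. eapply Rle_trans; [|apply (sum_words_wprod (2 * s - 1) M n); lra].
apply sumR_le. intros w hw. apply words_pos in hw.
replace (- (1 + (2 * s - 1))) with (- (2 * s)) by ring.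
pose proof (wprod_ge1 w hw). pose proof (wprod_le_q w hw). apply Rpower_anti; lra.
Qed.

Lemma Zsum_app M m n s : 0 <= s -> Zsum M (m + n) s <= Zsum M m s * Zsum M n s.
Proof.
intros hs. unfold Zsum at 1. rewrite sumR_words_app.
replace (Zsum M m s * Zsum M n s) with
  (sumR (fun u => Zsum M n s * Rpower (q u) (- (2 * s))) (words M m))
  by (rewrite sumR_scal; apply Rmult_comm).
apply sumR_le. intros u hu. rewrite (Rmult_comm (Zsum M n s)).
unfold Zsum. rewrite <- sumR_scal.
apply sumR_le. intros v hv. apply words_pos in hu. apply words_pos in hv.
pose proof (q_ge1 u hu). pose proof (q_ge1 v hv). pose proof (q_app u v hu hv).
rewrite <- Rpower_mult_l by lra. apply Rpower_anti; nra.
Qed.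

Lemma Zsum_mono M M' n s : (M <= M')%nat -> Zsum M n s <= Zsum M' n s.
Proof.
intros h. apply sumR_incl; [apply NoDup_words|apply words_mono; auto|].
intros; apply Rlt_le, Rpower_gt0.
Qed.

(** Passing from s to t multiplies the term of w by q(w)^(2(s-t)), and q(w) is exponentially large
    in n. *)
Lemma Zsum_compare M n s t : t <= s ->
  Rpower 2 (2 * INR (Nat.div2 n) * (s - t)) * Zsum M n s <= Zsum M n t.
Proof.
intros h. unfold Zsum. rewrite <- sumR_scal. apply sumR_le. intros w hw.
assert (hl : length w = n) by (apply In_words in hw; tauto). apply words_pos in hw.
pose proof (q_ge_pow2 w hw) as hq. rewrite hl in hq.
rewrite <- Rpower_pow in hq by lra.
replace (- (2 * t)) with (2 * (s - t) + - (2 * s)) by ring. rewrite Rpower_plus.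
apply Rmult_le_compat_r; [apply Rlt_le, Rpower_gt0|].
replace (2 * INR (Nat.div2 n) * (s - t)) with (INR (Nat.div2 n) * (2 * (s - t))) by ring.
rewrite <- Rpower_mult. apply Rle_Rpower_l; [lra|]. split; [apply Rpower_gt0|auto].
Qed.

Lemma telescope_sum x M : 0 <= x ->
  sumR (fun a => (1 + x) / ((INR a + x) * (INR a + 1 + x))) (seq 1 M) = 1 - (1 + x) / (INR M + 1 + x).
Proof.
intros hx. induction M as [|M IH].
- simpl. field. lra.
- rewrite seq_S, sumR_app, IH. cbn [sumR]. simpl Nat.add. rewrite S_INR.
  pose proof (pos_INR M). field. lra.
Qed.

(* With [h w = (den^2 (1 + cf w 0))^(-s)], the sum of [h (a :: w)] over [a <= M] is at least [h w]: at [s = 1] the terms telescope, and lowering [s] multiplies each by at least [2^(1-s)]. *)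
Lemma Zsum_ge1 s : 0 < s < 1 -> exists M0, forall M n, (M0 <= M)%nat -> 1 <= Zsum M n s.
Proof.
intros hs.
set (L := Rpower 2 (1 - s)).
assert (hL : 1 < L).
{ apply Rle_lt_trans with (Rpower 2 0); [rewrite Rpower_O; lra|apply Rpower_lt; lra]. }
destruct (INR_unbounded (2 * L / (L - 1))) as [M0 hM0].
exists M0. intros M n hM.
assert (hM1 : 2 * L / (L - 1) < INR M) by (apply le_INR in hM; lra).
assert (hML : 2 * L < INR M * (L - 1)).
{ apply (Rmult_lt_compat_r (L - 1)) in hM1; [|lra].
  replace (2 * L / (L - 1) * (L - 1)) with (2 * L) in hM1 by (field; lra). lra. }
set (h := fun w => Rpower (q w * q w * (1 + cf w 0)) (- s)).
apply Rle_trans with (sumR h (words M n)).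
- induction n as [|n IH].
  + simpl. unfold h, q. simpl. replace (1 * 1 * (1 + 0)) with 1 by ring.
    unfold Rpower. rewrite ln_1, Rmult_0_r, exp_0. lra.
  + apply Rle_trans with (1 := IH). rewrite sumR_words_S. apply sumR_le. intros w hw.
    apply words_pos in hw. pose proof (q_ge1 w hw) as hq.
    pose proof (cf_range w 0 hw ltac:(lra)) as hx. set (x := cf w 0) in *.
    rewrite (sumR_ext _ (fun a => h w * Rpower ((1 + x) / ((INR a + x) * (INR a + 1 + x))) s)).
    * rewrite sumR_scal. rewrite <- (Rmult_1_r (h w)) at 1.
      apply Rmult_le_compat_l; [apply Rlt_le, Rpower_gt0|].
      apply Rle_trans with (L * (1 - (1 + x) / (INR M + 1 + x))).
      { apply (Rmult_le_reg_r (INR M + 1 + x)); [pose proof (pos_INR M); lra|].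
        pose proof (pos_INR M).
        replace (L * (1 - (1 + x) / (INR M + 1 + x)) * (INR M + 1 + x)) with (L * INR M)
          by (field; lra).
        nra. }
      rewrite <- telescope_sum, <- sumR_scal by lra.
      apply sumR_le. intros a ha. apply in_seq in ha. pose proof (INR_ge1 a ltac:(lia)) as ha1.
      set (T := (1 + x) / ((INR a + x) * (INR a + 1 + x))).
      assert (hT : 0 < T) by (apply Rdiv_lt_0_compat; nra).
      assert (hT2 : T <= / 2).
      { unfold T. apply (Rmult_le_reg_r ((INR a + x) * (INR a + 1 + x))); [nra|].
        unfold Rdiv. rewrite Rmult_assoc, Rinv_l, Rmult_1_r by nra. nra. }
      replace s with (1 + - (1 - s)) at 1 by ring. rewrite Rpower_plus, Rpower_1 by auto.
      rewrite Rmult_comm. apply Rmult_le_compat_l; [lra|].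
      apply Rle_trans with (Rpower (/ 2) (- (1 - s))); [|apply Rpower_anti; lra].
      apply Req_le. unfold L. rewrite Rpower_Ropp. unfold Rpower.
      rewrite ln_Rinv, <- exp_Ropp by lra. f_equal. ring.
    * intros a ha. apply in_seq in ha. pose proof (INR_ge1 a ltac:(lia)) as ha1.
      unfold h. unfold q at 1 2. simpl den. simpl cf. fold (q w). fold x.
      set (T := (1 + x) / ((INR a + x) * (INR a + 1 + x))).
      assert (hT : 0 < T) by (apply Rdiv_lt_0_compat; nra).
      replace (Rpower T s) with (Rpower (/ T) (- s)).
      2:{ unfold Rpower. rewrite ln_Rinv by auto. f_equal. ring. }
      assert (0 < / T) by (apply Rinv_0_lt_compat; auto).
      rewrite <- Rpower_mult_l by nra. f_equal. unfold T. field. repeat split; nra.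
- apply sumR_le. intros w hw. apply words_pos in hw. pose proof (q_ge1 w hw).
  pose proof (cf_range w 0 hw ltac:(lra)). unfold h.
  replace (- (2 * s)) with ((1 + 1) * - s) by ring.
  rewrite <- Rpower_mult, Rpower_plus, Rpower_1 by lra.
  apply Rpower_anti; nra.
Qed.

(** * Hausdorff measure *)

Lemma diam_bounds (U : R -> Prop) r : (forall x y, U x -> U y -> Rabs (x - y) <= r) ->
  0 <= r -> 0 <= diam U <= r.
Proof.
intros h hr. unfold diam.
set (A := fun r => exists x y, U x /\ U y /\ r = Rabs (x - y)).
pose proof (Lub_Rbar_correct A) as [h1 h2].
assert (hub : Rbar_le (Lub_Rbar A) r).
{ apply h2. intros z [x [y [hx [hy ->]]]]. simpl. auto. }
destruct (Lub_Rbar A) as [d| |] eqn:e; simpl in *; try lra; try tauto.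
split; auto.
destruct (classic (exists x, U x)) as [[x hx]|hn].
- assert (h0 : Rbar_le 0 d).
  { apply h1. exists x, x. rewrite Rminus_diag, Rabs_R0. auto. }
  exact h0.
(* On an empty set [m_infty] is an upper bound, so the least one cannot be finite. *)
- exfalso. apply (h2 m_infty). intros z [x [y [hx _]]]. exfalso; eauto.
Qed.

Lemma dist_le_diam (U : R -> Prop) r x y : (forall x y, U x -> U y -> Rabs (x - y) <= r) ->
  U x -> U y -> Rabs (x - y) <= diam U.
Proof.
intros h hx hy. unfold diam.
set (A := fun r => exists x y, U x /\ U y /\ r = Rabs (x - y)).
pose proof (Lub_Rbar_correct A) as [h1 h2].
assert (hub : Rbar_le (Lub_Rbar A) r).
{ apply h2. intros z [u [v [hu [hv ->]]]]. simpl. auto. }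
assert (hlb : Rbar_le (Rabs (x - y)) (Lub_Rbar A)) by (apply h1; exists x, y; auto).
destruct (Lub_Rbar A) as [d| |]; simpl in *; try tauto.
Qed.

Lemma dpow_nonneg d s : 0 <= dpow d s.
Proof. unfold dpow. destruct Rlt_dec; [apply Rlt_le, Rpower_gt0|lra]. Qed.

Lemma dpow_mono d e s : 0 <= s -> d <= e -> dpow d s <= dpow e s.
Proof.
intros hs h. unfold dpow. destruct (Rlt_dec 0 d), (Rlt_dec 0 e); try lra.
- apply Rle_Rpower_l; lra.
- apply Rlt_le, Rpower_gt0.
Qed.

Lemma dpow_pos d s : 0 < d -> dpow d s = Rpower d s.
Proof. intros h. unfold dpow. destruct Rlt_dec; auto; lra. Qed.

Definition small_cover (delta : R) (E : R -> Prop) (U : nat -> R -> Prop) : Prop :=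
  (forall i x y, U i x -> U i y -> Rabs (x - y) <= delta) /\ (forall x, E x -> exists i, U i x).

Lemma sum_n_sumR (a : nat -> R) K : sum_n a K = sumR a (seq 0 (S K)).
Proof.
induction K as [|K IH].
- rewrite sum_O. symmetry. apply Rplus_0_r.
- rewrite sum_Sn, IH, (seq_S (S K)), sumR_app. cbn [sumR]. rewrite Rplus_0_r. auto.
Qed.

Lemma series_nonneg a v : (forall i, 0 <= a i) -> is_series a v -> 0 <= v.
Proof.
intros h hs. change (Rbar_le 0 v).
apply (is_lim_seq_le (fun _ => 0) (sum_n a) 0 v); [|apply is_lim_seq_const|exact hs].
intros n; induction n as [|n IH]; [rewrite sum_O; auto|].
rewrite sum_Sn. unfold plus; simpl. pose proof (h (S n)). lra.
Qed.

Lemma partial_sum_le a v K : (forall i, 0 <= a i) -> is_series a v -> sum_n a K <= v.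
Proof.
intros h hs. apply (is_lim_seq_incr_compare (sum_n a) v hs).
intros n. rewrite sum_Sn. unfold plus; simpl. pose proof (h (S n)). lra.
Qed.

Lemma hausdorff_delta_nonneg s delta E : Rbar_le 0 (hausdorff_delta s delta E).
Proof.
unfold hausdorff_delta. apply (proj2 (Glb_Rbar_correct _)).
intros v [U [_ [_ h]]]. simpl. eapply series_nonneg; [|exact h]. intros; apply dpow_nonneg.
Qed.

Lemma bounded_series a eps : (forall i, 0 <= a i) -> (forall K, sum_n a K <= eps) ->
  exists v, is_series a v /\ v <= eps.
Proof.
intros h1 h2.
assert (hc : ex_finite_lim_seq (sum_n a)).
{ apply (ex_finite_lim_seq_incr _ eps); auto. intros n. rewrite sum_Sn.
  unfold plus; simpl. pose proof (h1 (S n)). lra. }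
destruct hc as [v hv]. exists v. split; [exact hv|].
apply (is_lim_seq_le _ (fun _ => eps) v eps) in hv; auto. apply is_lim_seq_const.
Qed.

Lemma measure_zero_intro s E :
  (forall delta eps, 0 < delta -> 0 < eps -> exists U, small_cover delta E U /\
     forall K, sum_n (fun i => dpow (diam (U i)) s) K <= eps) ->
  hausdorff_measure s E = Finite 0.
Proof.
intros h. unfold hausdorff_measure.
assert (hd : forall delta, 0 < delta -> hausdorff_delta s delta E = Finite 0).
{ intros delta hdelta. pose proof (hausdorff_delta_nonneg s delta E) as h0.
  assert (hle : forall eps, 0 < eps -> Rbar_le (hausdorff_delta s delta E) eps).
  { intros eps heps. destruct (h delta eps hdelta heps) as [U [[h1 h2] h3]].
    destruct (bounded_series _ eps (fun i => dpow_nonneg (diam (U i)) s) h3) as [v [hv hle]].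
    apply Rbar_le_trans with v; [|exact hle].
    apply (proj1 (Glb_Rbar_correct _)). exists U. auto. }
  destruct (hausdorff_delta s delta E) as [d| |].
  - f_equal. simpl in h0. destruct h0 as [h0|h0]; [|auto].
    specialize (hle (d / 2) ltac:(lra)). simpl in hle. lra.
  - specialize (hle 1 ltac:(lra)). destruct hle.
  - destruct h0. }
unfold Rbar_lub. destruct Rbar_ex_lub as [m [m1 m2]]. simpl.
apply Rbar_le_antisym.
- apply m2. intros v [delta [hdelta ->]]. rewrite hd by auto. apply Rbar_le_refl.
- apply m1. exists 1. split; [lra|]. symmetry; apply hd; lra.
Qed.

Lemma measure_zero_elim s E delta eps : hausdorff_measure s E = Finite 0 ->
  0 < delta -> 0 < eps -> exists U v, small_cover delta E U /\
     is_series (fun i => dpow (diam (U i)) s) v /\ v < eps.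
Proof.
intros h hdelta heps. unfold hausdorff_measure, Rbar_lub in h.
destruct Rbar_ex_lub as [m [m1 m2]]. simpl in h. subst m.
assert (hle : Rbar_le (hausdorff_delta s delta E) 0) by (apply m1; exists delta; auto).
apply NNPP. intros hn.
assert (hc : Rbar_le eps (hausdorff_delta s delta E)).
{ apply (proj2 (Glb_Rbar_correct _)). intros v [U [h1 [h2 h3]]]. simpl.
  destruct (Rle_lt_dec eps v); auto. exfalso. apply hn. exists U, v. split; [split|]; auto. }
pose proof (Rbar_le_trans _ _ _ hc hle) as hf. simpl in hf. lra.
Qed.

Lemma measure_zero_mono s E F : (forall x, E x -> F x) ->
  hausdorff_measure s F = Finite 0 -> hausdorff_measure s E = Finite 0.
Proof.
intros hEF h. apply measure_zero_intro. intros delta eps hd he.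
destruct (measure_zero_elim s F delta eps h hd he) as [U [v [[h1 h2] [h3 h4]]]].
exists U. split; [split; auto|]. intros K.
assert (hK : sum_n (fun i => dpow (diam (U i)) s) K <= v).
{ apply partial_sum_le; auto. intros; apply dpow_nonneg. }
lra.
Qed.

Lemma dim_le s E : 0 < s -> hausdorff_measure s E = Finite 0 -> Rbar_le (hausdorff_dim E) s.
Proof. intros h1 h2. apply (proj1 (Glb_Rbar_correct _)). auto. Qed.

Lemma dim_ge t E : (forall s, 0 < s -> hausdorff_measure s E = Finite 0 -> t <= s) ->
  Rbar_le t (hausdorff_dim E).
Proof. intros h. apply (proj2 (Glb_Rbar_correct _)). intros s [h1 h2]. simpl. auto. Qed.

Lemma dim_mono E F : (forall x, E x -> F x) -> Rbar_le (hausdorff_dim E) (hausdorff_dim F).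
Proof.
intros h. apply (proj2 (Glb_Rbar_correct _)). intros s [h1 h2].
apply (dim_le s); auto. apply (measure_zero_mono s E F); auto.
Qed.

Module Enumeration.
Import all_boot.

(** An index (n, i, u, v) names a piece of a cover: a position n, the n - 1 digits u before it, and
    either the first i digits v of the block at n, or, with v empty, the integer part i of the
    logarithm of the digit at n. *)
Definition index := (nat * nat * list nat * list nat)%type.

Lemma index_enumeration : exists f : nat -> option index,
  (forall t, exists i, f i = Some t) /\ (forall i j t, f i = Some t -> f j = Some t -> i = j).
Proof.
exists (pickle_inv : nat -> option (nat * nat * list nat * list nat)).
split=> [t | i j t hi hj]; first by exists (pickle t); apply: pickleK_inv.
have := pickle_invK (T := (nat * nat * list nat * list nat)%type) i.
have := pickle_invK (T := (nat * nat * list nat * list nat)%type) j.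
by rewrite hi hj => /= <-.
Qed.

End Enumeration.
Import Enumeration.

Definition somes {T} (o : option T) : list T := match o with Some t => [t] | None => [] end.

(** The form in which the covers are given: pieces indexed by words, bounds r in place of exact
    diameters, finite sums in place of a series. *)
Lemma measure_zero_index s E : 0 <= s ->
  (forall delta eps, 0 < delta -> 0 < eps -> exists (U : index -> R -> Prop) (r : index -> R),
    (forall t x y, U t x -> U t y -> Rabs (x - y) <= r t) /\
    (forall t, 0 <= r t <= delta) /\
    (forall x, E x -> exists t, U t x) /\
    (forall L, NoDup L -> sumR (fun t => dpow (r t) s) L <= eps)) ->
  hausdorff_measure s E = Finite 0.
Proof.
intros hs h. destruct index_enumeration as [index_at [index_at_surj index_at_inj]].
apply measure_zero_intro. intros delta eps hdelta heps.
destruct (h delta eps hdelta heps) as [U [r [h1 [h2 [h3 h4]]]]].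
exists (fun i x => match index_at i with Some t => U t x | None => False end).
split; [split|].
- intros i x y. destruct (index_at i) as [t|]; [|tauto]. intros hx hy.
  specialize (h1 t x y hx hy). specialize (h2 t). lra.
- intros x hx. destruct (h3 x hx) as [t ht]. destruct (index_at_surj t) as [i hi].
  exists i. rewrite hi. auto.
- intros K. set (L := flat_map (fun i => somes (index_at i)) (seq 0 (S K))).
  assert (hL : NoDup L).
  { apply NoDup_flat_map.
    - apply seq_NoDup.
    - intros i _. destruct (index_at i); simpl; repeat constructor; auto.
    - intros i j t hi hj. unfold somes in *.
      destruct (index_at i) as [a|] eqn:ei; [destruct hi as [hi|[]]|destruct hi].
      destruct (index_at j) as [b|] eqn:ej; [destruct hj as [hj|[]]|destruct hj]. subst.
      eapply index_at_inj; eauto. }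
  eapply Rle_trans; [|apply (h4 L hL)]. unfold L. rewrite sumR_flat_map.
  rewrite sum_n_sumR. apply sumR_le. intros i _. destruct (index_at i) as [t|] eqn:ei; simpl.
  + rewrite Rplus_0_r. apply dpow_mono; auto. apply diam_bounds; [apply h1|apply h2].
  + assert (hz : 0 <= diam (fun _ => False) <= 0) by (apply diam_bounds; [tauto|lra]).
    replace (diam (fun _ => False)) with 0 by lra. unfold dpow. destruct Rlt_dec; lra.
Qed.

(** N intervals of length 1/N cost N^(1-s), which tends to 0 for s > 1. The bound makes the
    dimensions finite, so that they can be compared as real numbers. *)
Lemma dim_unit_le1 E : (forall x, E x -> 0 < x < 1) -> Rbar_le (hausdorff_dim E) 1.
Proof.
intros hE.
assert (hs : forall s, 1 < s -> hausdorff_measure s E = Finite 0).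
{ intros s hs. apply measure_zero_intro. intros delta eps hd he.
  set (c := Rmax (/ delta) (Rpower eps (- / (s - 1)))).
  destruct (INR_unbounded c) as [N hN].
  assert (hc : 0 < c) by (eapply Rlt_le_trans; [|apply Rmax_l]; apply Rinv_0_lt_compat; auto).
  assert (hN0 : 0 < INR N) by lra.
  assert (hNd : / INR N <= delta).
  { rewrite <- (Rinv_inv delta). apply Rinv_le_contravar; [apply Rinv_0_lt_compat; auto|].
    pose proof (Rmax_l (/ delta) (Rpower eps (- / (s - 1)))). fold c in H. lra. }
  assert (hNe : INR N * Rpower (/ INR N) s <= eps).
  { rewrite <- (Rpower_1 (INR N)) at 1 by auto.
    replace (Rpower (/ INR N) s) with (Rpower (INR N) (- s))
      by (unfold Rpower; rewrite ln_Rinv by auto; f_equal; ring).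
    rewrite <- Rpower_plus. replace (1 + - s) with (- (s - 1)) by ring.
    apply Rle_trans with (Rpower (Rpower eps (- / (s - 1))) (- (s - 1))).
    - apply Rpower_anti; [|lra]. split; [apply Rpower_gt0|].
      pose proof (Rmax_r (/ delta) (Rpower eps (- / (s - 1)))). fold c in H. lra.
    - rewrite Rpower_mult. replace (- / (s - 1) * - (s - 1)) with 1 by (field; lra).
      rewrite Rpower_1; lra. }
  exists (fun i x => (i < N)%nat /\ INR i / INR N <= x <= (INR i + 1) / INR N).
  assert (hdiff : forall i x y, ((i < N)%nat /\ INR i / INR N <= x <= (INR i + 1) / INR N) ->
     ((i < N)%nat /\ INR i / INR N <= y <= (INR i + 1) / INR N) -> Rabs (x - y) <= / INR N).
  { intros i x y [_ hx] [_ hy]. replace ((INR i + 1) / INR N) with (INR i / INR N + / INR N) in *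
      by (field; lra). apply Rabs_le. lra. }
  split; [split|].
  - intros i x y hx hy. eapply Rle_trans; [eapply (hdiff i x y); eauto|auto].
  - intros x hx. apply hE in hx.
    exists (Z.to_nat (Int_part (x * INR N))).
    pose proof (base_Int_part (x * INR N)) as [b1 b2].
    assert (hp : (0 <= Int_part (x * INR N))%Z).
    { assert (IZR (-1) < IZR (Int_part (x * INR N))) as hh by nra. apply lt_IZR in hh. lia. }
    assert (hi : INR (Z.to_nat (Int_part (x * INR N))) = IZR (Int_part (x * INR N)))
      by (rewrite INR_IZR_INZ, Z2Nat.id; auto).
    split.
    + apply INR_lt. rewrite hi. nra.
    + rewrite hi. split.
      * apply (Rmult_le_reg_r (INR N)); auto. unfold Rdiv.
        rewrite Rmult_assoc, Rinv_l; lra.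
      * apply (Rmult_le_reg_r (INR N)); auto. unfold Rdiv.
        rewrite Rmult_assoc, Rinv_l; lra.
  - intros K. apply Rle_trans with (INR N * Rpower (/ INR N) s); auto.
    assert (hN1 : 0 < / INR N) by (apply Rinv_0_lt_compat; auto).
    assert (main : sum_n (fun i => dpow (diam (fun x => (i < N)%nat /\
       INR i / INR N <= x <= (INR i + 1) / INR N)) s) K <= INR (Nat.min (S K) N) * Rpower (/ INR N) s).
    { assert (h1 : forall i, dpow (diam (fun x => (i < N)%nat /\
         INR i / INR N <= x <= (INR i + 1) / INR N)) s <= Rpower (/ INR N) s).
      { intros i. rewrite <- (dpow_pos (/ INR N)) by auto. apply dpow_mono; [lra|].
        apply diam_bounds; [apply hdiff|lra]. }
      assert (h2 : forall i, (N <= i)%nat -> dpow (diam (fun x => (i < N)%nat /\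
         INR i / INR N <= x <= (INR i + 1) / INR N)) s <= 0).
      { intros i hi. apply Rle_trans with (dpow 0 s).
        - apply dpow_mono; [lra|]. apply diam_bounds; [|lra].
          intros x y [hx _]; exfalso; lia.
        - unfold dpow. destruct Rlt_dec; lra. }
      assert (0 < N)%nat by (apply INR_lt; auto).
      rewrite sum_n_sumR. induction K as [|K IH].
      - cbn [seq sumR]. replace (Nat.min 1 N) with 1%nat by lia. rewrite INR_1.
        specialize (h1 0%nat). lra.
      - rewrite (seq_S (S K)), sumR_app. cbn [sumR]. simpl (0 + S K)%nat.
        destruct (le_lt_dec N (S K)) as [hK|hK].
        + specialize (h2 (S K) hK). replace (Nat.min (S (S K)) N) with (Nat.min (S K) N) by lia. lra.
        + replace (Nat.min (S (S K)) N) with (S (Nat.min (S K) N)) by lia.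
          rewrite (S_INR (Nat.min (S K) N)). specialize (h1 (S K)). lra. }
    eapply Rle_trans; [exact main|]. apply Rmult_le_compat_r; [apply Rlt_le, Rpower_gt0|].
    apply le_INR. lia. }
destruct (hausdorff_dim E) as [d| |] eqn:e.
- simpl. destruct (Rle_lt_dec d 1); auto. exfalso.
  pose proof (dim_le ((1 + d) / 2) E ltac:(lra) (hs ((1 + d) / 2) ltac:(lra))) as h.
  rewrite e in h. simpl in h. lra.
- pose proof (dim_le 2 E ltac:(lra) (hs 2 ltac:(lra))) as h. rewrite e in h. destruct h.
- exact I.
Qed.

(** * Mass distribution on a tree of words *)

Definition cat {A : Type} (F : nat -> list A) (k : nat) : list A := concat (map F (seq 0 k)).

(** The first [S n] blocks contain entry n as soon as no block is empty. The construction serves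
    twice: it strings words into digits and plans into steps. *)
Definition flat {A : Type} (x0 : A) (F : nat -> list A) (n : nat) : A := nth n (cat F (S n)) x0.

Lemma cat_S {A} (F : nat -> list A) k : cat F (S k) = cat F k ++ F k.
Proof. unfold cat. rewrite seq_S, map_app, concat_app. simpl. rewrite app_nil_r. auto. Qed.

Lemma cat_length_ge {A} (F : nat -> list A) k :
  (forall i, (1 <= length (F i))%nat) -> (k <= length (cat F k))%nat.
Proof.
intros h; induction k as [|k IH]; [lia|]. rewrite cat_S, length_app. specialize (h k). lia.
Qed.

Lemma cat_split {A} (F : nat -> list A) j k : (j <= k)%nat -> exists r, cat F k = cat F j ++ r.
Proof.
intros h; induction h as [|k h [r IH]].
- exists nil. rewrite app_nil_r; auto.
- exists (r ++ F k). rewrite cat_S, IH, app_assoc. auto.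
Qed.

Lemma flat_nth {A} (x0 : A) F k n : (forall i, (1 <= length (F i))%nat) ->
  (n < length (cat F k))%nat -> flat x0 F n = nth n (cat F k) x0.
Proof.
intros hF hn. unfold flat. pose proof (cat_length_ge F (S n) hF) as hl.
destruct (le_lt_dec (S n) k) as [h|h].
- destruct (cat_split F (S n) k h) as [r ->]. rewrite app_nth1; auto.
- destruct (cat_split F k (S n) ltac:(lia)) as [r ->]. rewrite app_nth1; auto.
Qed.

Lemma flat_block {A} (x0 : A) F k j : (forall i, (1 <= length (F i))%nat) ->
  (j < length (F k))%nat -> flat x0 F (length (cat F k) + j) = nth j (F k) x0.
Proof.
intros hF hj. rewrite (flat_nth x0 F (S k)); auto.
- rewrite cat_S, app_nth2 by lia. f_equal. lia.
- rewrite cat_S, length_app. lia.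
Qed.

Lemma flat_decomp {A} (F : nat -> list A) n : (forall i, (1 <= length (F i))%nat) ->
  exists k j, (j < length (F k))%nat /\ n = (length (cat F k) + j)%nat.
Proof.
intros hF. induction n as [|n [k [j [h1 h2]]]].
- exists 0%nat, 0%nat. split; [apply hF|reflexivity].
- destruct (le_lt_dec (length (F k)) (S j)) as [h|h].
  + exists (S k), 0%nat. split; [apply hF|]. rewrite cat_S, length_app. lia.
  + exists k, (S j). split; [auto|lia].
Qed.

Lemma map_seq_block {A} (x0 : A) (f : nat -> A) n l i :
  (forall j, (j < i)%nat -> f (n + j)%nat = nth j l x0) -> (i <= length l)%nat ->
  map f (seq n i) = firstn i l.
Proof.
intros h hi. apply (nth_ext _ _ x0 x0).
- rewrite length_map, length_seq, length_firstn. lia.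
- intros j hj. rewrite length_map, length_seq in hj.
  rewrite (nth_indep _ x0 (f 0%nat)) by (rewrite length_map, length_seq; auto).
  rewrite map_nth, seq_nth by auto. rewrite h by auto.
  rewrite nth_firstn. destruct (Nat.ltb_spec j i); [auto|lia].
Qed.

Lemma map_flat {A} (x0 : A) F k : (forall i, (1 <= length (F i))%nat) ->
  map (flat x0 F) (seq 0 (length (cat F k))) = cat F k.
Proof.
intros hF. rewrite (map_seq_block x0 _ 0 (cat F k)); auto.
- apply firstn_all.
- intros j hj. simpl. apply flat_nth; auto.
Qed.

Lemma first_diff (w w' : list nat) : length w = length w' -> w <> w' ->
  exists i, (i < length w)%nat /\ firstn i w = firstn i w' /\ nth i w 0%nat <> nth i w' 0%nat.
Proof.
revert w'; induction w as [|a w IH]; intros [|a' w'] hl hn; simpl in hl; try discriminate.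
- congruence.
- destruct (Nat.eq_dec a a') as [<-|ha].
  + destruct (IH w') as [i [h1 [h2 h3]]]; [lia|congruence|].
    exists (S i). simpl. repeat split; auto; [lia|congruence].
  + exists 0%nat. simpl. repeat split; auto; lia.
Qed.

(** The least and the greatest element serve. This is all that the bounds on distances use about the
    primes, whatever their gaps. *)
Lemma NoDup_spread S : NoDup S -> (2 <= length S)%nat ->
  exists a a' : nat, In a S /\ In a' S /\ (a < a')%nat /\ (length S <= a' - a + 1)%nat.
Proof.
intros hS hl.
assert (hm : forall L : list nat, L <> nil ->
  exists a a', In a L /\ In a' L /\ forall b, In b L -> (a <= b <= a')%nat).
{ induction L as [|x L IH]; [congruence|]. intros _. destruct L as [|y L].
  - exists x, x. simpl. repeat split; auto; destruct H as [->|[]]; auto.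
  - destruct IH as [a [a' [h1 [h2 h3]]]]; [congruence|].
    exists (Nat.min x a), (Nat.max x a'). split; [|split].
    + destruct (Nat.min_dec x a) as [-> | ->]; simpl in *; tauto.
    + destruct (Nat.max_dec x a') as [-> | ->]; simpl in *; tauto.
    + intros b [<-|hb]; [lia|]. specialize (h3 b hb). lia. }
destruct (hm S) as [a [a' [h1 [h2 h3]]]]; [destruct S; simpl in hl; [lia|congruence]|].
assert (hle : (length S <= a' - a + 1)%nat).
{ rewrite <- (length_seq (a' - a + 1) a). apply NoDup_incl_length; auto.
  intros b hb. apply in_seq. specialize (h3 b hb). lia. }
exists a, a'. repeat split; auto. lia.
Qed.

(* [sW] lists the admissible words, of length [slen], and [sp] their probabilities. [sfac] bounds the factor
   by which the step multiplies mass * q^(2t), [slim] the value of that product allowed before the step. *)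
Record step := Step {
  sW : list (list nat);
  sp : list nat -> R;
  slen : nat;
  sfac : R;
  slim : R }.

Section Tree.

Variable A : nat -> step.

Definition valid (om : nat -> list nat) : Prop := forall k, In (om k) (sW (A k)).

(* Nodes are lists of words, latest word first. *)
Fixpoint node (om : nat -> list nat) (k : nat) : list (list nat) :=
  match k with O => nil | S k => om k :: node om k end.

Fixpoint mass (sg : list (list nat)) : R :=
  match sg with nil => 1 | w :: sg => sp (A (length sg)) w * mass sg end.

Definition dig (om : nat -> list nat) : nat -> nat := flat 0%nat om.

Definition pt (om : nat -> list nat) : R := xof (dig om).

Definition meets (U : R -> Prop) (sg : list (list nat)) : Prop :=
  exists om, valid om /\ U (pt om) /\ node om (length sg) = sg.

(* total mass of the descendants of [sg], [j] levels further down, that meet [U] *)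
Fixpoint met (U : R -> Prop) (j : nat) (sg : list (list nat)) : R :=
  match j with
  | O => if excluded_middle_informative (meets U sg) then mass sg else 0
  | S j => sumR (fun w => met U j (w :: sg)) (sW (A (length sg)))
  end.

Lemma node_length om k : length (node om k) = k.
Proof. induction k; simpl; auto. Qed.

Hypothesis sp_nonneg : forall k w, 0 <= sp (A k) w.
Hypothesis sp_sum : forall k, sumR (sp (A k)) (sW (A k)) = 1.

Lemma mass_nonneg sg : 0 <= mass sg.
Proof. induction sg; simpl; [lra|]. apply Rmult_le_pos; auto. Qed.

Lemma met_nonneg U j sg : 0 <= met U j sg.
Proof.
revert sg; induction j as [|j IH]; intros sg; simpl.
- destruct excluded_middle_informative; [apply mass_nonneg|lra].
- apply sumR_nonneg; auto.
Qed.

Lemma meets_child U w sg : meets U (w :: sg) -> meets U sg.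
Proof. intros [om [h1 [h2 h3]]]. exists om. simpl in h3. injection h3; auto. Qed.

(** Above depth D this is the recursion of [met]. From depth D on both truncated differences are 0
    and each node is measured by itself: the probabilities of the children sum to 1, and a node with
    a child that meets U meets U itself. *)
Lemma met_super U D sg :
  sumR (fun w => met U (D - length (w :: sg)) (w :: sg)) (sW (A (length sg)))
  <= met U (D - length sg) sg.
Proof.
simpl length. destruct (le_lt_dec D (length sg)) as [h|h].
- replace (D - S (length sg))%nat with 0%nat by lia.
  replace (D - length sg)%nat with 0%nat by lia. simpl.
  destruct (excluded_middle_informative (meets U sg)) as [hm|hm].
  + apply Rle_trans with (sumR (fun w => mass sg * sp (A (length sg)) w) (sW (A (length sg)))).
    * apply sumR_le. intros w _. pose proof (mass_nonneg sg). pose proof (sp_nonneg (length sg) w).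
      destruct excluded_middle_informative; nra.
    * rewrite sumR_scal, sp_sum. lra.
  + apply Rle_trans with (sumR (fun _ => 0) (sW (A (length sg)))).
    * apply sumR_le. intros w _. destruct excluded_middle_informative as [hw|]; [|lra].
      exfalso. apply hm. eapply meets_child; eauto.
    * rewrite sumR_const. lra.
- replace (D - length sg)%nat with (S (D - S (length sg))) by lia. simpl. lra.
Qed.

Lemma ex_series_dominated (a b : nat -> R) : (forall i, 0 <= a i <= b i) ->
  ex_series b -> ex_series a.
Proof.
intros h [v hv]. destruct (bounded_series a v) as [u [hu _]]; [apply h| |exists u; auto].
intros K. eapply Rle_trans; [|apply (partial_sum_le b v K); auto].
- rewrite !sum_n_sumR. apply sumR_le. intros; apply h.
- intros i. specialize (h i). lra.
Qed.

Lemma Series_sumR {B} (f : B -> nat -> R) l : (forall b, In b l -> ex_series (f b)) ->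
  ex_series (fun i => sumR (fun b => f b i) l) /\
  Series (fun i => sumR (fun b => f b i) l) = sumR (fun b => Series (f b)) l.
Proof.
induction l as [|b l IH]; intros h; simpl.
- assert (hz : is_series (fun _ : nat => 0) 0).
  { destruct (bounded_series (fun _ => 0) 0) as [v [hv hle]]; [intros; lra| |].
    - intros K. rewrite sum_n_sumR, sumR_const. lra.
    - pose proof (series_nonneg (fun _ => 0) v ltac:(intros; lra) hv).
      replace v with 0 in hv; [exact hv|]. apply Rle_antisym; auto. }
  split; [exists 0; auto|apply is_series_unique; auto].
- destruct IH as [h1 h2]; [intros; apply h; simpl; auto|].
  assert (hb := h b (or_introl eq_refl)). split.
  + apply (ex_series_plus (f b)); auto.
  + rewrite Series_plus, h2; auto.
Qed.

(* Descend greedily to a child in which the sets to be avoided carry less than its mass. *)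
Lemma mass_distribution (U : nat -> R -> Prop) (D : nat -> nat) :
  ex_series (fun i => met (U i) (D i) nil) -> Series (fun i => met (U i) (D i) nil) < 1 ->
  exists om, valid om /\ forall i, ~ U i (pt om).
Proof.
intros hex hlt.
set (g := fun sg i => met (U i) (D i - length sg) sg).
set (inv := fun sg => ex_series (g sg) /\ Series (g sg) < mass sg).
assert (h0 : inv nil).
{ split.
  - eapply ex_series_ext; [|exact hex]. intros i. unfold g. simpl. rewrite Nat.sub_0_r. auto.
  - simpl. rewrite (Series_ext _ (fun i => met (U i) (D i) nil)); auto.
    intros i. unfold g. simpl. rewrite Nat.sub_0_r. auto. }
(* If no child kept the invariant, the series of the children would total at least the mass of [sg],
   whereas by [met_super] they total at most the series of [sg]. *)
assert (hstep : forall sg, inv sg -> exists w, In w (sW (A (length sg))) /\ inv (w :: sg)).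
{ intros sg [hs1 hs2]. apply NNPP. intros hn.
  assert (hg : forall w i, In w (sW (A (length sg))) -> 0 <= g (w :: sg) i <= g sg i).
  { intros w i hw. split; [apply met_nonneg|].
    eapply Rle_trans; [|apply met_super].
    apply in_split in hw. destruct hw as [l1 [l2 ->]]. rewrite sumR_app. simpl sumR.
    assert (ha : forall l, 0 <= sumR (fun w0 => met (U i) (D i - length (w0 :: sg)) (w0 :: sg)) l)
      by (intros; apply sumR_nonneg; intros; apply met_nonneg).
    pose proof (ha l1). pose proof (ha l2). unfold g. simpl in *. lra. }
  assert (hx : forall w, In w (sW (A (length sg))) -> ex_series (g (w :: sg))).
  { intros w hw. apply (ex_series_dominated _ (g sg)); auto. }
  destruct (Series_sumR (fun w => g (w :: sg)) (sW (A (length sg))) hx) as [k1 k2].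
  assert (b1 : Series (fun i => sumR (fun w => g (w :: sg) i) (sW (A (length sg)))) <= Series (g sg)).
  { apply Series_le; auto. intros i. split.
    - apply sumR_nonneg. intros w hw. apply hg; auto.
    - apply met_super. }
  assert (b2 : mass sg <= sumR (fun w => Series (g (w :: sg))) (sW (A (length sg)))).
  { rewrite <- (Rmult_1_r (mass sg)), <- (sp_sum (length sg)), <- sumR_scal.
    apply sumR_le. intros w hw. apply Rnot_lt_le. intros hlt'. apply hn.
    exists w. split; auto. split; auto. simpl. lra. }
  lra. }
(* Dependent choice, carried out by iterating a choice function on the nodes that satisfy the
   invariant. *)
set (T := {sg | inv sg}).
set (nxt := fun x : T => let (w, h) := constructive_indefinite_description _ (hstep (proj1_sig x) (proj2_sig x)) in
   exist inv (w :: proj1_sig x) (proj2 h) : T).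
assert (hnxt : forall x, exists w, proj1_sig (nxt x) = w :: proj1_sig x /\
   In w (sW (A (length (proj1_sig x))))).
{ intros x. unfold nxt. destruct constructive_indefinite_description as [w [hw1 hw2]].
  exists w. simpl. auto. }
set (st := fun k => Nat.iter k nxt (exist inv nil h0)).
set (om := fun k => hd nil (proj1_sig (st (S k)))).
assert (hnode : forall k, node om k = proj1_sig (st k)).
{ induction k as [|k IH]; auto. simpl node. rewrite IH. unfold om.
  change (st (S k)) with (nxt (st k)). destruct (hnxt (st k)) as [w [-> _]]. auto. }
assert (hv : valid om).
{ intros k. unfold om. change (st (S k)) with (nxt (st k)).
  destruct (hnxt (st k)) as [w [-> hw]]. simpl.
  rewrite <- hnode, node_length in hw. auto. }
(* If the limit point lay in [U i], the node at depth [D i] would meet [U i], and its full mass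
   would be a single term of a series whose sum is smaller than that mass. *)
exists om. split; auto. intros i hi.
destruct (proj2_sig (st (D i))) as [c1 c2]. rewrite <- hnode in c1, c2.
assert (e : g (node om (D i)) i = mass (node om (D i))).
{ unfold g. rewrite node_length, Nat.sub_diag. simpl.
  destruct excluded_middle_informative as [|hn]; auto. exfalso. apply hn.
  exists om. rewrite node_length. auto. }
assert (hle : g (node om (D i)) i <= Series (g (node om (D i)))).
{ apply Rle_trans with (sum_n (g (node om (D i))) i).
  - rewrite sum_n_sumR, seq_S, sumR_app. cbn [sumR]. simpl Nat.add.
    assert (0 <= sumR (g (node om (D i))) (seq 0 i))
      by (apply sumR_nonneg; intros; apply met_nonneg). lra.
  - apply partial_sum_le; [intros; apply met_nonneg|]. apply Series_correct; auto. }
lra.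
Qed.

(** The mass distribution principle. For s < t, a cover by sets of diameter at most 1 whose s-th
    powers sum to less than 1/(2C) meets less than the whole mass, and so misses a point of E. *)
Lemma dim_ge_of_local_bound (E : R -> Prop) t C : 0 < t -> 0 < C ->
  (forall U d, 0 < d -> (forall x y, U x -> U y -> Rabs (x - y) <= d) ->
     exists D, met U D nil <= C * Rpower d t) ->
  (forall om, valid om -> E (pt om)) -> Rbar_le t (hausdorff_dim E).
Proof.
intros ht hC hloc hE. apply dim_ge. intros s hs hm.
destruct (Rle_lt_dec t s) as [|hst]; auto. exfalso.
destruct (measure_zero_elim s E 1 (/ (2 * C)) hm ltac:(lra)
  ltac:(apply Rinv_0_lt_compat; lra)) as [U [v [[h1 h2] [h3 h4]]]].
(* A set of diameter 0 adds nothing to the sum of the cover, but the local bound needs d > 0; it is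
   applied with d so small that C d^t = 2^(-i)/8. These errors add up to 1/4, and C v < 1/2, so the
   total stays below 1. *)
assert (hD : forall i, exists D, met (U i) D nil <= C * dpow (diam (U i)) s + / 8 * (/ 2) ^ i).
{ intros i. pose proof (diam_bounds (U i) 1 (h1 i) ltac:(lra)) as hb.
  assert (hpw : 0 < (/ 2) ^ i) by (apply pow_lt; lra).
  destruct (Rlt_dec 0 (diam (U i))) as [hd|hd].
  - destruct (hloc (U i) (diam (U i)) hd) as [D hD].
    { intros x y hx hy. eapply dist_le_diam; eauto. }
    exists D. eapply Rle_trans; [exact hD|]. rewrite dpow_pos by auto.
    assert (Rpower (diam (U i)) t <= Rpower (diam (U i)) s).
    { unfold Rpower. assert (hl : ln (diam (U i)) <= 0) by (rewrite <- ln_1; apply ln_le; lra).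
      assert (hh : t * ln (diam (U i)) <= s * ln (diam (U i))) by nra.
      destruct hh as [hh| ->]; [apply Rlt_le, exp_increasing; auto|lra]. }
    nra.
  - set (c := / 8 * (/ 2) ^ i * / C).
    assert (hc : 0 < c) by (unfold c; repeat apply Rmult_lt_0_compat; auto; try lra; apply Rinv_0_lt_compat; auto).
    destruct (hloc (U i) (Rpower c (/ t)) (Rpower_gt0 _ _)) as [D hD].
    { intros x y hx hy. pose proof (dist_le_diam (U i) 1 x y (h1 i) hx hy).
      pose proof (Rpower_gt0 c (/ t)). lra. }
    exists D. eapply Rle_trans; [exact hD|]. rewrite Rpower_mult, Rinv_l, Rpower_1 by lra.
    pose proof (dpow_nonneg (diam (U i)) s). unfold c.
    replace (C * (/ 8 * (/ 2) ^ i * / C)) with (/ 8 * (/ 2) ^ i) by (field; lra). nra. }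
set (D := fun i => proj1_sig (constructive_indefinite_description _ (hD i))).
assert (hD' : forall i, met (U i) (D i) nil <= C * dpow (diam (U i)) s + / 8 * (/ 2) ^ i).
{ intros i. unfold D. destruct constructive_indefinite_description; auto. }
assert (hser : is_series (fun i => C * dpow (diam (U i)) s + / 8 * (/ 2) ^ i) (C * v + / 8 * (/ (1 - / 2)))).
{ apply (is_series_plus (fun i => C * dpow (diam (U i)) s) (fun i => / 8 * (/ 2) ^ i)).
  - apply (is_series_scal_l C (fun i => dpow (diam (U i)) s)); auto.
  - apply (is_series_scal_l (/ 8) (fun i => (/ 2) ^ i)). apply is_series_geom. rewrite Rabs_pos_eq; lra. }
destruct (mass_distribution U D) as [om [hv hom]].
- eapply ex_series_dominated; [|exists (C * v + / 8 * (/ (1 - / 2))); exact hser].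
  intros i. split; [apply met_nonneg|apply hD'].
- apply Rle_lt_trans with (C * v + / 8 * (/ (1 - / 2))).
  + rewrite <- (is_series_unique _ _ hser). apply Series_le.
    * intros i. split; [apply met_nonneg|auto].
    * exists (C * v + / 8 * (/ (1 - / 2))). auto.
  + assert (C * v < / 2).
    { apply (Rmult_lt_compat_l C) in h4; auto.
      replace (C * / (2 * C)) with (/ 2) in h4 by (field; lra). auto. }
    lra.
- destruct (h2 (pt om) (hE om hv)) as [i hi]. exact (hom i hi).
Qed.

End Tree.

(** A word may not end in 1, so that concatenated words stay [spaced]. The default 0 of [nth] is
    never mistaken for a digit 1. *)
Definition spaced_word (M : nat) (w : list nat) : Prop :=
  forall i, nth i w 0%nat = 1%nat -> (S i < length w)%nat /\ (nth (S i) w 0 <= M)%nat.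

(** Boundedly many bounded digits: points that part inside such a word are as far apart as the
    cylinder is long, up to a constant. *)
Definition chunk_kind (M m : nat) (S : step) : Prop :=
  (forall w, In w (sW S) -> Forall (fun a => (a <= M)%nat) w) /\ (slen S <= m)%nat.

(** A set that meets r >= 2 of the digits in P has diameter at least of order r/N^2 times the length
    of the cylinder. This is why mass * q^(2t) must be at most of order (|P|/N^2)^t before the
    step. *)
Definition digit_kind (t : R) (S : step) : Prop :=
  exists P N, sW S = map (fun a => [a]) P /\ NoDup P /\
    (forall a, In a P -> (2 <= a)%nat /\ INR a <= N) /\
    (forall w, sp S w = / INR (length P)) /\
    slim S <= Rpower (INR (length P) / (N * N)) t.

(** The factor 2 in [ok_fac] pays for the constant of [q_app], so that the numbers [sfac] simply
    multiply along a branch. *)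
Record step_ok (M m : nat) (t : R) (S : step) : Prop := StepOk {
  ok_nodup : NoDup (sW S);
  ok_word : forall w, In w (sW S) -> length w = slen S /\ pos_word w /\ spaced_word M w;
  ok_len : (1 <= slen S)%nat;
  ok_sp : forall w, 0 <= sp S w;
  ok_sum : sumR (sp S) (sW S) = 1;
  ok_fac : forall w, In w (sW S) -> sp S w * Rpower (2 * q w) (2 * t) <= sfac S;
  ok_lim : slim S <= 1;
  ok_kind : chunk_kind M m S \/ digit_kind t S }.

Fixpoint pfac (A : nat -> step) (k : nat) : R :=
  match k with O => 1 | S k => pfac A k * sfac (A k) end.

Fixpoint node_word (sg : list (list nat)) : list nat :=
  match sg with nil => nil | w :: sg => node_word sg ++ w end.

Lemma node_word_cat om k : node_word (node om k) = cat om k.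
Proof. induction k as [|k IH]; auto. rewrite cat_S. simpl. rewrite IH. auto. Qed.

Lemma nonzero_sum {B} (f : B -> R) l b : NoDup l -> (forall c, In c l -> c <> b -> f c = 0) ->
  0 <= f b -> sumR f l <= f b.
Proof.
intros h; induction h as [|a l ha hl IH]; simpl; intros hz hb; [lra|].
destruct (excluded_middle_informative (a = b)) as [->|hab].
- assert (sumR f l = 0).
  { rewrite (sumR_ext f (fun _ => 0)); [rewrite sumR_const; ring|].
    intros c hc. apply hz; auto. intros ->; auto. }
  lra.
- rewrite (hz a); auto. specialize (IH (fun c hc => hz c (or_intror hc)) hb). lra.
Qed.

Lemma last_before (P : nat -> Prop) n : P 0%nat -> ~ P n -> exists k, (k < n)%nat /\ P k /\ ~ P (S k).
Proof.
intros h0; induction n as [|n IH]; intros h; [tauto|].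
destruct (classic (P n)) as [hp|hp]; [exists n; auto|].
destruct (IH hp) as [k [h1 h2]]. exists k. split; auto.
Qed.

Section LocalBound.

Variables (A : nat -> step) (M m : nat) (t C0 : R).
Hypothesis ht : 0 < t <= 1.
Hypothesis hM : (1 <= M)%nat.
Hypothesis hC0 : 0 < C0.
Hypothesis hok : forall k, step_ok M m t (A k).
Hypothesis hrun : forall k, pfac A k <= C0 * slim (A k).

Lemma sp_ge0 k w : 0 <= sp (A k) w.
Proof. apply (ok_sp M m t _ (hok k)). Qed.

Lemma valid_len om k : valid A om -> (1 <= length (om k))%nat.
Proof.
intros hv. destruct (ok_word M m t _ (hok k) _ (hv k)) as [-> _]. apply (ok_len M m t _ (hok k)).
Qed.

Lemma dig_spaced om : valid A om -> spaced M (dig om).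
Proof.
intros hv. pose proof (fun k => valid_len om k hv) as hl. split; intros i;
destruct (flat_decomp om i hl) as [k [j [hj ->]]];
destruct (ok_word M m t _ (hok k) _ (hv k)) as [h1 [h2 h3]].
- unfold dig. rewrite flat_block by auto. unfold pos_word in h2.
  rewrite Forall_forall in h2. apply h2, nth_In; auto.
- unfold dig. rewrite flat_block by auto. intros e. destruct (h3 j e) as [h4 h5].
  rewrite <- Nat.add_succ_r, flat_block; auto.
Qed.

Lemma dig_pos om : valid A om -> forall i, (1 <= dig om i)%nat.
Proof. intros hv. apply (dig_spaced om hv). Qed.

Lemma cat_pos om k : valid A om -> pos_word (cat om k).
Proof.
intros hv; induction k as [|k IH]; [constructor|]. rewrite cat_S. apply Forall_app. split; auto.
apply (ok_word M m t _ (hok k) _ (hv k)).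
Qed.

Lemma prefix_dig om k i : valid A om -> (i <= length (om k))%nat ->
  prefix (dig om) (length (cat om k) + i) = cat om k ++ firstn i (om k).
Proof.
intros hv hi. pose proof (fun k => valid_len om k hv) as hl.
rewrite prefix_add. f_equal.
- apply map_flat; auto.
- apply (map_seq_block 0%nat); auto. intros j hj. apply flat_block; auto. lia.
Qed.

Lemma mass_bound om k : valid A om ->
  mass A (node om k) * Rpower (q (cat om k)) (2 * t) <= pfac A k.
Proof.
intros hv; induction k as [|k IH].
- simpl. unfold cat, q; simpl. rewrite Rmult_1_l. unfold Rpower.
  rewrite ln_1, Rmult_0_r, exp_0. lra.
- rewrite cat_S. simpl. rewrite node_length.
  assert (hk := ok_word M m t _ (hok k) _ (hv k)).
  pose proof (cat_pos om k hv) as hc. pose proof (q_ge1 _ hc). pose proof (q_ge1 _ (proj1 (proj2 hk))).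
  pose proof (q_app (cat om k) (om k) hc (proj1 (proj2 hk))).
  pose proof (sp_ge0 k (om k)). pose proof (mass_nonneg A sp_ge0 (node om k)).
  apply Rle_trans with ((mass A (node om k) * Rpower (q (cat om k)) (2 * t)) *
    (sp (A k) (om k) * Rpower (2 * q (om k)) (2 * t))).
  + assert (hp : Rpower (q (cat om k ++ om k)) (2 * t) <=
      Rpower (q (cat om k)) (2 * t) * Rpower (2 * q (om k)) (2 * t)).
    { rewrite <- Rpower_mult_l by lra. apply Rle_Rpower_l; [lra|]. split; nra. }
    replace (mass A (node om k) * Rpower (q (cat om k)) (2 * t) *
      (sp (A k) (om k) * Rpower (2 * q (om k)) (2 * t))) with
     (sp (A k) (om k) * mass A (node om k) *
      (Rpower (q (cat om k)) (2 * t) * Rpower (2 * q (om k)) (2 * t))) by ring.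
    apply Rmult_le_compat_l; auto. apply Rmult_le_pos; auto.
  + apply Rmult_le_compat; auto.
    * apply Rmult_le_pos; auto. apply Rlt_le, Rpower_gt0.
    * apply Rmult_le_pos; auto. apply Rlt_le, Rpower_gt0.
    * apply (ok_fac M m t _ (hok k) _ (hv k)).
Qed.

Lemma mass_bound_lim om k : valid A om ->
  mass A (node om k) <= C0 * slim (A k) * Rpower (q (cat om k)) (- (2 * t)).
Proof.
intros hv. pose proof (mass_bound om k hv). specialize (hrun k).
rewrite Rpower_Ropp. pose proof (Rpower_gt0 (q (cat om k)) (2 * t)).
apply (Rmult_le_reg_r (Rpower (q (cat om k)) (2 * t))); auto.
rewrite Rmult_assoc, Rinv_l; lra.
Qed.

Lemma cat_node om om' k : node om k = node om' k -> cat om k = cat om' k.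
Proof. intros h. rewrite <- !node_word_cat, h. auto. Qed.

(** Every child off the common branch has no descendant that meets U, so at each level a single term
    of the sum survives. *)
Lemma met_single U k j sg : (forall om, valid A om -> U (pt om) -> node om k = sg) ->
  (exists om, valid A om /\ U (pt om)) -> met A U (k + j) nil <= met A U j sg.
Proof.
revert j sg; induction k as [|k IH]; intros j sg h [om [hv hU]].
- rewrite <- (h om hv hU). simpl. lra.
- replace (S k + j)%nat with (k + S j)%nat by lia.
  assert (e := h om hv hU). simpl in e.
  eapply Rle_trans; [apply (IH (S j) (node om k))|].
  + intros om' hv' hU'. pose proof (h om' hv' hU') as e'. rewrite <- e in e'. simpl in e'. congruence.
  + eauto.
  + simpl. rewrite node_length, <- e.
    apply (nonzero_sum (fun w => met A U j (w :: node om k))).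
    * apply (ok_nodup M m t _ (hok k)).
    * intros w hw hne.
      assert (hz : forall j tau, (exists pre, tau = pre ++ w :: node om k) -> met A U j tau = 0).
      { clear j IH. induction j as [|j IHj]; intros tau [pre ->]; simpl.
        - destruct excluded_middle_informative as [[om' [hv' [hU' hn']]]|]; auto. exfalso.
          assert (ek : node om' (S k) = w :: node om k).
          { revert hn'. generalize (node_length om k). generalize (node om k). clear.
            intros l hl. rewrite length_app. simpl. rewrite hl. clear hl.
            induction pre as [|p pre IH]; simpl; auto. intros e. injection e. auto. }
          apply hne. pose proof (h om' hv' hU') as e'. rewrite ek, <- e in e'. congruence.
        - rewrite (sumR_ext _ (fun _ => 0)); [rewrite sumR_const; ring|].
          intros v _. apply IHj. exists (v :: pre). auto. }
      apply hz. exists nil. auto.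
    * apply met_nonneg, sp_ge0.
Qed.

(** One constant for both kinds of steps. Chunks need 16 (M+1)^(2m+2) (M+2): (M+1)^m bounds q of the
    common beginning, which enters squared, and (M+1)^2 the two digits that differ. Single digits
    need 128 (M+2): a factor 4 comes from a + 1 <= 2N for both digits, and a factor 2 from the
    spread, which is at least r/2. *)
Definition kappa : R := / (128 * (INR M + 1) ^ (2 * m + 2) * (INR M + 2)).

Lemma kappa_bounds : 0 < kappa /\ kappa <= / (128 * (INR M + 2)).
Proof.
pose proof (INR_ge1 M hM) as h1.
assert (h3 : 1 <= (INR M + 1) ^ (2 * m + 2)) by (apply pow_R1_Rle; lra).
split; [apply Rinv_0_lt_compat; nra|apply Rinv_le_contravar; nra].
Qed.

Lemma dist_digits om om' k i : valid A om -> valid A om' -> node om k = node om' k ->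
  (i < slen (A k))%nat -> firstn i (om k) = firstn i (om' k) ->
  (nth i (om k) 0 < nth i (om' k) 0)%nat ->
  INR (nth i (om' k) 0%nat - nth i (om k) 0%nat) /
   (16 * (q (cat om k) * q (cat om k)) * (q (firstn i (om k)) * q (firstn i (om k)))
     * (INR M + 2) * (INR (nth i (om k) 0%nat) + 1) * (INR (nth i (om' k) 0%nat) + 1))
  <= Rabs (pt om - pt om').
Proof.
intros hv hv' hn hi hf hlt.
destruct (ok_word M m t _ (hok k) _ (hv k)) as [h1 [h2 h3]].
destruct (ok_word M m t _ (hok k) _ (hv' k)) as [h1' [h2' h3']].
pose proof (cat_node om om' k hn) as hc.
assert (hl := fun j => valid_len om j hv). assert (hl' := fun j => valid_len om' j hv').
pose proof (spaced_dist M (dig om) (dig om') (length (cat om k) + i)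
  (dig_spaced om hv) (dig_spaced om' hv')) as hd.
assert (e1 : prefix (dig om) (length (cat om k) + i) = cat om k ++ firstn i (om k))
  by (apply prefix_dig; auto; lia).
assert (e2 : prefix (dig om') (length (cat om k) + i) = cat om k ++ firstn i (om k))
  by (rewrite hc, prefix_dig, hf by (auto; lia); auto).
assert (d1 : dig om (length (cat om k) + i) = nth i (om k) 0%nat)
  by (apply flat_block; auto; lia).
assert (d2 : dig om' (length (cat om k) + i) = nth i (om' k) 0%nat)
  by (rewrite hc; apply flat_block; auto; lia).
rewrite e1, e2, d1, d2 in hd. specialize (hd eq_refl hlt).
eapply Rle_trans; [|exact hd].
assert (hp1 := cat_pos om k hv).
assert (hp2 : pos_word (firstn i (om k))).
{ unfold pos_word in *. rewrite <- (firstn_skipn i (om k)) in h2. apply Forall_app in h2. tauto. }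
pose proof (q_ge1 _ hp1). pose proof (q_ge1 _ hp2). pose proof (q_app _ _ hp1 hp2) as hq.
set (u := q (cat om k)) in *. set (v := q (firstn i (om k))) in *.
set (w := q (cat om k ++ firstn i (om k))) in *.
assert (hw : 4 * (w * w) <= 16 * (u * u) * (v * v)).
{ replace (16 * (u * u) * (v * v)) with (4 * ((2 * u * v) * (2 * u * v))) by ring.
  apply Rmult_le_compat_l; [lra|]. apply Rmult_le_compat; nra. }
assert (hw0 : 0 < w) by nra.
pose proof (pos_INR M). pose proof (pos_INR (nth i (om k) 0%nat)). pose proof (pos_INR (nth i (om' k) 0%nat)).
apply Rmult_le_compat_l; [apply pos_INR|].
apply Rinv_le_contravar.
- repeat apply Rmult_lt_0_compat; lra.
- repeat apply Rmult_le_compat_r; lra.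
Qed.

Lemma dist_words om om' k : chunk_kind M m (A k) -> valid A om -> valid A om' ->
  node om k = node om' k -> om k <> om' k ->
  kappa / (q (cat om k) * q (cat om k)) <= Rabs (pt om - pt om').
Proof.
intros hch hv hv' hn hne.
destruct (ok_word M m t _ (hok k) _ (hv k)) as [h1 [h2 h3]].
destruct (ok_word M m t _ (hok k) _ (hv' k)) as [h1' [h2' h3']].
destruct (first_diff (om k) (om' k)) as [i [hi [hf hd]]]; [congruence|auto|].
assert (main : forall om om', valid A om -> valid A om' -> node om k = node om' k ->
   length (om k) = slen (A k) -> length (om' k) = slen (A k) ->
   pos_word (om k) -> (i < slen (A k))%nat ->
   firstn i (om k) = firstn i (om' k) -> (nth i (om k) 0 < nth i (om' k) 0)%nat ->
   kappa / (q (cat om k) * q (cat om k)) <= Rabs (pt om - pt om')).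
{ clear om om' hv hv' hn hne h1 h2 h3 h1' h2' h3' hi hf hd.
  intros om om' hv hv' hn hl hl' hp hi hf hlt.
  eapply Rle_trans; [|apply (dist_digits om om' k i); auto].
  destruct hch as [hc1 hc2].
  pose proof (hc1 _ (hv k)) as hc. pose proof (hc1 _ (hv' k)) as hc'.
  assert (hp2 : pos_word (firstn i (om k))).
  { unfold pos_word in *. rewrite <- (firstn_skipn i (om k)) in hp. apply Forall_app in hp. tauto. }
  assert (hq2 : q (firstn i (om k)) <= (INR M + 1) ^ m).
  { eapply Rle_trans; [apply (q_le_pow _ M); auto|].
    - rewrite <- (firstn_skipn i (om k)) in hc. apply Forall_app in hc. tauto.
    - apply Rle_pow; [pose proof (pos_INR M); lra|]. rewrite length_firstn. lia. }
  pose proof (q_ge1 _ (cat_pos om k hv)). pose proof (q_ge1 _ hp2).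
  set (u := q (cat om k)) in *. set (v := q (firstn i (om k))) in *.
  assert (b1 : INR (nth i (om k) 0%nat) <= INR M).
  { apply le_INR. rewrite Forall_forall in hc. apply hc, nth_In. lia. }
  assert (b2 : INR (nth i (om' k) 0%nat) <= INR M).
  { apply le_INR. rewrite Forall_forall in hc'. apply hc', nth_In. lia. }
  assert (b3 : 1 <= INR (nth i (om' k) 0%nat - nth i (om k) 0%nat)) by (apply INR_ge1; lia).
  pose proof (pos_INR (nth i (om k) 0%nat)). pose proof (pos_INR (nth i (om' k) 0%nat)).
  set (a := INR (nth i (om k) 0%nat)) in *. set (a' := INR (nth i (om' k) 0%nat)) in *.
  unfold kappa. pose proof (pos_INR M).
  apply Rle_trans with (/ (16 * (INR M + 1) ^ (2 * m + 2) * (INR M + 2)) / (u * u)).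
  { apply Rmult_le_compat_r; [apply Rlt_le, Rinv_0_lt_compat; nra|].
    assert (0 < (INR M + 1) ^ (2 * m + 2)) by (apply pow_lt; lra).
    apply Rinv_le_contravar; nra. }
  replace (/ (16 * (INR M + 1) ^ (2 * m + 2) * (INR M + 2)) / (u * u)) with
   (1 * / (16 * (u * u) * ((INR M + 1) ^ m * (INR M + 1) ^ m) * (INR M + 2) * (INR M + 1) * (INR M + 1))).
  2:{ replace (2 * m + 2)%nat with (m + m + 2)%nat by lia. rewrite !pow_add. simpl.
      field. assert (0 < (INR M + 1) ^ m) by (apply pow_lt; lra). repeat split; lra. }
  assert (hd : 0 < 16 * (u * u) * (v * v)) by (repeat apply Rmult_lt_0_compat; lra).
  assert (hvv : v * v <= (INR M + 1) ^ m * (INR M + 1) ^ m) by (apply Rmult_le_compat; lra).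
  apply Rmult_le_compat; try lra.
  - apply Rlt_le, Rinv_0_lt_compat.
    assert (0 < (INR M + 1) ^ m) by (apply pow_lt; lra).
    repeat apply Rmult_lt_0_compat; lra.
  - apply Rinv_le_contravar.
    + repeat apply Rmult_lt_0_compat; lra.
    + assert (0 <= 16 * (u * u)) by nra.
      apply Rmult_le_compat; try lra; [apply Rmult_le_pos; try lra; apply Rmult_le_pos; lra|].
      apply Rmult_le_compat; try lra; [apply Rmult_le_pos; lra|].
      apply Rmult_le_compat_r; [lra|]. apply Rmult_le_compat_l; auto. }
destruct (Nat.lt_total (nth i (om k) 0%nat) (nth i (om' k) 0%nat)) as [h|[h|h]].
- apply main; auto. lia.
- exfalso; auto.
- rewrite Rabs_minus_sym, (cat_node om om' k hn). apply main; auto. lia.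
Qed.

(** Points that part at a chunk are at distance at least kappa/q^2, so d >= kappa/q^2, while the
    whole node carries at most C0 q^(-2t). *)
Lemma local_bound_chunk U d om om' k : 0 < d -> (forall x y, U x -> U y -> Rabs (x - y) <= d) ->
  valid A om -> U (pt om) -> valid A om' -> U (pt om') ->
  (forall o, valid A o -> U (pt o) -> node o k = node om k) -> om k <> om' k ->
  chunk_kind M m (A k) -> met A U k nil <= C0 * Rpower (d / kappa) t.
Proof.
intros hd hU hv hx hv' hx' hsame hne hch.
replace k with (k + 0)%nat by lia.
eapply Rle_trans; [apply (met_single U k 0 (node om k)); eauto|].
simpl. destruct excluded_middle_informative as [_|hn].
2:{ apply Rmult_le_pos; [lra|apply Rlt_le, Rpower_gt0]. }
eapply Rle_trans; [apply mass_bound_lim; auto|].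
pose proof (ok_lim M m t _ (hok k)) as hl.
pose proof (dist_words om om' k hch hv hv' ltac:(symmetry; auto) hne) as hdist.
specialize (hU _ _ hx hx'). destruct kappa_bounds as [hk _].
pose proof (q_ge1 _ (cat_pos om k hv)) as hq. set (Q := q (cat om k)) in *.
assert (hQ : / (Q * Q) <= d / kappa).
{ apply (Rmult_le_reg_r kappa); auto. unfold Rdiv in *. rewrite Rmult_assoc, Rinv_l by lra. lra. }
pose proof (Rpower_gt0 Q (- (2 * t))).
apply Rle_trans with (C0 * 1 * Rpower Q (- (2 * t))).
- apply Rmult_le_compat_r; [lra|]. apply Rmult_le_compat_l; lra.
- rewrite Rmult_1_r. apply Rmult_le_compat_l; [lra|].
  replace (Rpower Q (- (2 * t))) with (Rpower (/ (Q * Q)) t).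
  + apply Rle_Rpower_l; [lra|]. split; auto. apply Rinv_0_lt_compat; nra.
  + unfold Rpower. rewrite ln_Rinv, ln_mult by nra. f_equal. ring.
Qed.

(** Let U meet r of the p digits. It meets the fraction r/p of a node of mass at most C0 (p/N^2)^t
    q^(-2t), and d >= kappa r/(N^2 q^2). The exponents match because r/p <= (r/p)^t for t <= 1. *)
Lemma local_bound_digit U d om om' k : 0 < d -> (forall x y, U x -> U y -> Rabs (x - y) <= d) ->
  valid A om -> U (pt om) -> valid A om' -> U (pt om') ->
  (forall o, valid A o -> U (pt o) -> node o k = node om k) -> om k <> om' k ->
  digit_kind t (A k) -> met A U (k + 1) nil <= C0 * Rpower (d / kappa) t.
Proof.
intros hd hU hv hx hv' hx' hsame hne [P [N [hW [hP [hPN [hp hlim]]]]]].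
eapply Rle_trans; [apply (met_single U k 1 (node om k)); eauto|].
cbn [met]. rewrite node_length, hW, sumR_map.
set (isin := fun a => if excluded_middle_informative (meets A U ([a] :: node om k)) then true else false).
set (S := filter isin P).
assert (hsum : sumR (fun a => if excluded_middle_informative (meets A U ([a] :: node om k))
    then mass A ([a] :: node om k) else 0) P = INR (length S) * (/ INR (length P) * mass A (node om k))).
{ unfold S, isin. set (L := INR (length P)) in *. clearbody L. clear - hp.
  induction P as [|b P IH]; [simpl; ring|]. cbn [sumR filter]. rewrite IH.
  destruct excluded_middle_informative; [|ring].
  cbn [length mass]. rewrite node_length, hp, S_INR. ring. }
rewrite hsum.
assert (hin : forall o, valid A o -> U (pt o) -> exists a, o k = [a] /\ In a S).
{ intros o ho hxo. pose proof (ho k) as hk. rewrite hW in hk. apply in_map_iff in hk.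
  destruct hk as [a [ea ha]]. exists a. split; auto. apply filter_In. split; auto.
  unfold isin. destruct excluded_middle_informative as [|hn]; auto. exfalso. apply hn.
  exists o. split; auto. split; auto. simpl. rewrite node_length, <- ea, hsame; auto. }
destruct (hin om hv hx) as [a0 [e0 i0]]. destruct (hin om' hv' hx') as [a1 [e1 i1]].
assert (ha01 : a0 <> a1) by congruence.
assert (hnS : NoDup S) by (apply NoDup_filter; auto).
assert (hS2 : (2 <= length S)%nat).
{ change 2%nat with (length [a0; a1]). apply NoDup_incl_length.
  - repeat constructor; simpl; intuition.
  - intros b [<-|[<-|[]]]; auto. }
destruct (NoDup_spread S hnS hS2) as [b [b' [hb [hb' [hlt hle]]]]].
assert (hmeet : forall c, In c S -> In c P /\ exists o, valid A o /\ U (pt o) /\ o k = [c]).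
{ intros c hc. apply filter_In in hc. destruct hc as [c1 c2]. split; auto.
  unfold isin in c2. destruct excluded_middle_informative as [[o [g1 [g2 g3]]]|]; [|discriminate].
  exists o. simpl in g3. rewrite node_length in g3. injection g3. auto. }
destruct (hmeet b hb) as [hbP [o [ho [hxo eo]]]].
destruct (hmeet b' hb') as [hbP' [o' [ho' [hxo' eo']]]].
assert (hno : node o k = node o' k) by (rewrite (hsame o), (hsame o'); auto).
assert (hlen : slen (A k) = 1%nat).
{ destruct (ok_word M m t _ (hok k) _ (ho k)) as [<- _]. rewrite eo. auto. }
pose proof (dist_digits o o' k 0 ho ho' hno ltac:(lia) eq_refl) as hdist.
rewrite eo, eo' in hdist. cbn [nth firstn] in hdist. specialize (hdist hlt).
replace (q []) with 1 in hdist by reflexivity.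
replace (cat o k) with (cat om k) in hdist by (apply cat_node; rewrite (hsame o); auto).
specialize (hU _ _ hxo hxo').
destruct kappa_bounds as [hk0 hk1].
pose proof (q_ge1 _ (cat_pos om k hv)) as hq.
pose proof (mass_bound_lim om k hv) as hmass.
set (Q := q (cat om k)) in *.
destruct (hPN b hbP) as [pb1 pb2]. destruct (hPN b' hbP') as [pb1' pb2'].
assert (hb2 : 2 <= INR b) by (apply le_INR in pb1; exact pb1).
assert (hb2' : 2 <= INR b') by (apply le_INR in pb1'; exact pb1').
set (r := INR (length S)).
assert (hr2 : 2 <= r) by (apply (le_INR 2); auto).
assert (hr : r <= 2 * INR (b' - b)).
{ unfold r. replace 2 with (INR 2) by reflexivity. rewrite <- mult_INR. apply le_INR. lia. }
assert (hSP : r <= INR (length P)).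
{ apply le_INR. unfold S. apply filter_length_le. }
assert (hNN : 0 < N * N) by nra.
assert (hdN : kappa * (r / (N * N) / (Q * Q)) <= d).
{ eapply Rle_trans; [|exact hU]. eapply Rle_trans; [|exact hdist].
  pose proof (pos_INR M).
  apply Rle_trans with (/ (128 * (INR M + 2)) * (r / (N * N) / (Q * Q))).
  - apply Rmult_le_compat_r; auto. unfold Rdiv.
    apply Rmult_le_pos; [apply Rmult_le_pos; [lra|]|]; apply Rlt_le, Rinv_0_lt_compat; nra.
  - replace (/ (128 * (INR M + 2)) * (r / (N * N) / (Q * Q))) with
      ((r / 2) * / (16 * (Q * Q) * (1 * 1) * (INR M + 2) * (2 * N) * (2 * N)))
      by (field; repeat split; nra).
    assert (hx0 : 0 < 16 * (Q * Q) * (1 * 1) * (INR M + 2))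
      by (repeat apply Rmult_lt_0_compat; lra).
    apply Rmult_le_compat; try lra.
    + apply Rlt_le, Rinv_0_lt_compat. repeat apply Rmult_lt_0_compat; lra.
    + apply Rinv_le_contravar; [repeat apply Rmult_lt_0_compat; lra|].
      apply Rmult_le_compat; try lra; [apply Rmult_le_pos; lra|].
      apply Rmult_le_compat_l; lra. }
assert (hPpos : 0 < INR (length P)) by lra.
set (p := INR (length P)) in *.
apply Rle_trans with (C0 * Rpower (r / (N * N) / (Q * Q)) t).
2:{ apply Rmult_le_compat_l; [lra|]. apply Rle_Rpower_l; [lra|]. split.
    - unfold Rdiv. repeat apply Rmult_lt_0_compat; try lra; apply Rinv_0_lt_compat; nra.
    - apply (Rmult_le_reg_l kappa); auto. replace (kappa * (d / kappa)) with d by (field; lra). auto. }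
assert (hrp : r / p <= Rpower (r / p) t).
{ assert (h0 : 0 < r / p) by (apply Rdiv_lt_0_compat; lra).
  assert (h1 : r / p <= 1) by (apply (Rmult_le_reg_r p); auto; unfold Rdiv; rewrite Rmult_assoc, Rinv_l; lra).
  rewrite <- (Rpower_1 (r / p)) at 1 by auto. unfold Rpower.
  assert (hl : ln (r / p) <= 0) by (rewrite <- ln_1; apply ln_le; lra).
  assert (hh : 1 * ln (r / p) <= t * ln (r / p)) by nra.
  destruct hh as [hh| ->]; [apply Rlt_le, exp_increasing; auto|lra]. }
assert (hQt : Rpower Q (- (2 * t)) = Rpower (/ (Q * Q)) t).
{ unfold Rpower. rewrite ln_Rinv, ln_mult by nra. f_equal. ring. }
assert (hrp0 : 0 <= r / p) by (apply Rlt_le, Rdiv_lt_0_compat; lra).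
apply Rle_trans with (Rpower (r / p) t * (C0 * Rpower (p / (N * N)) t * Rpower (/ (Q * Q)) t)).
- replace (r * (/ p * mass A (node om k))) with (r / p * mass A (node om k)) by (field; lra).
  apply Rmult_le_compat; auto; [apply mass_nonneg, sp_ge0|].
  eapply Rle_trans; [exact hmass|]. rewrite hQt.
  apply Rmult_le_compat_r; [apply Rlt_le, Rpower_gt0|]. apply Rmult_le_compat_l; lra.
- apply Req_le.
  assert (g1 : 0 < r / p) by (apply Rdiv_lt_0_compat; lra).
  assert (g2 : 0 < p / (N * N)) by (apply Rdiv_lt_0_compat; lra).
  assert (g3 : 0 < / (Q * Q)) by (apply Rinv_0_lt_compat; nra).
  replace (r / (N * N) / (Q * Q)) with (r / p * (p / (N * N)) * / (Q * Q)) by (field; repeat split; nra).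
  rewrite !Rpower_mult_l by (auto; apply Rmult_lt_0_compat; auto). ring.
Qed.

Lemma q_cat_large om c : valid A om -> exists k, c <= q (cat om k).
Proof.
intros hv. destruct (INR_unbounded c) as [n hn]. exists (2 * n)%nat.
pose proof (cat_pos om (2 * n) hv) as hp.
pose proof (q_ge_pow2 _ hp) as h.
pose proof (cat_length_ge om (2 * n) (fun k => valid_len om k hv)) as hl.
assert (hn2 : (n <= Nat.div2 (length (cat om (2 * n))))%nat).
{ rewrite <- (Nat.div2_double n) at 1. rewrite !Nat.div2_div. apply Nat.Div0.div_le_mono; auto. }
assert (h1 : 2 ^ n <= 2 ^ Nat.div2 (length (cat om (2 * n)))) by (apply Rle_pow; [lra|auto]).
assert (h2 : INR n <= 2 ^ n).
{ clear. induction n as [|n IH]; [simpl; lra|]. rewrite S_INR. simpl.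
  pose proof (pow_R1_Rle 2 n ltac:(lra)). lra. }
lra.
Qed.

Lemma local_bound U d : 0 < d -> (forall x y, U x -> U y -> Rabs (x - y) <= d) ->
  exists D, met A U D nil <= C0 * Rpower (/ kappa) t * Rpower d t.
Proof.
intros hd hU. destruct kappa_bounds as [hk _].
assert (e : C0 * Rpower (/ kappa) t * Rpower d t = C0 * Rpower (d / kappa) t).
{ unfold Rdiv. rewrite Rpower_mult_l; [ring|auto|apply Rinv_0_lt_compat; auto]. }
rewrite e. clear e.
pose proof (Rpower_gt0 (d / kappa) t) as hpos.
destruct (classic (exists om, valid A om /\ U (pt om))) as [[om [hv hx]]|hn].
2:{ exists 0%nat. simpl. destruct excluded_middle_informative as [[om [h1 [h2 _]]]|].
    - exfalso; eauto.
    - nra. }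
set (P := fun k => forall o, valid A o -> U (pt o) -> node o k = node om k).
destruct (classic (forall k, P k)) as [hall|hnall].
(* The points of U never part; their common branch is followed until q^(-2t) <= (d/kappa)^t. *)
- destruct (q_cat_large om (Rpower (Rpower (d / kappa) t) (- / (2 * t))) hv) as [k hk'].
  exists (k + 0)%nat.
  eapply Rle_trans; [apply (met_single U k 0 (node om k)); [apply hall|eauto]|].
  simpl. destruct excluded_middle_informative as [_|]; [|nra].
  eapply Rle_trans; [apply mass_bound_lim; auto|].
  pose proof (ok_lim M m t _ (hok k)) as hl.
  pose proof (Rpower_gt0 (q (cat om k)) (- (2 * t))).
  apply Rle_trans with (C0 * 1 * Rpower (q (cat om k)) (- (2 * t))).
  + apply Rmult_le_compat_r; [lra|]. apply Rmult_le_compat_l; lra.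
  + rewrite Rmult_1_r. apply Rmult_le_compat_l; [lra|].
    eapply Rle_trans; [apply Rpower_anti; [split; [apply Rpower_gt0|exact hk']|lra]|].
    rewrite Rpower_mult. replace (- / (2 * t) * - (2 * t)) with 1 by (field; lra).
    rewrite Rpower_1; lra.
- apply not_all_ex_not in hnall. destruct hnall as [n hn].
  (* At depth k all points of U still share their node, and [om'] leaves the branch of [om] in the
     next step. *)
  destruct (last_before P n) as [k [_ [hk1 hk2]]]; [intros o _ _; reflexivity|auto|].
  apply not_all_ex_not in hk2. destruct hk2 as [om' hk2].
  apply imply_to_and in hk2. destruct hk2 as [hv' hk2].
  apply imply_to_and in hk2. destruct hk2 as [hx' hk2].
  assert (hne : om k <> om' k).
  { intros e. apply hk2. simpl. rewrite (hk1 om' hv' hx'), e. auto. }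
  destruct (ok_kind M m t _ (hok k)) as [hc|hc].
  + exists k. apply (local_bound_chunk U d om om' k); auto.
  + exists (k + 1)%nat. apply (local_bound_digit U d om om' k); auto.
Qed.

End LocalBound.

Theorem tree_dim A M m t C0 (E : R -> Prop) : 0 < t <= 1 -> (1 <= M)%nat -> 0 < C0 ->
  (forall k, step_ok M m t (A k)) -> (forall k, pfac A k <= C0 * slim (A k)) ->
  (forall om, valid A om -> E (pt om)) -> Rbar_le t (hausdorff_dim E).
Proof.
intros ht hM hC0 hok hrun hE.
apply (dim_ge_of_local_bound A) with (C := C0 * Rpower (/ kappa M m) t); auto.
- intros k w. apply (ok_sp M m t _ (hok k)).
- intros k. apply (ok_sum M m t _ (hok k)).
- lra.
- apply Rmult_lt_0_compat; [auto|apply Rpower_gt0].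
- intros U d hd hU. apply (local_bound A M m t C0); auto.
Qed.

(** * Upper bounds *)

(** The finitely many indices with a nonzero term lie in a box: n, i and all entries of the words
    are bounded by one K. *)
Lemma sum_index_le (c : index -> R) (N : nat) (lv : nat -> nat) (eps : R) :
  (forall x, 0 <= c x) ->
  (forall n i u v, c (n, i, u, v) <> 0 -> (N <= n)%nat /\ length u = (n - 1)%nat /\ pos_word u /\
     length v = lv i /\ pos_word v) ->
  (forall K, sumR (fun n => sumR (fun i => sumR (fun u => sumR (fun v => c (n, i, u, v))
     (words K (lv i))) (words K (n - 1))) (seq 0 K)) (seq N K) <= eps) ->
  forall L, NoDup L -> sumR c L <= eps.
Proof.
intros h0 hsupp hbox L hL.
set (nz := fun x => if Req_EM_T (c x) 0 then false else true).
assert (e : sumR c L = sumR c (filter nz L)).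
{ clear hL. induction L as [|x L IH]; auto. simpl. unfold nz at 1.
  destruct (Req_EM_T (c x) 0) as [->|]; simpl; rewrite IH; ring. }
rewrite e.
set (size := fun x : index => match x with (n, i, u, v) => (n + i + list_max u + list_max v + 1)%nat end).
set (K := list_max (map size L)).
assert (hK : forall x, In x L -> (size x <= K)%nat).
{ intros x hx. assert (h := proj1 (list_max_le (map size L) K) (le_n _)).
  rewrite Forall_forall in h. apply h, in_map; auto. }
assert (hmax : forall u k, (list_max u < k)%nat -> pos_word u -> Forall (fun a => (1 <= a <= k)%nat) u).
{ intros u k hk hu. assert (h := proj1 (list_max_le u (list_max u)) (le_n _)).
  unfold pos_word in hu. rewrite Forall_forall in *. intros a ha. specialize (h a ha). specialize (hu a ha). lia. }
eapply Rle_trans; [|apply (hbox K)].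
set (B := flat_map (fun n => flat_map (fun i => flat_map (fun u => map (fun v => (n, i, u, v) : index)
     (words K (lv i))) (words K (n - 1))) (seq 0 K)) (seq N K)).
apply Rle_trans with (sumR c B).
- apply sumR_incl; [apply NoDup_filter; auto| |auto].
  intros [[[n i] u] v] hx. apply filter_In in hx. destruct hx as [hx hz].
  unfold nz in hz. destruct (Req_EM_T (c (n, i, u, v)) 0) as [|hne]; [discriminate|].
  destruct (hsupp n i u v hne) as [h1 [h2 [h3 [h4 h5]]]].
  specialize (hK _ hx). simpl in hK.
  unfold B. apply in_flat_map. exists n. split; [apply in_seq; lia|].
  apply in_flat_map. exists i. split; [apply in_seq; lia|].
  apply in_flat_map. exists u. split; [apply In_words; split; auto; apply hmax; auto; lia|].
  apply in_map_iff. exists v. split; auto. apply In_words; split; auto; apply hmax; auto; lia.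
- apply Req_le. unfold B. rewrite sumR_flat_map. apply sumR_ext. intros n _.
  rewrite sumR_flat_map. apply sumR_ext. intros i _.
  rewrite sumR_flat_map. apply sumR_ext. intros u _. apply sumR_map.
Qed.

Lemma sum_inv_sq N K : (2 <= N)%nat -> sumR (fun n => / (INR n * INR n)) (seq N K) <= / (INR N - 1).
Proof.
intros hN.
assert (main : forall K, sumR (fun n => / (INR n * INR n)) (seq N K) <= / (INR N - 1) - / (INR (N + K) - 1)).
{ clear K. assert (h2 : 2 <= INR N) by (apply (le_INR 2); auto).
  induction K as [|K IH].
  - rewrite Nat.add_0_r. simpl. lra.
  - rewrite seq_S, sumR_app. cbn [sumR]. replace (N + S K)%nat with (S (N + K)) by lia.
    rewrite S_INR. assert (h3 : 2 <= INR (N + K)) by (apply (le_INR 2); lia).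
    set (y := INR (N + K)) in *.
    assert (/ (y * y) <= / (y - 1) - / (y + 1 - 1)).
    { replace (/ (y - 1) - / (y + 1 - 1)) with (/ ((y - 1) * y)) by (field; lra).
      apply Rinv_le_contravar; nra. }
    lra. }
specialize (main K). assert (h2 : 2 <= INR N) by (apply (le_INR 2); auto).
assert (h3 : 2 <= INR (N + K)) by (apply (le_INR 2); lia).
assert (0 < / (INR (N + K) - 1)) by (apply Rinv_0_lt_compat; lra). lra.
Qed.

Lemma inv_q_sq_small delta : 0 < delta -> exists N, forall u, pos_word u -> (N <= length u)%nat ->
  / (q u * q u) <= delta.
Proof.
intros hd. destruct (pow_half_small delta hd) as [N hN].
exists (2 * N)%nat. intros u hu hl.
pose proof (q_ge_pow2 u hu). pose proof (q_ge1 u hu).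
assert (hn : (N <= Nat.div2 (length u))%nat).
{ rewrite <- (Nat.div2_double N). rewrite !Nat.div2_div. apply Nat.Div0.div_le_mono; auto. }
specialize (hN _ hn). rewrite pow_inv in hN.
apply Rle_trans with (/ 2 ^ Nat.div2 (length u)); [|lra].
apply Rinv_le_contravar; [apply pow_lt; lra|]. nra.
Qed.

(** * Covers for s > 1/2 *)

Lemma wprod_app u v : wprod (u ++ v) = wprod u * wprod v.
Proof. induction u as [|a u IH]; simpl; [|rewrite IH]; ring. Qed.

Lemma block_prod_digits x n l : 0 < x < 1 -> irrational x ->
  block_prod (fun m => pq m x) (S n) l = wprod (map (digit x) (seq n l)).
Proof.
intros hx hi. revert n; induction l as [|l IH]; intros n; simpl; auto.
rewrite IH. destruct (digit_step x n hx hi) as [_ [_ ->]]. rewrite INR_IZR_INZ. auto.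
Qed.

Definition rho (s : R) : R := (1 - s) / s.
Definition geo (s : R) (i : nat) : R := sumR (fun j => rho s ^ j) (seq 0 i).
(* [alpha] is the exponent of the i-th digit of an optimal block, [acum] its partial sums. *)
Definition alpha (s : R) (l i : nat) : R := rho s ^ i / geo s l.
Definition acum (s : R) (l i : nat) : R := geo s i / geo s l.
Definition fexp (s : R) (l : nat) : R := s / geo s l.

Lemma geo_S s i : geo s (S i) = geo s i + rho s ^ i.
Proof. unfold geo. rewrite seq_S, sumR_app. simpl. ring. Qed.

Lemma rho_pos s : 0 < s < 1 -> 0 < rho s.
Proof. intros h. apply Rdiv_lt_0_compat; lra. Qed.

Lemma geo_ge1 s l : 0 < s < 1 -> (1 <= l)%nat -> 1 <= geo s l.
Proof.
intros hs hl. destruct l as [|l]; [lia|]. clear hl. pose proof (rho_pos s hs).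
induction l as [|l IH]; [unfold geo; simpl; lra|]. rewrite geo_S.
pose proof (pow_lt (rho s) (S l) H). lra.
Qed.

(** Since s rho = 1 - s, the quantity s rho^i drops by (2s-1) rho^i when i grows by 1. This identity
    is the reason for the choice of rho; it serves both the cover and the Cantor set. *)
Lemma alpha_identity s l i : 0 < s < 1 -> (1 <= l)%nat ->
  s * alpha s l i = fexp s l - (2 * s - 1) * acum s l i.
Proof.
intros hs hl. unfold alpha, fexp, acum. pose proof (geo_ge1 s l hs hl).
assert (main : s * rho s ^ i = s - (2 * s - 1) * geo s i).
{ induction i as [|i IH]; [unfold geo; simpl; ring|].
  rewrite geo_S. replace (s * rho s ^ S i) with ((1 - s) * rho s ^ i)
    by (simpl; unfold rho; field; lra).
  nra. }
replace (s * (rho s ^ i / geo s l)) with ((s * rho s ^ i) / geo s l) by (field; lra).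
rewrite main. field. lra.
Qed.

Lemma acum_S s l i : acum s l (S i) = acum s l i + alpha s l i.
Proof. unfold acum, alpha. rewrite geo_S. unfold Rdiv. ring. Qed.

Lemma acum_0 s l : acum s l 0 = 0.
Proof. unfold acum, geo. simpl. unfold Rdiv. ring. Qed.

Lemma acum_l s l : 0 < s < 1 -> (1 <= l)%nat -> acum s l l = 1.
Proof. intros hs hl. unfold acum. pose proof (geo_ge1 s l hs hl). field. lra. Qed.

Lemma alpha_pos s l i : 0 < s < 1 -> (1 <= l)%nat -> 0 < alpha s l i.
Proof.
intros hs hl. pose proof (geo_ge1 s l hs hl). apply Rdiv_lt_0_compat; [|lra].
apply pow_lt, rho_pos; auto.
Qed.

Lemma acum_nonneg s l i : 0 < s < 1 -> (1 <= l)%nat -> 0 <= acum s l i.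
Proof.
intros hs hl. induction i as [|i IH]; [rewrite acum_0; lra|].
rewrite acum_S. pose proof (alpha_pos s l i hs hl). lra.
Qed.

Lemma fexp_pos s l : 0 < s < 1 -> (1 <= l)%nat -> 0 < fexp s l.
Proof. intros hs hl. pose proof (geo_ge1 s l hs hl). apply Rdiv_lt_0_compat; lra. Qed.

Lemma Rpower_1_l e : Rpower 1 e = 1.
Proof. unfold Rpower. rewrite ln_1, Rmult_0_r. apply exp_0. Qed.

Lemma Rpower_inv_l x e : 0 < x -> Rpower (/ x) e = Rpower x (- e).
Proof. intros h. unfold Rpower. rewrite ln_Rinv by auto. f_equal. ring. Qed.

Lemma cover_piece_diam w y z h : pos_word w -> 0 <= y <= 1 -> 0 <= z <= 1 -> y <= h -> z <= h ->
  Rabs (cf w y - cf w z) <= h / (q w * q w).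
Proof.
intros hw hy hz h1 h2. eapply Rle_trans; [apply cf_lip; auto|].
pose proof (q_ge1 w hw). apply Rmult_le_compat_r; [apply Rlt_le, Rinv_0_lt_compat; nra|].
apply Rabs_le. lra.
Qed.

Lemma upper_mid (phi : nat -> R) (l : nat) (s s' : R) (N0 : nat) :
  (forall n, (1 <= n)%nat -> 0 < phi n) -> (1 <= l)%nat -> / 2 < s < 1 -> s < s' ->
  (forall n M, (1 <= n)%nat -> (N0 <= n)%nat ->
     INR n * INR n * Zsum M (n - 1) s <= Rpower (phi n) (fexp s l)) ->
  hausdorff_measure s' (E_set phi l) = Finite 0.
Proof.
intros hphi hl hs hss hZ.
assert (hs01 : 0 < s < 1) by lra.
pose proof (fexp_pos s l hs01 hl) as hf.
(* [Zsum_ge1] and the hypothesis force phi(n)^f >= 1. *)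
assert (hphi1 : forall n, (1 <= n)%nat -> (N0 <= n)%nat -> 1 <= phi n).
{ intros n h1 h2. destruct (Zsum_ge1 s hs01) as [M0 hM0].
  specialize (hZ n M0 h1 h2). specialize (hM0 M0 (n - 1)%nat (le_n _)).
  pose proof (INR_ge1 n h1). apply Rnot_lt_le. intros hlt.
  assert (Rpower (phi n) (fexp s l) < 1).
  { rewrite <- (Rpower_1_l (fexp s l)). apply Rlt_Rpower_l; auto. }
  nra. }
(* With eps = s' - s and tau = s' the exponent 1 + eps - tau of [sum_words_wterm] becomes 1 - s. *)
set (ze := 1 + / (s' - s)).
assert (hze : 1 <= ze) by (unfold ze; pose proof (Rinv_0_lt_compat (s' - s) ltac:(lra)); lra).
apply measure_zero_index; [lra|]. intros delta eps hdelta heps.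
destruct (inv_q_sq_small delta hdelta) as [N1 hN1].
set (C := INR l * ze ^ l).
assert (hC : 0 < C).
{ unfold C. apply Rmult_lt_0_compat; [apply lt_0_INR; lia|apply pow_lt; lra]. }
destruct (INR_unbounded (C / eps + 1)) as [N2 hN2].
set (N := (N0 + N1 + N2 + 2)%nat).
assert (hNe : C * / (INR N - 1) <= eps).
{ assert (INR N2 <= INR N) by (apply le_INR; unfold N; lia).
  assert (0 < C / eps) by (apply Rdiv_lt_0_compat; auto).
  apply (Rmult_le_reg_r (INR N - 1)); [lra|]. rewrite Rmult_assoc, Rinv_l by lra.
  assert (C / eps * eps <= (INR N - 1) * eps) by (apply Rmult_le_compat_r; lra).
  replace (C / eps * eps) with C in * by (field; lra). lra. }
(* Here u holds the digits before the block and v its first i digits, whose product is still within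
   the threshold. The next digit passes the following threshold, which is what the bound [h] on the
   tail expresses. *)
set (ok := fun x : index => match x with (n, i, u, v) =>
  (N <= n)%nat /\ (i < l)%nat /\ length u = (n - 1)%nat /\ pos_word u /\ length v = i /\ pos_word v /\
  wprod v <= Rpower (phi n) (acum s l i) end).
set (h := fun x : index => match x with (n, i, u, v) => wprod v * Rpower (phi n) (- acum s l (S i)) end).
set (rad := fun x : index => match x with (n, i, u, v) =>
   / (q u * q u) * (/ wprod v * Rpower (phi n) (- acum s l (S i))) end).
assert (hok : forall x, ok x -> 0 < rad x <= delta).
{ intros [[[n i] u] v] [h1 [h2 [h3 [h4 [h5 [h6 h7]]]]]]. unfold rad.
  pose proof (q_ge1 u h4). pose proof (wprod_ge1 v h6).
  pose proof (Rpower_gt0 (phi n) (- acum s l (S i))).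
  assert (0 < / (q u * q u)) by (apply Rinv_0_lt_compat; nra).
  assert (0 < / wprod v) by (apply Rinv_0_lt_compat; lra).
  assert (/ wprod v <= 1) by (rewrite <- Rinv_1; apply Rinv_le_contravar; lra).
  assert (Rpower (phi n) (- acum s l (S i)) <= 1).
  { apply Rpower_le1; [apply hphi1; unfold N in *; lia|]. pose proof (acum_nonneg s l (S i) hs01 hl). lra. }
  split; [repeat apply Rmult_lt_0_compat; auto|].
  apply Rle_trans with (/ (q u * q u) * 1); [|rewrite Rmult_1_r; apply hN1; auto; unfold N in *; lia].
  apply Rmult_le_compat_l; [lra|]. nra. }
exists (fun x y => ok x /\ match x with (n, i, u, v) =>
  exists th, 0 <= th <= 1 /\ th <= h x /\ y = cf (u ++ v) th end).
exists (fun x => if excluded_middle_informative (ok x) then rad x else 0).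
split; [|split; [|split]].
- intros [[[n i] u] v] x y [hx [th [t1 [t2 ->]]]] [_ [th' [t1' [t2' ->]]]].
  destruct excluded_middle_informative as [_|hn]; [|tauto].
  destruct hx as [h1 [h2 [h3 [h4 [h5 [h6 h7]]]]]].
  assert (hp : pos_word (u ++ v)) by (apply pos_word_app; auto).
  eapply Rle_trans; [apply (cover_piece_diam _ _ _ (h (n, i, u, v))); auto|].
  unfold h, rad. pose proof (q_ge1 u h4). pose proof (wprod_ge1 v h6).
  pose proof (wprod_le_q v h6). pose proof (q_app u v h4 h6).
  pose proof (Rpower_gt0 (phi n) (- acum s l (S i))).
  assert (hq : q u * wprod v <= q (u ++ v)) by nra.
  apply Rle_trans with (wprod v * Rpower (phi n) (- acum s l (S i)) * / ((q u * wprod v) * (q u * wprod v))).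
  + apply Rmult_le_compat_l; [nra|]. apply Rinv_le_contravar.
    * apply Rmult_lt_0_compat; apply Rmult_lt_0_compat; lra.
    * assert (0 < q u * wprod v) by (apply Rmult_lt_0_compat; lra). apply Rmult_le_compat; lra.
  + apply Req_le. field. split; lra.
- intros x. destruct excluded_middle_informative as [hx|]; [|lra].
  specialize (hok x hx). lra.
- intros x [hx [hi hio]]. destruct (hio N) as [n [hn1 [hn2 hn3]]].
  destruct n as [|n]; [lia|]. rewrite block_prod_digits in hn3 by auto.
  set (W := fun k => wprod (map (digit x) (seq n k))) in *.
  assert (hph : 1 <= phi (S n)) by (apply hphi1; unfold N in *; lia).
  (* The clause k = 0 starts the search: at 0 the product and the threshold are both 1, and the
     strict inequality fails. *)
  destruct (last_before (fun k => k = 0%nat \/ W k < Rpower (phi (S n)) (acum s l k)) l)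
    as [k [hk1 [hk2 hk3]]]; [auto| |].
  { intros [h0|h0]; [lia|]. rewrite acum_l, Rpower_1 in h0 by (auto; lra). unfold W in h0. lra. }
  assert (hWk : W k <= Rpower (phi (S n)) (acum s l k)).
  { destruct hk2 as [->|h2]; [|lra]. unfold W. simpl. rewrite acum_0, Rpower_O; lra. }
  assert (hWS : Rpower (phi (S n)) (acum s l (S k)) <= W (S k)).
  { apply Rnot_lt_le. intros hlt. apply hk3. auto. }
  exists (S n, k, prefix (digit x) n, map (digit x) (seq n k)).
  assert (hdp : forall j, (1 <= digit x j)%nat) by (intros; apply digit_step; auto).
  split.
  + unfold ok. repeat split; auto.
    * rewrite prefix_length. lia.
    * apply prefix_positive; auto.
    * rewrite length_map, length_seq. auto.
    * apply Forall_map, Forall_forall; auto.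
  + exists (gtail (n + k)%nat x). destruct (gtail_irrational x (n + k)%nat hx hi) as [ht _].
    split; [lra|]. split.
    * unfold h. destruct (digit_step x (n + k)%nat hx hi) as [d1 [d2 _]]. rewrite d2.
      destruct (gtail_irrational x (S (n + k)%nat) hx hi) as [ht' _].
      pose proof (INR_ge1 _ d1).
      assert (e : W (S k) = W k * INR (digit x (n + k)%nat)).
      { unfold W. rewrite seq_S, map_app, wprod_app. simpl. ring. }
      rewrite e in hWS. rewrite Rpower_Ropp. fold (W k).
      pose proof (Rpower_gt0 (phi (S n)) (acum s l (S k))).
      apply Rle_trans with (/ INR (digit x (n + k)%nat)); [apply Rinv_le_contravar; lra|].
      apply (Rmult_le_reg_r (INR (digit x (n + k)%nat))); [lra|].
      rewrite Rinv_l by lra.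
      apply (Rmult_le_reg_r (Rpower (phi (S n)) (acum s l (S k)))); auto.
      replace (W k * / Rpower (phi (S n)) (acum s l (S k)) * INR (digit x (n + k)%nat) *
        Rpower (phi (S n)) (acum s l (S k))) with (W k * INR (digit x (n + k)%nat)) by (field; lra).
      lra.
    * rewrite <- prefix_add. apply cf_digits; auto.
- intros L hL.
  eapply Rle_trans; [|exact hNe].
  revert L hL.
  apply (sum_index_le _ N (fun i => i)).
  + intros; apply dpow_nonneg.
  + intros n i u v. destruct excluded_middle_informative as [[h1 [h2 [h3 [h4 [h5 [h6 h7]]]]]]|_].
    * intros _. auto.
    * intros h0. exfalso. apply h0. unfold dpow. destruct Rlt_dec; lra.
  + intros K.
    apply Rle_trans with (sumR (fun n => C * / (INR n * INR n)) (seq N K)).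
    2:{ rewrite sumR_scal. apply Rmult_le_compat_l; [lra|]. apply sum_inv_sq. unfold N; lia. }
    apply sumR_le. intros n hn. apply in_seq in hn.
    assert (hn0 : (N0 <= n)%nat) by (unfold N in *; lia).
    assert (hn1 : (1 <= n)%nat) by (unfold N in *; lia).
    specialize (hphi1 n hn1 hn0). pose proof (INR_ge1 n hn1) as hin.
    set (F := Rpower (phi n) (- fexp s l)).
    assert (hterm : forall i, sumR (fun u => sumR (fun v => dpow
       (if excluded_middle_informative (ok (n, i, u, v)) then rad (n, i, u, v) else 0) s')
        (words K i)) (words K (n - 1)) <= if lt_dec i l then Zsum K (n - 1) s * (F * ze ^ l) else 0).
    { intros i. destruct (lt_dec i l) as [hil|hil].
      - assert (hv : forall u, pos_word u -> sumR (fun v => dpow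
          (if excluded_middle_informative (ok (n, i, u, v)) then rad (n, i, u, v) else 0) s')
          (words K i) <= Rpower (q u) (- (2 * s)) * (F * ze ^ l)).
        { intros u hu. pose proof (q_ge1 u hu) as hqu.
          set (G := Rpower (phi n) (- acum s l (S i) * s')).
          apply Rle_trans with (sumR (fun v => (Rpower (q u) (- (2 * s)) * G) *
              wterm (Rpower (phi n) (acum s l i)) s' v) (words K i)).
          - apply sumR_le. intros v hv. apply words_pos in hv.
            pose proof (wterm_nonneg (Rpower (phi n) (acum s l i)) s' v).
            pose proof (Rpower_gt0 (q u) (- (2 * s))).
            assert (0 < G) by apply Rpower_gt0.
            destruct excluded_middle_informative as [hx|_].
            2:{ unfold dpow at 1. destruct (Rlt_dec 0 0); [lra|].
                apply Rmult_le_pos; auto. apply Rmult_le_pos; lra. }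
            rewrite dpow_pos by (apply hok; auto).
            destruct hx as [_ [_ [_ [_ [_ [_ h7]]]]]].
            unfold wterm. destruct (Rle_dec (wprod v) (Rpower (phi n) (acum s l i))) as [_|]; [|tauto].
            pose proof (wprod_ge1 v hv). pose proof (Rpower_gt0 (phi n) (- acum s l (S i))).
            unfold rad.
            assert (0 < / (q u * q u)) by (apply Rinv_0_lt_compat; nra).
            assert (0 < / wprod v) by (apply Rinv_0_lt_compat; lra).
            rewrite !Rpower_mult_l by (auto; apply Rmult_lt_0_compat; auto).
            rewrite !Rpower_inv_l by nra. rewrite Rpower_mult. fold G.
            rewrite Rpower_mult_l, <- Rpower_plus by lra.
            replace (Rpower (q u) (- s' + - s') * (Rpower (wprod v) (- s') * G)) with
              (Rpower (q u) (- s' + - s') * G * Rpower (wprod v) (- s')) by ring.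
            apply Rmult_le_compat_r; [apply Rlt_le, Rpower_gt0|].
            apply Rmult_le_compat_r; [lra|]. apply Rle_Rpower; lra.
          - rewrite sumR_scal, Rmult_assoc. apply Rmult_le_compat_l; [apply Rlt_le, Rpower_gt0|].
            assert (hG : 0 < G) by apply Rpower_gt0.
            eapply Rle_trans.
            { apply Rmult_le_compat_l; [lra|]. apply (sum_words_wterm (s' - s)); [lra|lra|].
              apply Rpower_ge1; [lra|]. apply acum_nonneg; auto. }
            fold ze. rewrite <- Rmult_assoc. apply Rmult_le_compat.
            + apply Rmult_le_pos; [lra|apply Rlt_le, Rpower_gt0].
            + apply pow_le; lra.
            + rewrite Rpower_mult. unfold G, F. rewrite <- Rpower_plus. apply Rle_Rpower; [lra|].
              (* The thresholds balance here: (1-s) acum_i - s acum_(i+1) = -f for every i, so each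
                 stopping place costs the same. *)
              pose proof (alpha_identity s l i hs01 hl). rewrite acum_S.
              pose proof (acum_nonneg s l i hs01 hl). pose proof (alpha_pos s l i hs01 hl). nra.
            + apply Rle_pow; [lra|lia]. }
        unfold Zsum. rewrite Rmult_comm, <- sumR_scal. apply sumR_le. intros u hu.
        apply words_pos in hu. rewrite Rmult_comm. apply hv; auto.
      - apply Rle_trans with (sumR (fun u => sumR (fun v => 0) (words K i)) (words K (n - 1))).
        + apply sumR_le. intros u _. apply sumR_le. intros v _.
          destruct excluded_middle_informative as [[_ [h2 _]]|_]; [lia|].
          unfold dpow. destruct Rlt_dec; lra.
        + rewrite (sumR_ext _ (fun _ => 0)); [rewrite sumR_const; lra|].
          intros; rewrite sumR_const; ring. }
    eapply Rle_trans; [apply sumR_le; intros i _; apply hterm|].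
    specialize (hZ n K hn1 hn0).
    assert (hF : Zsum K (n - 1) s * F <= / (INR n * INR n)).
    { unfold F. rewrite Rpower_Ropp. pose proof (Rpower_gt0 (phi n) (fexp s l)) as hp.
      apply (Rmult_le_reg_r (Rpower (phi n) (fexp s l))); auto.
      rewrite Rmult_assoc, Rinv_l, Rmult_1_r by lra.
      apply (Rmult_le_reg_l (INR n * INR n)); [nra|].
      rewrite <- Rmult_assoc, Rinv_r, Rmult_1_l by nra. lra. }
    assert (hzl : 0 < ze ^ l) by (apply pow_lt; lra).
    set (X := Zsum K (n - 1) s * (F * ze ^ l)).
    assert (hX : 0 <= X).
    { unfold X, F. apply Rmult_le_pos; [apply Zsum_nonneg|]. apply Rmult_le_pos; [apply Rlt_le, Rpower_gt0|lra]. }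
    apply Rle_trans with (INR l * X).
    * assert (hcnt : forall K, sumR (fun i => if lt_dec i l then X else 0) (seq 0 K) <= INR (Nat.min K l) * X).
      { clear - hX. clearbody X. intros K0. induction K0 as [|K0 IH]; [simpl; lra|]. rewrite seq_S, sumR_app. cbn [sumR]. simpl (0 + K0)%nat.
        destruct (lt_dec K0 l).
        - replace (Nat.min (S K0) l) with (S (Nat.min K0 l)) by lia. rewrite S_INR. lra.
        - replace (Nat.min (S K0) l) with (Nat.min K0 l) by lia. lra. }
      eapply Rle_trans; [apply hcnt|]. apply Rmult_le_compat_r; auto. apply le_INR. lia.
    * unfold C, X. rewrite !Rmult_assoc. apply Rmult_le_compat_l; [apply pos_INR|].
      replace (Zsum K (n - 1) s * (F * ze ^ l)) with (ze ^ l * (Zsum K (n - 1) s * F)) by ring.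
      apply Rmult_le_compat_l; [lra|]. exact hF.
Qed.

(** * Covers for s <= 1/2 *)

Lemma geom_sum_le r K : 0 <= r < 1 -> sumR (fun i => r ^ i) (seq 0 K) <= / (1 - r).
Proof.
intros hr.
assert (main : sumR (fun i => r ^ i) (seq 0 K) = (1 - r ^ K) / (1 - r)).
{ induction K as [|K IH]; [simpl; field; lra|]. rewrite seq_S, sumR_app, IH. simpl. field. lra. }
rewrite main. pose proof (pow_le r K (proj1 hr)).
rewrite <- (Rmult_1_l (/ (1 - r))). apply Rmult_le_compat_r; [apply Rlt_le, Rinv_0_lt_compat|]; lra.
Qed.

(* [g^m = exp(m ln g / 2)^2 >= (m ln g / 2)^2] *)
Lemma pow_beats_linear g c : 1 < g -> exists N, forall m, (N <= m)%nat -> c * INR m <= g ^ m.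
Proof.
intros hg. assert (hl : 0 < ln g) by (rewrite <- ln_1; apply ln_increasing; lra).
destruct (INR_unbounded (4 * c / (ln g * ln g))) as [N hN].
exists N. intros m hm. apply le_INR in hm. pose proof (pos_INR m).
rewrite <- Rpower_pow by lra. unfold Rpower.
set (y := INR m * ln g / 2). replace (INR m * ln g) with (y + y) by (unfold y; field).
rewrite exp_plus. pose proof (exp_ineq1_le y). assert (0 <= y) by (unfold y; nra).
apply Rle_trans with (y * y); [|nra].
replace (y * y) with (INR m * (INR m * (ln g * ln g) / 4)) by (unfold y; field).
rewrite Rmult_comm. apply Rmult_le_compat_l; auto.
assert (h : 4 * c / (ln g * ln g) <= INR m) by lra.
apply (Rmult_le_compat_r (ln g * ln g / 4)) in h; [|nra].
replace (4 * c / (ln g * ln g) * (ln g * ln g / 4)) with c in h by (field; lra). lra.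
Qed.

Lemma exp_pow_beats z k g : 1 <= z -> 0 < k -> 1 < g ->
  exists N, forall m, (N <= m)%nat -> INR m * INR m * z ^ m <= exp (k * g ^ m).
Proof.
intros hz hk hg. destruct (pow_beats_linear g ((2 + ln z) / k) hg) as [N hN].
exists (S N). intros m hm. assert (hm1 : 1 <= INR m) by (apply INR_ge1; lia).
specialize (hN m ltac:(lia)).
replace (INR m * INR m * z ^ m) with (exp (ln (INR m * INR m * z ^ m))).
2:{ apply exp_ln. pose proof (pow_lt z m ltac:(lra)). apply Rmult_lt_0_compat; nra. }
assert (h : ln (INR m * INR m * z ^ m) <= k * g ^ m).
{ rewrite !ln_mult, ln_pow; try lra; try nra; try (apply pow_lt; lra).
  pose proof (ln_le_sub1 (INR m) ltac:(lra)).
  apply (Rmult_le_compat_l k) in hN; [|lra].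
  replace (k * ((2 + ln z) / k * INR m)) with ((2 + ln z) * INR m) in hN by (field; lra). lra. }
destruct h as [h|h]; [apply Rlt_le, exp_increasing; auto|rewrite h; lra].
Qed.

Lemma wprod_ln_le w c : pos_word w -> (forall a, In a w -> ln (INR a) <= c) ->
  ln (wprod w) <= INR (length w) * c.
Proof.
intros hw; induction hw as [|a w ha hw IH]; intros hc.
- simpl. rewrite ln_1. lra.
- cbn [wprod length]. apply INR_ge1 in ha. pose proof (wprod_ge1 w hw).
  rewrite S_INR, ln_mult by lra. specialize (IH (fun b hb => hc b (or_intror hb))).
  specialize (hc a (or_introl eq_refl)). lra.
Qed.

(** The maximum over 0, ..., i works, where r i exceeds 1 and every r j with j <= N. *)
Lemma record_index (r : nat -> R) (N : nat) : (forall T, exists i, T < r i) ->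
  exists k, (N <= k)%nat /\ 1 <= r k /\ forall j, (j < k)%nat -> r j <= r k.
Proof.
intros h.
assert (hmax : forall n, exists k, (k <= n)%nat /\ forall j, (j <= n)%nat -> r j <= r k).
{ induction n as [|n [k [h1 h2]]].
  - exists 0%nat. split; auto. intros j hj. replace j with 0%nat by lia. lra.
  - destruct (Rle_lt_dec (r (S n)) (r k)) as [hc|hc].
    + exists k. split; [lia|]. intros j hj. destruct (Nat.eq_dec j (S n)) as [->|]; auto. apply h2. lia.
    + exists (S n). split; [lia|]. intros j hj. destruct (Nat.eq_dec j (S n)) as [->|]; [lra|].
      specialize (h2 j ltac:(lia)). lra. }
destruct (hmax N) as [k0 [_ hk0]]. destruct (h (Rmax 1 (r k0))) as [i hi].
pose proof (Rmax_l 1 (r k0)). pose proof (Rmax_r 1 (r k0)).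
destruct (hmax i) as [k [hk1 hk2]]. pose proof (hk2 i (le_n _)) as hki.
exists k. split; [|split].
- destruct (le_lt_dec N k); auto. specialize (hk0 k ltac:(lia)). lra.
- lra.
- intros j hj. apply hk2. lia.
Qed.

(** At a record n of ln(a_n)/g^n the earlier digits satisfy ln a_j <= g^(j-n) ln a_n, so their
    product is at most a_n^(1/(g-1)). Given these digits u and the size of a_n, the point lies in a
    piece of length about q(u)^(-2)/a_n, and the words u with so small a product contribute
    little. *)
Lemma upper_low (phi : nat -> R) (l : nat) (beta s : R) (N0 : nat) :
  (1 <= l)%nat -> 1 < beta -> / (1 + beta) < s <= / 2 ->
  (forall n, (1 <= n)%nat -> (N0 <= n)%nat -> exp (beta ^ n) <= phi n) ->
  hausdorff_measure s (E_set phi l) = Finite 0.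
Proof.
intros hl hb hs hphi.
assert (hib : 0 < / (1 + beta)) by (apply Rinv_0_lt_compat; lra).
assert (hs0 : 0 < s) by lra.
assert (h2s : 2 <= / s) by (rewrite <- (Rinv_inv 2); apply Rinv_le_contravar; lra).
assert (hsb : / s < 1 + beta).
{ rewrite <- (Rinv_inv (1 + beta)). apply Rinv_lt_contravar; [apply Rmult_lt_0_compat|]; lra. }
(* Below beta, so that records exist; above 1/s - 1, so that s (1 + g) > 1. *)
set (g := (beta + (/ s - 1)) / 2).
assert (hg : 1 < g < beta) by (unfold g; lra).
assert (hsg : 1 < s * (1 + g)).
{ assert (/ s < 1 + g) by (unfold g; lra). apply (Rmult_lt_compat_l s) in H; auto. rewrite Rinv_r in H; lra. }
(* Half of the margin s - (1-2s)/(g-1), which is positive because s (1 + g) > 1; [e0] spends the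
   other half on the convergence of the sums over digits. *)
set (ka := (s - (1 - 2 * s) / (g - 1)) / 2).
assert (hka : 0 < ka).
{ unfold ka. assert ((1 - 2 * s) / (g - 1) < s); [|lra].
  apply (Rmult_lt_reg_r (g - 1)); [lra|]. unfold Rdiv. rewrite Rmult_assoc, Rinv_l; lra. }
set (e0 := ka * (g - 1)).
assert (he0 : 0 < e0) by (unfold e0; nra).
assert (hke : s - (1 + e0 - 2 * s) / (g - 1) = ka).
{ unfold e0. replace ((1 + ka * (g - 1) - 2 * s) / (g - 1)) with ((1 - 2 * s) / (g - 1) + ka) by (field; lra).
  unfold ka. field. lra. }
set (ze := 1 + / e0).
assert (hze : 1 <= ze) by (unfold ze; pose proof (Rinv_0_lt_compat e0 he0); lra).
destruct (exp_pow_beats ze (ka / 2) g hze ltac:(lra) (proj1 hg)) as [N3 hN3].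
apply measure_zero_index; [lra|]. intros delta eps hdelta heps.
destruct (inv_q_sq_small delta hdelta) as [N1 hN1].
set (r := exp (- (ka / 2))).
assert (hr : 0 <= r < 1).
{ unfold r. split; [apply Rlt_le, exp_pos|]. rewrite <- exp_0. apply exp_increasing. lra. }
set (C := exp s * / (1 - r)).
assert (hC : 0 < C) by (unfold C; apply Rmult_lt_0_compat; [apply exp_pos|apply Rinv_0_lt_compat; lra]).
destruct (INR_unbounded (C / eps + 1)) as [N2 hN2].
set (N := (N3 + N1 + N2 + 2)%nat).
assert (hNe : C * / (INR N - 1) <= eps).
{ assert (INR N2 <= INR N) by (apply le_INR; unfold N; lia).
  assert (0 < C / eps) by (apply Rdiv_lt_0_compat; auto).
  apply (Rmult_le_reg_r (INR N - 1)); [lra|]. rewrite Rmult_assoc, Rinv_l by lra.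
  assert (C / eps * eps <= (INR N - 1) * eps) by (apply Rmult_le_compat_r; lra).
  replace (C / eps * eps) with C in * by (field; lra). lra. }
set (Q := fun L : nat => exp ((INR L + 1) / (g - 1))).
(* Here i is the integer part of ln a_n. A record of at least 1 gives g^n <= i + 1, and [Q i] bounds
   the product of the earlier digits. *)
set (ok := fun x : index => match x with (n, i, u, v) =>
  (N <= n)%nat /\ g ^ n <= INR i + 1 /\ length u = (n - 1)%nat /\ pos_word u /\ v = nil /\
  wprod u <= Q i end).
set (rad := fun x : index => match x with (n, i, u, v) => exp (- INR i) / (q u * q u) end).
assert (hok : forall x, ok x -> 0 < rad x <= delta).
{ intros [[[n i] u] v] [h1 [h2 [h3 [h4 [h5 h6]]]]]. unfold rad.
  pose proof (q_ge1 u h4). pose proof (exp_pos (- INR i)).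
  assert (0 < / (q u * q u)) by (apply Rinv_0_lt_compat; nra).
  split; [apply Rmult_lt_0_compat; auto|].
  apply Rle_trans with (1 * / (q u * q u)); [|rewrite Rmult_1_l; apply hN1; auto; unfold N in *; lia].
  apply Rmult_le_compat_r; [lra|]. rewrite <- exp_0. pose proof (pos_INR i).
  destruct (Req_dec (INR i) 0) as [->|]; [rewrite Ropp_0; lra|apply Rlt_le, exp_increasing; lra]. }
exists (fun x y => ok x /\ match x with (n, i, u, v) =>
  exists th, 0 <= th <= 1 /\ th <= exp (- INR i) /\ y = cf u th end).
exists (fun x => if excluded_middle_informative (ok x) then rad x else 0).
split; [|split; [|split]].
- intros [[[n i] u] v] x y [hx [th [t1 [t2 ->]]]] [_ [th' [t1' [t2' ->]]]].
  destruct excluded_middle_informative as [_|hn]; [|tauto].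
  destruct hx as [h1 [h2 [h3 [h4 _]]]]. apply cover_piece_diam; auto.
- intros x. destruct excluded_middle_informative as [hx|]; [|lra].
  specialize (hok x hx). lra.
- intros x [hx [hi hio]].
  assert (hdp : forall j, (1 <= digit x j)%nat) by (intros; apply digit_step; auto).
  set (rr := fun j => ln (INR (digit x j)) / g ^ (S j)).
  assert (hgp : forall j, 0 < g ^ j) by (intros; apply pow_lt; lra).
  destruct (record_index rr N) as [k [hk1 [hk2 hk3]]].
  (* If all ln(a_j)/g^j were at most T, with T >= 0, the product of the block at n would have
     logarithm at most l T g^(n+l), less than beta^n for large n, against phi(n) >= exp(beta^n). *)
  { intros T. destruct (pow_beats_linear (beta / g) (Rmax 0 T * (INR l * g ^ l) + 1)) as [K1 hK1].
    { apply (Rmult_lt_reg_r g); [lra|]. unfold Rdiv. rewrite Rmult_assoc, Rinv_l; lra. }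
    destruct (hio (K1 + N0 + 1)%nat) as [n [hn1 [hn2 hn3]]].
    destruct n as [|n]; [lia|]. rewrite block_prod_digits in hn3 by auto.
    specialize (hphi (S n) hn2 ltac:(lia)).
    assert (hlp : 0 < INR l) by (apply lt_0_INR; lia).
    apply NNPP. intros hno.
    assert (hpw : pos_word (map (digit x) (seq n l))) by (apply Forall_map, Forall_forall; auto).
    assert (hall : forall j, rr j <= Rmax 0 T).
    { intros j. apply Rnot_lt_le. intros hc. apply hno. exists j.
      pose proof (Rmax_r 0 T). lra. }
    assert (hw : ln (wprod (map (digit x) (seq n l))) <= INR l * (Rmax 0 T * g ^ (S n + l))).
    { rewrite <- (length_seq l n) at 2. rewrite <- (length_map (digit x) (seq n l)).
      apply wprod_ln_le; auto. intros a ha. apply in_map_iff in ha. destruct ha as [j [<- hj]].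
      apply in_seq in hj. specialize (hall j). unfold rr in hall.
      apply (Rmult_le_compat_r (g ^ S j)) in hall; [|apply Rlt_le, hgp].
      unfold Rdiv in hall. rewrite Rmult_assoc, Rinv_l, Rmult_1_r in hall by (pose proof (hgp (S j)); lra).
      eapply Rle_trans; [exact hall|]. apply Rmult_le_compat_l; [apply Rmax_l|].
      apply Rle_pow; [lra|lia]. }
    assert (hlow : beta ^ S n <= ln (wprod (map (digit x) (seq n l)))).
    { rewrite <- (ln_exp (beta ^ S n)). apply ln_le; [apply exp_pos|]. lra. }
    specialize (hK1 (S n) ltac:(lia)).
    unfold Rdiv in hK1. rewrite Rpow_mult_distr, pow_inv in hK1.
    apply (Rmult_le_compat_r (g ^ S n)) in hK1; [|apply Rlt_le, hgp].
    replace (beta ^ S n * / g ^ S n * g ^ S n) with (beta ^ S n) in hK1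
      by (field; pose proof (hgp (S n)); lra).
    rewrite pow_add in hw. pose proof (hgp (S n)). pose proof (hgp l). pose proof (Rmax_l 0 T).
    assert (h1n : 1 <= INR (S n)) by (apply INR_ge1; lia).
    set (G := Rmax 0 T * (INR l * g ^ l)) in *.
    assert (hG : 0 <= G) by (unfold G; apply Rmult_le_pos; auto; nra).
    replace (INR l * (Rmax 0 T * (g ^ S n * g ^ l))) with (G * g ^ S n) in hw by (unfold G; ring).
    set (X := g ^ S n) in *. assert (G * X < (G + 1) * INR (S n) * X); [|lra].
    apply Rmult_lt_compat_r; auto. nra. }
  set (a := digit x k). set (lna := ln (INR a)).
  assert (ha1 : 1 <= INR a) by (apply INR_ge1, hdp).
  assert (hlna : g ^ S k <= lna).
  { unfold rr in hk2. fold a lna in hk2. apply (Rmult_le_compat_r (g ^ S k)) in hk2; [|apply Rlt_le, hgp].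
    unfold Rdiv in hk2. rewrite Rmult_assoc, Rinv_l in hk2 by (pose proof (hgp (S k)); lra). lra. }
  set (L := Z.to_nat (Int_part lna)).
  assert (hL : INR L <= lna < INR L + 1).
  { unfold L. pose proof (base_Int_part lna) as [b1 b2]. pose proof (hgp (S k)).
    assert (0 <= Int_part lna)%Z.
    { assert (IZR (-1) < IZR (Int_part lna)) as hh by lra. apply lt_IZR in hh. lia. }
    rewrite INR_IZR_INZ, Z2Nat.id by auto. lra. }
  exists (S k, L, prefix (digit x) k, nil). split.
  + unfold ok. repeat split; auto.
    * lra.
    * rewrite prefix_length. lia.
    * apply prefix_positive; auto.
    * assert (hw : forall j, (j <= k)%nat -> ln (wprod (prefix (digit x) j)) <= lna / g ^ S k * (g ^ S j / (g - 1))).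
      { induction j as [|j IH]; intros hj.
        - simpl wprod. rewrite ln_1. apply Rmult_le_pos.
          + apply Rlt_le, Rdiv_lt_0_compat; [pose proof (hgp (S k)); lra|auto].
          + apply Rlt_le, Rdiv_lt_0_compat; [auto|lra].
        - rewrite prefix_S, wprod_app. pose proof (wprod_ge1 _ (prefix_positive (digit x) j hdp)).
          pose proof (INR_ge1 _ (hdp j)). cbn [wprod]. rewrite Rmult_1_r, ln_mult by lra.
          specialize (IH ltac:(lia)). specialize (hk3 j ltac:(lia)). unfold rr in hk3. fold a lna in hk3.
          apply (Rmult_le_compat_r (g ^ S j)) in hk3; [|apply Rlt_le, hgp].
          unfold Rdiv in hk3 at 1. rewrite Rmult_assoc, Rinv_l, Rmult_1_r in hk3 by (pose proof (hgp (S j)); lra).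
          replace (lna / g ^ S k * (g ^ S (S j) / (g - 1))) with
            (lna / g ^ S k * (g ^ S j / (g - 1)) + lna / g ^ S k * g ^ S j).
          + lra.
          + change (g ^ S (S j)) with (g * g ^ S j). field. pose proof (hgp (S k)). split; lra. }
      specialize (hw k (le_n _)).
      replace (lna / g ^ S k * (g ^ S k / (g - 1))) with (lna / (g - 1)) in hw
        by (field; pose proof (hgp (S k)); split; lra).
      unfold Q. pose proof (wprod_ge1 _ (prefix_positive (digit x) k hdp)).
      rewrite <- (exp_ln (wprod _)) by lra.
      assert (hx2 : ln (wprod (prefix (digit x) k)) < (INR L + 1) / (g - 1)).
      { eapply Rle_lt_trans; [exact hw|]. apply Rmult_lt_compat_r; [apply Rinv_0_lt_compat|]; lra. }
      apply Rlt_le, exp_increasing; auto.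
  + exists (gtail k x). destruct (gtail_irrational x k hx hi) as [ht _]. split; [lra|]. split.
    * destruct (digit_step x k hx hi) as [d1 [d2 _]]. rewrite d2. fold a.
      destruct (gtail_irrational x (S k) hx hi) as [ht' _].
      rewrite exp_Ropp. apply Rinv_le_contravar; [apply exp_pos|].
      assert (exp (INR L) <= INR a).
      { rewrite <- (exp_ln (INR a)) by lra. fold lna.
        destruct hL as [[hL|hL] _]; [apply Rlt_le, exp_increasing; auto|rewrite hL; lra]. }
      lra.
    * apply cf_digits; auto.
- intros L hL. eapply Rle_trans; [|exact hNe]. revert L hL.
  apply (sum_index_le _ N (fun _ => 0%nat)).
  + intros; apply dpow_nonneg.
  + intros n i u v. destruct excluded_middle_informative as [[h1 [h2 [h3 [h4 [-> h6]]]]]|_].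
    * intros _. repeat split; auto. constructor.
    * intros h0. exfalso. apply h0. unfold dpow. destruct Rlt_dec; lra.
  + intros K.
    apply Rle_trans with (sumR (fun n => C * / (INR n * INR n)) (seq N K)).
    2:{ rewrite sumR_scal. apply Rmult_le_compat_l; [lra|]. apply sum_inv_sq. unfold N; lia. }
    apply sumR_le. intros n hn. apply in_seq in hn.
    assert (hn1 : (1 <= n)%nat) by (unfold N in *; lia). pose proof (INR_ge1 n hn1) as hin.
    specialize (hN3 n ltac:(unfold N in *; lia)).
    assert (hterm : forall i, sumR (fun u => sumR (fun v => dpow
       (if excluded_middle_informative (ok (n, i, u, v)) then rad (n, i, u, v) else 0) s)
        (words K 0)) (words K (n - 1)) <= exp s * / (INR n * INR n) * r ^ i).
    { intros i.
      assert (hrhs : 0 <= exp s * / (INR n * INR n) * r ^ i).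
      { apply Rmult_le_pos; [|apply pow_le; lra]. apply Rmult_le_pos; [apply Rlt_le, exp_pos|].
        apply Rlt_le, Rinv_0_lt_compat. nra. }
      destruct (Rle_lt_dec (g ^ n) (INR i + 1)) as [hgi|hgi].
      2:{ apply Rle_trans with (sumR (fun u : list nat => 0) (words K (n - 1))).
          - apply sumR_le. intros u _. simpl.
            destruct excluded_middle_informative as [[_ [h2 _]]|_]; [lra|].
            unfold dpow. destruct Rlt_dec; lra.
          - rewrite sumR_const. lra. }
      apply Rle_trans with (sumR (fun u => exp (- (INR i * s)) * wterm (Q i) (2 * s) u) (words K (n - 1))).
      - apply sumR_le. intros u hu. apply words_pos in hu. simpl. rewrite Rplus_0_r.
        pose proof (wterm_nonneg (Q i) (2 * s) u). pose proof (exp_pos (- (INR i * s))).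
        destruct excluded_middle_informative as [hx|_].
        2:{ unfold dpow. destruct (Rlt_dec 0 0); [lra|]. apply Rmult_le_pos; lra. }
        rewrite dpow_pos by (apply (hok (n, i, u, [])); auto).
        destruct hx as [_ [_ [_ [_ [_ h6]]]]].
        unfold wterm. destruct (Rle_dec (wprod u) (Q i)); [|tauto].
        pose proof (q_ge1 u hu). pose proof (wprod_ge1 u hu). pose proof (wprod_le_q u hu).
        assert (0 < / (q u * q u)) by (apply Rinv_0_lt_compat; nra).
        unfold Rdiv. rewrite Rpower_mult_l, Rpower_inv_l, Rpower_mult_l by (try apply exp_pos; nra).
        rewrite <- Rpower_plus. unfold Rpower at 1. rewrite ln_exp.
        replace (s * - INR i) with (- (INR i * s)) by ring.
        apply Rmult_le_compat_l; [lra|]. replace (- s + - s) with (- (2 * s)) by ring.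
        apply Rpower_anti; lra.
      - rewrite sumR_scal.
        assert (hQ : 1 <= Q i).
        { apply Rle_trans with (exp 0); [rewrite exp_0; lra|]. unfold Q. pose proof (pos_INR i).
          apply Rlt_le, exp_increasing, Rdiv_lt_0_compat; lra. }
        eapply Rle_trans.
        { apply Rmult_le_compat_l; [apply Rlt_le, exp_pos|]. apply (sum_words_wterm e0); auto. lra. }
        fold ze.
        assert (hzn : ze ^ (n - 1) <= ze ^ n) by (apply Rle_pow; [lra|lia]).
        assert (hpz : 0 < ze ^ (n - 1)) by (apply pow_lt; lra).
        assert (hQp : Rpower (Q i) (1 + e0 - 2 * s) = exp ((INR i + 1) * ((1 + e0 - 2 * s) / (g - 1)))).
        { unfold Rpower, Q. rewrite ln_exp. f_equal. field. lra. }
        rewrite hQp, <- Rmult_assoc, <- exp_plus.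
        (* The exponent is s - ka (i+1). Since i + 1 >= g^n, one half of ka (i+1) absorbs n^2
           [ze]^n; the other half leaves the geometric series in [r]. *)
        replace (- (INR i * s) + (INR i + 1) * ((1 + e0 - 2 * s) / (g - 1))) with
          (s + - (ka / 2) * (INR i + 1) + - (ka / 2) * (INR i + 1)) by (rewrite <- hke; field; lra).
        rewrite !exp_plus.
        assert (hr1 : exp (- (ka / 2) * (INR i + 1)) <= r ^ i).
        { unfold r. rewrite <- Rpower_pow by apply exp_pos. unfold Rpower. rewrite ln_exp.
          apply Rlt_le, exp_increasing. lra. }
        assert (hr2 : exp (- (ka / 2) * (INR i + 1)) * ze ^ n <= / (INR n * INR n)).
        { apply (Rmult_le_reg_l (INR n * INR n)); [nra|]. rewrite Rinv_r by nra.
          replace (INR n * INR n * (exp (- (ka / 2) * (INR i + 1)) * ze ^ n)) with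
            (exp (- (ka / 2) * (INR i + 1)) * (INR n * INR n * ze ^ n)) by ring.
          apply Rle_trans with (exp (- (ka / 2) * (INR i + 1)) * exp (ka / 2 * g ^ n)).
          - apply Rmult_le_compat_l; [apply Rlt_le, exp_pos|auto].
          - apply Rle_trans with (exp 0); [|rewrite exp_0; lra]. rewrite <- exp_plus.
            assert (hle : - (ka / 2) * (INR i + 1) + ka / 2 * g ^ n <= 0) by nra.
            destruct hle as [hle|hle]; [apply Rlt_le, exp_increasing; auto|rewrite hle; lra]. }
        set (X := exp (- (ka / 2) * (INR i + 1))) in *.
        assert (hX : 0 < X) by apply exp_pos. pose proof (exp_pos s).
        replace (exp s * X * X * ze ^ (n - 1)) with (exp s * (X * ze ^ (n - 1)) * X) by ring.
        apply Rmult_le_compat; auto; [|lra|].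
        + apply Rmult_le_pos; [lra|]. apply Rmult_le_pos; lra.
        + apply Rmult_le_compat_l; [lra|]. eapply Rle_trans; [|exact hr2].
          apply Rmult_le_compat_l; lra. }
    eapply Rle_trans; [apply sumR_le; intros i _; apply hterm|].
    rewrite sumR_scal. unfold C.
    replace (exp s * / (1 - r) * / (INR n * INR n)) with (exp s * / (INR n * INR n) * / (1 - r)) by ring.
    apply Rmult_le_compat_l; [|apply geom_sum_le; auto].
    apply Rmult_le_pos; [apply Rlt_le, exp_pos|]. apply Rlt_le, Rinv_0_lt_compat. nra.
Qed.

(** * Lower bounds *)

(** [sfac] bounds (2a)^(2t)/|P| by means of a <= N^(1+eps), |P| >= N and 2^(2t) <= 4; [slim] is
    (N/N^(2+2eps))^t, within the limit of [digit_kind]. *)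
Definition digit_step_of (t eps N : R) (P : list nat) : step :=
  Step (map (fun a => [a]) P) (fun _ => / INR (length P)) 1
    (4 * Rpower N (2 * t * (1 + eps) - 1)) (Rpower N (- (t * (1 + 2 * eps)))).

Lemma pow_2t_le x t : 1 <= x -> 0 < t <= 1 -> Rpower x (2 * t) <= x * x.
Proof.
intros hx ht. apply Rle_trans with (Rpower x (1 + 1)); [apply Rle_Rpower; lra|].
rewrite Rpower_plus, Rpower_1; lra.
Qed.

Lemma digit_step_ok M m t eps N P : 0 < t <= 1 -> 0 < eps -> 2 <= N -> NoDup P ->
  (forall p, In p P -> N <= INR p <= Rpower N (1 + eps)) -> N <= INR (length P) ->
  step_ok M m t (digit_step_of t eps N P).
Proof.
intros ht he hN hP hPN hlen.
assert (hP2 : forall p, In p P -> (2 <= p)%nat).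
{ intros p hp. apply INR_le. specialize (hPN p hp). simpl. lra. }
assert (hNe : 1 <= Rpower N (1 + eps)) by (apply Rpower_ge1; lra).
constructor; simpl.
- apply Injective_map_NoDup; auto. intros a b e. congruence.
- intros w hw. apply in_map_iff in hw. destruct hw as [a [<- ha]]. specialize (hP2 a ha).
  repeat split; auto.
  + constructor; [lia|constructor].
  + destruct i as [|i]; simpl in H; [lia|destruct i; discriminate].
  + destruct i as [|i]; simpl in H; [lia|destruct i; discriminate].
- lia.
- intros _. apply Rlt_le, Rinv_0_lt_compat. lra.
- rewrite sumR_map, sumR_const. field. lra.
- intros w hw. apply in_map_iff in hw. destruct hw as [a [<- ha]]. rewrite q_single.
  specialize (hPN a ha).
  assert (h1 : / INR (length P) <= / N) by (apply Rinv_le_contravar; lra).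
  assert (h2 : Rpower (2 * INR a) (2 * t) <= 4 * Rpower N (2 * t * (1 + eps))).
  { rewrite Rpower_mult_l by lra. pose proof (pow_2t_le 2 t ltac:(lra) ht).
    apply Rmult_le_compat; try apply Rlt_le, Rpower_gt0; [lra|].
    replace (2 * t * (1 + eps)) with ((1 + eps) * (2 * t)) by ring.
    rewrite <- (Rpower_mult N (1 + eps)).
    apply Rle_Rpower_l; lra. }
  replace (2 * t * (1 + eps) - 1) with (2 * t * (1 + eps) + - (1)) by ring.
  rewrite Rpower_plus, Rpower_Ropp, Rpower_1 by lra.
  rewrite Rmult_comm, <- Rmult_assoc.
  apply Rmult_le_compat; auto; [apply Rlt_le, Rpower_gt0|apply Rlt_le, Rinv_0_lt_compat; lra].
- apply Rpower_le1; [lra|]. nra.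
- right. exists P, (Rpower N (1 + eps)). simpl. repeat split; auto.
  + apply hPN; auto.
  + replace (- (t * (1 + 2 * eps))) with ((1 + - (1 + eps) + - (1 + eps)) * t) by ring.
    rewrite <- Rpower_mult. apply Rle_Rpower_l; [lra|]. split; [apply Rpower_gt0|].
    rewrite (Rpower_plus (1 + - (1 + eps)) (- (1 + eps))), (Rpower_plus 1 (- (1 + eps))).
    rewrite Rpower_1, !Rpower_Ropp by lra. unfold Rdiv. rewrite Rinv_mult.
    rewrite <- Rmult_assoc.
    assert (0 < / Rpower N (1 + eps)) by (apply Rinv_0_lt_compat; lra).
    apply Rmult_le_compat_r; [lra|]. apply Rmult_le_compat_r; lra.
Qed.

(** A single word of probability 1 brings the block to its exact position. Its cost is bounded: q <=
    3^p for r <= p, and 2t <= 2 gives the square. *)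
Definition filler_step (r p : nat) : step :=
  Step [repeat 2%nat r] (fun _ => 1) r ((2 * 3 ^ p) * (2 * 3 ^ p)) 1.

Lemma filler_step_ok M m t r p : 0 < t <= 1 -> (2 <= M)%nat -> (1 <= r <= p)%nat -> (p <= m)%nat ->
  step_ok M m t (filler_step r p).
Proof.
intros ht hM hr hp.
assert (hpos : forall k, pos_word (repeat 2%nat k)) by (intros k; induction k; constructor; auto).
assert (hM2 : forall k j, (2 <= j)%nat -> Forall (fun a => (a <= j)%nat) (repeat 2%nat k))
  by (intros k j hj; induction k; constructor; auto).
assert (hns : forall i, nth i (repeat 2%nat r) 0%nat <> 1%nat).
{ clear. intros i. revert i. induction r as [|r IH]; intros [|i]; simpl; auto. }
constructor; simpl.
- repeat constructor; auto.
- intros w [<-|[]]. rewrite repeat_length. split; [auto|split; [auto|]].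
  intros i hi. exfalso. exact (hns i hi).
- lia.
- intros; lra.
- ring.
- intros w [<-|[]]. pose proof (q_ge1 _ (hpos r)). rewrite Rmult_1_l.
  eapply Rle_trans; [apply pow_2t_le; [lra|auto]|].
  assert (hq : q (repeat 2%nat r) <= 3 ^ p).
  { eapply Rle_trans; [apply (q_le_pow _ 2); auto|]. rewrite repeat_length. simpl INR.
    replace (1 + 1 + 1) with 3 by ring. apply Rle_pow; [lra|lia]. }
  apply Rmult_le_compat; lra.
- lra.
- left. split; simpl; [|lia]. intros w [<-|[]]. auto.
Qed.

(** The word v has probability proportional to q(v)^(-2t). The final 2 keeps the whole word from
    ending in 1; it gives 2 q(v ++ [2]) <= 8 q(v), and 8^(2t) <= 64. *)
Definition chunk_step (t : R) (M m : nat) : step :=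
  Step (map (fun v => v ++ [2%nat]) (words M m))
    (fun w => Rpower (q (removelast w)) (- (2 * t)) / Zsum M m t) (S m) (64 / Zsum M m t) 1.

Lemma chunk_step_ok M m t : 0 < t <= 1 -> (2 <= M)%nat -> 0 < Zsum M m t ->
  step_ok M (S m) t (chunk_step t M m).
Proof.
intros ht hM hZ. constructor; simpl.
- apply Injective_map_NoDup; [|apply NoDup_words]. intros a b e. apply app_inj_tail in e. tauto.
- intros w hw. apply in_map_iff in hw. destruct hw as [v [<- hv]].
  assert (hp := words_pos _ _ _ hv). apply In_words in hv. destruct hv as [h1 h2].
  rewrite length_app, h1. simpl. split; [lia|]. split.
  + apply pos_word_app. split; auto. repeat constructor.
  + intros i hi. rewrite length_app, h1. simpl.
    destruct (lt_dec i m) as [him|him].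
    * split; [lia|]. destruct (Nat.eq_dec (S i) m) as [e|e].
      -- rewrite app_nth2 by lia. replace (S i - length v)%nat with 0%nat by lia. simpl. lia.
      -- rewrite app_nth1 by lia. rewrite Forall_forall in h2. apply h2, nth_In. lia.
    * rewrite app_nth2 in hi by lia. destruct (i - length v)%nat as [|j]; simpl in hi; [discriminate|].
      destruct j; discriminate.
- lia.
- intros w. apply Rlt_le, Rdiv_lt_0_compat; [apply Rpower_gt0|auto].
- rewrite sumR_map.
  rewrite (sumR_ext _ (fun v => / Zsum M m t * Rpower (q v) (- (2 * t)))).
  + rewrite sumR_scal. fold (Zsum M m t). field. lra.
  + intros v _. rewrite removelast_last. unfold Rdiv. ring.
- intros w hw. apply in_map_iff in hw. destruct hw as [v [<- hv]]. apply words_pos in hv.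
  rewrite removelast_last. pose proof (q_ge1 v hv).
  assert (hp2 : pos_word [2%nat]) by repeat constructor; auto.
  pose proof (q_app v [2%nat] hv hp2) as hq. rewrite q_single in hq. simpl INR in hq.
  assert (h8 : Rpower (2 * q (v ++ [2%nat])) (2 * t) <= 64 * Rpower (q v) (2 * t)).
  { apply Rle_trans with (Rpower (8 * q v) (2 * t)); [apply Rle_Rpower_l; nra|].
    rewrite Rpower_mult_l by lra. apply Rmult_le_compat_r; [apply Rlt_le, Rpower_gt0|].
    pose proof (pow_2t_le 8 t ltac:(lra) ht). lra. }
  rewrite Rpower_Ropp. pose proof (Rpower_gt0 (q v) (2 * t)).
  apply Rle_trans with (/ Rpower (q v) (2 * t) / Zsum M m t * (64 * Rpower (q v) (2 * t))).
  + apply Rmult_le_compat_l; auto. apply Rlt_le, Rdiv_lt_0_compat; auto. apply Rinv_0_lt_compat; auto.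
  + apply Req_le. field. split; lra.
- lra.
- left. split; simpl; [|lia]. intros w hw. apply in_map_iff in hw. destruct hw as [v [<- hv]].
  apply In_words in hv. apply Forall_app. split.
  + eapply Forall_impl; [|apply hv]. simpl; intros; lia.
  + repeat constructor; auto.
Qed.

Lemma block_prod_primes d n l : (forall i, (1 <= d i)%nat) ->
  (forall i, (i < l)%nat -> prime (Z.of_nat (d (n + i)%nat))) ->
  block_prod (fun m => pq' m (xof d)) (S n) l = wprod (map d (seq n l)).
Proof.
intros hd. revert n; induction l as [|l IH]; intros n hp; simpl; auto.
rewrite IH.
- unfold pq' at 1. rewrite pq_xof by auto. pose proof (hp 0%nat ltac:(lia)) as h0.
  rewrite Nat.add_0_r in h0. destruct prime_dec; [|tauto]. rewrite INR_IZR_INZ. auto.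
- intros i hi. replace (S n + i)%nat with (n + S i)%nat by lia. apply hp. lia.
Qed.

Lemma E'_of_digits phi l d : (forall i, (1 <= d i)%nat) ->
  (forall N, exists n, (N <= S n)%nat /\ (forall i, (i < l)%nat -> prime (Z.of_nat (d (n + i)%nat))) /\
     phi (S n) <= wprod (map d (seq n l))) ->
  E'_set phi l (xof d).
Proof.
intros hd h. split; [apply xof_range; auto|]. split; [apply xof_irrational; auto|].
intros N. destruct (h N) as [n [h1 [h2 h3]]]. exists (S n). split; auto. split; [lia|].
rewrite block_prod_primes by auto. lra.
Qed.

Lemma lower_low (phi : nat -> R) (l : nat) (beta t : R) :
  (1 <= l)%nat -> 1 < beta -> 0 < t < / (1 + beta) ->
  (forall N, exists n, (N <= S n)%nat /\ phi (S n) <= exp (beta ^ S n)) ->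
  Rbar_le t (hausdorff_dim (E'_set phi l)).
Proof.
intros hl hb ht hphi.
set (s := / (1 + beta)) in *.
assert (hs2 : s < / 2) by (unfold s; apply Rinv_lt_contravar; lra).
assert (hsb : s * (1 + beta) = 1) by (unfold s; field; lra).
set (s' := (s + t) / 2).
set (eps := (s - t) / (4 * t)).
assert (heps : 0 < eps) by (apply Rdiv_lt_0_compat; lra).
assert (he2 : t * (1 + 2 * eps) = s') by (unfold eps, s'; field; lra).
assert (hs' : t < s' < s) by (unfold s'; lra).
(* The digits before k contribute (N_0 ... N_(k-1))^(-(1-2s')), about N_k^(-(1-2s')/(beta-1)), where
   N_k^(-s') is required. The margin [th] is positive because s' (1 + beta) < 1. *)
set (th := (1 - 2 * s') / (beta - 1) - s').
assert (hth : 0 < th).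
{ unfold th. assert (s' < (1 - 2 * s') / (beta - 1)); [|lra].
  apply (Rmult_lt_reg_r (beta - 1)); [lra|]. unfold Rdiv. rewrite Rmult_assoc, Rinv_l by lra. nra. }
destruct (primes_in_range eps heps) as [N0 [hN0 hprimes]].
assert (hl4 : 0 < ln 4) by (rewrite <- ln_1; apply ln_increasing; lra).
(* [N0] is for the range of primes and 2 for digits at least 2; by Bernoulli's inequality the last
   summand makes 4^k, the product of the constants 4, at most N_k^th. As c >= 1, each single digit
   of index n reaches exp(beta^(n+1)). *)
set (c := N0 + 2 + ln 4 / (th * (beta - 1))).
assert (hc1 : 0 < ln 4 / (th * (beta - 1))) by (apply Rdiv_lt_0_compat; auto; apply Rmult_lt_0_compat; lra).
assert (hc2 : ln 4 <= c * th * (beta - 1)).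
{ assert (h : ln 4 / (th * (beta - 1)) <= c) by (unfold c; lra).
  apply (Rmult_le_compat_r (th * (beta - 1))) in h; [|apply Rlt_le, Rmult_lt_0_compat; lra].
  replace (ln 4 / (th * (beta - 1)) * (th * (beta - 1))) with (ln 4) in h by (field; split; lra). lra. }
set (Nk := fun k => exp (c * beta ^ S k)).
assert (hbp : forall k, 1 <= beta ^ k) by (intros; apply pow_R1_Rle; lra).
assert (hNk : forall k, N0 <= Nk k /\ 2 <= Nk k).
{ intros k. unfold Nk. pose proof (exp_ineq1_le (c * beta ^ S k)). pose proof (hbp (S k)).
  unfold c in *. nra. }
set (P := fun k => proj1_sig (constructive_indefinite_description _ (hprimes (Nk k) (proj1 (hNk k))))).
assert (hP : forall k, NoDup (P k) /\
  (forall p, In p (P k) -> prime (Z.of_nat p) /\ Nk k <= INR p <= Rpower (Nk k) (1 + eps)) /\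
  Nk k <= INR (length (P k))).
{ intros k. unfold P. destruct constructive_indefinite_description; auto. }
set (A := fun k => digit_step_of t eps (Nk k) (P k)).
set (C0 := exp (c * (1 - 2 * s') * (beta / (beta - 1)))).
apply (tree_dim A 2 1 t C0); [lra|lia|apply exp_pos| | |].
- intros k. destruct (hP k) as [h1 [h2 h3]]. apply digit_step_ok; auto; [lra|apply hNk|].
  intros p hp. apply h2; auto.
- assert (hpf : forall k, pfac A k <= exp (INR k * ln 4 - c * (1 - 2 * s') * ((beta ^ S k - beta) / (beta - 1)))).
  { induction k as [|k IH].
    - simpl. match goal with |- _ <= exp ?e => replace e with 0 by (field; lra) end. rewrite exp_0. lra.
    - cbn [pfac]. unfold A at 2. simpl sfac.
      assert (h1 : 4 * Rpower (Nk k) (2 * t * (1 + eps) - 1) <= exp (ln 4 - (1 - 2 * s') * (c * beta ^ S k))).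
      { unfold Rminus at 2. rewrite exp_plus, exp_ln by lra. apply Rmult_le_compat_l; [lra|].
        apply Rle_trans with (Rpower (Nk k) (- (1 - 2 * s'))).
        - apply Rle_Rpower; [destruct (hNk k); lra|]. nra.
        - unfold Rpower, Nk. rewrite ln_exp. apply Req_le. f_equal. ring. }
      eapply Rle_trans; [apply Rmult_le_compat; [| |exact IH|exact h1]|].
      + clear - A. assert (h : forall j, 0 <= pfac A j).
        { induction j; simpl; [lra|]. apply Rmult_le_pos; auto.
          apply Rmult_le_pos; [lra|apply Rlt_le, Rpower_gt0]. }
        apply h.
      + apply Rmult_le_pos; [lra|apply Rlt_le, Rpower_gt0].
      + rewrite <- exp_plus. apply Req_le. f_equal. rewrite S_INR.
        change (beta ^ S (S k)) with (beta * beta ^ S k). field. lra. }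
  intros k. eapply Rle_trans; [apply hpf|]. unfold A. simpl slim. rewrite he2.
  unfold C0, Rpower, Nk. rewrite ln_exp, <- exp_plus.
  assert (hle : INR k * ln 4 - c * (1 - 2 * s') * ((beta ^ S k - beta) / (beta - 1)) <=
    c * (1 - 2 * s') * (beta / (beta - 1)) + - s' * (c * beta ^ S k)).
  { replace (c * (1 - 2 * s') * ((beta ^ S k - beta) / (beta - 1))) with
      (c * (th + s') * beta ^ S k - c * (1 - 2 * s') * (beta / (beta - 1))) by (unfold th; field; lra).
    assert (hbern : INR k * (beta - 1) <= beta ^ S k).
    { pose proof (poly k (beta - 1) ltac:(lra)) as hp. replace (1 + (beta - 1)) with beta in hp by ring.
      simpl. pose proof (hbp k). nra. }
    assert (INR k * ln 4 <= c * th * beta ^ S k).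
    { apply Rle_trans with (INR k * (c * th * (beta - 1))).
      - apply Rmult_le_compat_l; [apply pos_INR|auto].
      - replace (INR k * (c * th * (beta - 1))) with (c * th * (INR k * (beta - 1))) by ring.
        apply Rmult_le_compat_l; auto. unfold c. nra. }
    lra. }
  destruct hle as [hle|hle]; [apply Rlt_le, exp_increasing; auto|rewrite hle; lra].
- intros om hv.
  assert (hom : forall k, exists a, om k = [a] /\ In a (P k)).
  { intros k. pose proof (hv k) as hk. simpl in hk. apply in_map_iff in hk. destruct hk as [a [e ha]]. eauto. }
  assert (hlen : forall k, length (om k) = 1%nat) by (intros k; destruct (hom k) as [a [-> _]]; auto).
  assert (hcat : forall k, length (cat om k) = k).
  { induction k as [|k IH]; auto. rewrite cat_S, length_app, IH, hlen. lia. }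
  assert (hdig : forall k, In (dig om k) (P k)).
  { intros k. destruct (hom k) as [a [e ha]].
    assert (ed : dig om k = a).
    { rewrite <- (hcat k) at 1. rewrite <- (Nat.add_0_r (length (cat om k))). unfold dig.
      rewrite flat_block; [rewrite e; auto|intros; rewrite hlen; lia|rewrite hlen; lia]. }
    rewrite ed. auto. }
  assert (hd1 : forall k, (1 <= dig om k)%nat).
  { intros k. apply INR_le. destruct (hP k) as [_ [h2 _]]. destruct (h2 _ (hdig k)). destruct (hNk k). simpl. lra. }
  apply E'_of_digits; auto. intros N. destruct (hphi N) as [n [h1 h2]]. exists n. split; auto. split.
  + intros i _. destruct (hP (n + i)%nat) as [_ [h3 _]]. apply h3, hdig.
  (* One digit suffices to reach phi: the other factors of the block are at least 1. *)
  + destruct l as [|l']; [lia|]. simpl seq. cbn [map wprod].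
    assert (hw : 1 <= wprod (map (dig om) (seq (S n) l'))) by (apply wprod_ge1, Forall_map, Forall_forall; auto).
    destruct (hP n) as [_ [h3 _]]. destruct (h3 _ (hdig n)) as [_ [h4 _]].
    assert (exp (beta ^ S n) <= Nk n).
    { unfold Nk. pose proof (hbp (S n)). apply Rlt_le, exp_increasing. unfold c. nra. }
    pose proof (exp_pos (beta ^ S n)). nra.
Qed.

(** * Cantor sets for s > 1/2 *)

Lemma Zsum_pow M p Y z s j r : 0 <= s -> 0 <= Y -> 0 <= z -> Zsum M p s <= Y ->
  (forall n, Zsum M n s <= z ^ n) -> Zsum M (j * p + r) s <= Y ^ j * z ^ r.
Proof.
intros hs hY hz hZ hz2. induction j as [|j IH].
- simpl. rewrite Rmult_1_l. auto.
- replace (S j * p + r)%nat with (p + (j * p + r))%nat by lia.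
  eapply Rle_trans; [apply Zsum_app; auto|]. simpl pow. rewrite Rmult_assoc.
  apply Rmult_le_compat; auto; apply Zsum_nonneg.
Qed.

(* The gain [2^(2k(s-t))] on words of length [2k] absorbs every multiplicative constant. *)
Lemma choose_chunk s t : / 2 < s < 1 -> 0 < t < s -> exists M m Y, (2 <= M)%nat /\ 1 <= Y /\
  (forall M', Zsum M' (S m) s <= Y) /\ 256 * Y <= Zsum M m t.
Proof.
intros hs ht. set (z := 1 + / (2 * s - 1)).
assert (hz : 1 <= z) by (unfold z; pose proof (Rinv_0_lt_compat (2 * s - 1) ltac:(lra)); lra).
destruct (Zsum_ge1 s ltac:(lra)) as [M0 hM0].
set (b := Rpower 2 (2 * (s - t))).
assert (hb : 1 < b).
{ unfold b. apply Rle_lt_trans with (Rpower 2 0); [rewrite Rpower_O; lra|apply Rpower_lt; lra]. }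
destruct (pow_beats_linear b (512 * z) hb) as [k0 hk0].
set (k := S k0). set (m := (2 * k)%nat).
assert (hbk : 512 * z <= b ^ k).
{ specialize (hk0 k ltac:(unfold k; lia)). pose proof (INR_ge1 k ltac:(unfold k; lia)). nra. }
(* For s > 1/2 the sums are bounded in M, so some M1 comes within a factor 2 of the supremum. *)
assert (hsup : exists M1, forall M', Zsum M' m s <= 2 * Zsum M1 m s).
{ destruct (completeness (fun v => exists M', v = Zsum M' m s)) as [L [hL1 hL2]].
  - exists (z ^ m). intros v [M' ->]. apply Zsum_le_zeta. lra.
  - exists (Zsum 0 m s), 0%nat. auto.
  - assert (hL : 1 <= L) by (eapply Rle_trans; [apply (hM0 M0 m); auto|apply hL1; exists M0; auto]).
    apply NNPP. intros hn. assert (hub : L <= L / 2); [|lra].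
    apply hL2. intros v [M' ->]. apply Rnot_lt_le. intros hlt. apply hn. exists M'.
    intros M''. assert (Zsum M'' m s <= L) by (apply hL1; exists M''; auto). lra. }
destruct hsup as [M1 hM1].
set (M := (M0 + M1 + 2)%nat).
assert (hMM : forall M', Zsum M' m s <= 2 * Zsum M m s).
{ intros M'. pose proof (hM1 M'). pose proof (Zsum_mono M1 M m s ltac:(unfold M; lia)). lra. }
assert (hge : 1 <= Zsum M m s) by (apply hM0; unfold M; lia).
(* [Y] has to bound sums over [S m] digits, because the final 2 lengthens a chunk by one; the extra
   digit costs a factor z at most. *)
exists M, m, (z * (2 * Zsum M m s)). split; [unfold M; lia|]. split; [nra|]. split.
- intros M'. change (S m) with (1 + m)%nat. eapply Rle_trans; [apply Zsum_app; lra|].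
  apply Rmult_le_compat; try apply Zsum_nonneg; auto.
  eapply Rle_trans; [apply Zsum_le_zeta; lra|]. simpl. fold z. lra.
- pose proof (Zsum_compare M m s t ltac:(lra)) as hc. unfold m in hc at 1.
  rewrite Nat.div2_double in hc.
  replace (2 * INR k * (s - t)) with (2 * (s - t) * INR k) in hc by ring.
  rewrite <- Rpower_mult in hc. fold b in hc. rewrite Rpower_pow in hc by lra.
  eapply Rle_trans; [|exact hc].
  replace (256 * (z * (2 * Zsum M m s))) with (512 * z * Zsum M m s) by ring.
  apply Rmult_le_compat_r; lra.
Qed.

Lemma square_vs_pow4 C (p c0 : nat) : exists J0, forall j, (J0 <= j)%nat ->
  C * (INR (S j * p + c0) * INR (S j * p + c0)) <= 4 ^ j.
Proof.
set (C1 := Rmax 1 C). pose proof (Rmax_l 1 C). pose proof (Rmax_r 1 C). fold C1 in H, H0.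
destruct (pow_beats_linear 2 (C1 * (2 * INR (p + c0))) ltac:(lra)) as [J hJ].
exists (S J). intros j hj. specialize (hJ j ltac:(lia)).
assert (hx : INR (S j * p + c0) <= 2 * INR (p + c0) * INR j).
{ replace 2 with (INR 2) by reflexivity. rewrite <- !mult_INR. apply le_INR. nia. }
pose proof (pos_INR (S j * p + c0)) as hx0. set (X := INR (S j * p + c0)) in *.
replace 4 with (2 * 2) by ring. rewrite Rpow_mult_distr.
assert (hX : C1 * X <= 2 ^ j) by nra.
apply Rle_trans with ((C1 * X) * (C1 * X)).
- assert (0 <= X * X) by nra.
  replace ((C1 * X) * (C1 * X)) with ((C1 * C1) * (X * X)) by ring.
  apply Rmult_le_compat_r; nra.
- apply Rmult_le_compat; nra.
Qed.

(** Here r bounds mass * q^(2t) on entering the list. The run must return to at most 1, so that runs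
    can be strung together. *)
Fixpoint run_ok (r : R) (L : list step) : Prop :=
  match L with nil => r <= 1 | st :: L => r <= slim st /\ run_ok (r * sfac st) L end.

Lemma run_ok_repeat r c st L k : slim st = 1 -> sfac st = c -> 0 <= r <= 1 -> 0 <= c <= 1 ->
  run_ok (r * c ^ k) L -> run_ok r (repeat st k ++ L).
Proof.
intros h1 h2. revert r; induction k as [|k IH]; intros r hr hc h; simpl.
- simpl in h. rewrite Rmult_1_r in h. auto.
- split; [lra|]. apply IH; auto; [rewrite h2; nra|]. rewrite h2.
  replace (r * c * c ^ k) with (r * c ^ S k) by (simpl; ring). auto.
Qed.

Lemma run_ok_stream (A : nat -> step) (L : list step) (n : nat) (r : R) : (forall k, 0 <= sfac (A k)) -> run_ok r L ->
  (forall j, (j < length L)%nat -> nth_error L j = Some (A (n + j)%nat)) -> pfac A n <= r ->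
  (forall j, (j < length L)%nat -> pfac A (n + j) <= slim (A (n + j)%nat)) /\
  pfac A (n + length L) <= 1.
Proof.
intros hf. revert n r; induction L as [|st L IH]; intros n r hr hA hp; simpl in hr.
- split; [simpl; intros; lia|]. rewrite Nat.add_0_r. lra.
- destruct hr as [hr1 hr2].
  pose proof (hA 0%nat ltac:(simpl; lia)) as h0. rewrite Nat.add_0_r in h0. simpl in h0.
  injection h0 as ->.
  destruct (IH (S n) (r * sfac (A n)) hr2) as [g1 g2].
  + intros j hj. specialize (hA (S j) ltac:(simpl; lia)). simpl in hA. rewrite hA.
    do 2 f_equal. lia.
  + simpl. apply Rmult_le_compat_r; auto.
  + split.
    * intros [|j] hj; [rewrite Nat.add_0_r; lra|]. rewrite Nat.add_succ_r. apply g1. simpl in hj. lia.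
    * simpl length. rewrite Nat.add_succ_r. exact g2.
Qed.

Lemma cat_length_stream (A : nat -> step) (om : nat -> list nat) (L : list step) (n : nat) : (forall k, length (om k) = slen (A k)) ->
  (forall j, (j < length L)%nat -> nth_error L j = Some (A (n + j)%nat)) ->
  length (cat om (n + length L)) = (length (cat om n) + list_sum (map slen L))%nat.
Proof.
intros hl. revert n; induction L as [|st L IH]; intros n hA.
- simpl. rewrite Nat.add_0_r. lia.
- pose proof (hA 0%nat ltac:(simpl; lia)) as h0. rewrite Nat.add_0_r in h0. simpl in h0.
  injection h0 as ->. simpl length. rewrite Nat.add_succ_r.
  change (S (n + length L))%nat with (S n + length L)%nat. rewrite IH.
  + rewrite cat_S, length_app, hl. simpl. lia.
  + intros j hj. specialize (hA (S j) ltac:(simpl; lia)). simpl in hA. rewrite hA.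
    do 2 f_equal. lia.
Qed.

(** Each digit preserves the form of the bound on r: a step multiplies r by at most 4 Phi^(alpha_i
    (2s-1)), and s alpha_(i+1) = s alpha_i - (2s-1) alpha_i. The prefactor 4^(i-l) makes room for
    the l factors 4. *)
Lemma digits_run_ok s t eps l Phi (N : nat -> R) (P : nat -> list nat) k i r :
  0 < s < 1 -> (1 <= l)%nat -> 0 < t -> 0 < eps -> t * (1 + 2 * eps) = s -> 1 <= Phi ->
  (forall i, N i = Rpower Phi (alpha s l i)) -> (i + k = l)%nat -> 0 <= r ->
  r <= / 4 ^ l * 4 ^ i * Rpower Phi (- (s * alpha s l i)) ->
  run_ok r (map (fun i => digit_step_of t eps (N i) (P i)) (seq i k)).
Proof.
intros hs hl ht he hte hPhi hN. revert i r; induction k as [|k IH]; intros i r hik hr0 hr.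
- simpl. replace i with l in hr by lia. rewrite Rinv_l in hr by (apply pow_nonzero; lra).
  assert (Rpower Phi (- (s * alpha s l l)) <= 1).
  { apply Rpower_le1; auto. pose proof (alpha_pos s l l hs hl). nra. }
  lra.
- cbn [seq map run_ok]. simpl slim. simpl sfac.
  assert (hN1 : 1 <= N i).
  { rewrite hN. apply Rpower_ge1; auto. apply Rlt_le, alpha_pos; auto. }
  assert (h4 : / 4 ^ l * 4 ^ i <= 1).
  { apply (Rmult_le_reg_l (4 ^ l)); [apply pow_lt; lra|]. rewrite <- Rmult_assoc, Rinv_r, Rmult_1_l, Rmult_1_r.
    - apply Rle_pow; [lra|lia].
    - apply pow_nonzero; lra. }
  split.
  + rewrite hte, hN, Rpower_mult. eapply Rle_trans; [exact hr|].
    replace (alpha s l i * - s) with (- (s * alpha s l i)) by ring.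
    rewrite <- (Rmult_1_l (Rpower Phi (- (s * alpha s l i)))) at 2.
    apply Rmult_le_compat_r; [apply Rlt_le, Rpower_gt0|auto].
  + apply IH; [lia| |].
    * apply Rmult_le_pos; auto. apply Rmult_le_pos; [lra|apply Rlt_le, Rpower_gt0].
    * assert (hp : Rpower (N i) (2 * t * (1 + eps) - 1) <= Rpower Phi (alpha s l i * (2 * s - 1))).
      { rewrite <- Rpower_mult, <- hN. apply Rle_Rpower; nra. }
      eapply Rle_trans; [apply Rmult_le_compat; [auto| |exact hr|]|].
      -- apply Rmult_le_pos; [lra|apply Rlt_le, Rpower_gt0].
      -- apply Rmult_le_compat_l; [lra|exact hp].
      -- apply Req_le.
         replace (- (s * alpha s l (S i))) with (- (s * alpha s l i) + alpha s l i * (2 * s - 1)).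
         ++ rewrite Rpower_plus. simpl pow. ring.
         ++ rewrite (alpha_identity s l (S i)), (alpha_identity s l i), acum_S by auto. ring.
Qed.

Lemma lower_mid (phi : nat -> R) (l : nat) (s t : R) :
  (forall n, (1 <= n)%nat -> 0 < phi n) -> (1 <= l)%nat -> / 2 < s < 1 -> 0 < t < s ->
  (forall N, exists n M, (N <= n)%nat /\ (1 <= n)%nat /\
     Rpower (phi n) (fexp s l) < INR n * INR n * Zsum M (n - 1) s) ->
  Rbar_le t (hausdorff_dim (E'_set phi l)).
Proof.
intros hphi hl hs ht hio.
assert (hs01 : 0 < s < 1) by lra.
set (eps := (s - t) / (2 * t)).
assert (heps : 0 < eps) by (apply Rdiv_lt_0_compat; lra).
assert (hte : t * (1 + 2 * eps) = s) by (unfold eps; field; lra).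
destruct (primes_in_range eps heps) as [N0 [hN0 hprimes]].
destruct (choose_chunk s t hs ht) as [M [m [Y [hM [hY [hYs hYt]]]]]].
set (p := S m).
set (z := 1 + / (2 * s - 1)).
assert (hz : 1 <= z) by (unfold z; pose proof (Rinv_0_lt_compat (2 * s - 1) ltac:(lra)); lra).
set (f := fexp s l). assert (hf : 0 < f) by (apply fexp_pos; auto).
assert (hA : exists a, 0 <= a /\ forall i, (i < l)%nat -> 1 <= alpha s l i * a).
{ clear - hs01 hl. assert (h : forall k, exists a, 0 <= a /\ forall i, (i < k)%nat -> 1 <= alpha s l i * a).
  { induction k as [|k [a [ha1 ha2]]]; [exists 0; split; [lra|intros; lia]|].
    exists (a + / alpha s l k). pose proof (alpha_pos s l k hs01 hl) as hk.
    pose proof (Rinv_0_lt_compat _ hk). split; [lra|]. intros i hi.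
    pose proof (alpha_pos s l i hs01 hl).
    destruct (Nat.eq_dec i k) as [->|]; [rewrite Rmult_plus_distr_l, Rinv_r by lra; nra|].
    specialize (ha2 i ltac:(lia)). nra. }
  apply h. }
destruct hA as [a [ha1 ha2]].
set (Nm := N0 + 2).
set (K := Rpower Nm a).
assert (hK : 1 <= K) by (apply Rpower_ge1; [unfold Nm; lra|auto]).
(* phi may be small, while the prime ranges need N_i >= N0. Raising phi to at least K gives
   Phi^(alpha_i) >= N0 + 2 for i < l, and a product that reaches Phi reaches phi. *)
set (Phi := fun n => Rmax (phi n) K).
assert (hPhi : forall n, 1 <= Phi n) by (intros; unfold Phi; eapply Rle_trans; [exact hK|apply Rmax_r]).
set (N := fun n i => Rpower (Phi n) (alpha s l i)).
assert (hNbig : forall n i, (i < l)%nat -> Nm <= N n i).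
{ intros n i hi. unfold N. apply Rle_trans with (Rpower K (alpha s l i)).
  - unfold K. rewrite Rpower_mult. rewrite <- (Rpower_1 Nm) at 1 by (unfold Nm; lra).
    apply Rle_Rpower; [unfold Nm; lra|]. rewrite Rmult_comm. auto.
  - apply Rle_Rpower_l; [apply Rlt_le, alpha_pos; auto|]. split; [lra|apply Rmax_r]. }
assert (hPex : forall n i, exists P : list nat, (i < l)%nat -> NoDup P /\
    (forall p, In p P -> prime (Z.of_nat p) /\ N n i <= INR p <= Rpower (N n i) (1 + eps)) /\
    N n i <= INR (length P)).
{ intros n i. destruct (lt_dec i l) as [hi|hi]; [|exists nil; tauto].
  destruct (hprimes (N n i)) as [P hP]; [pose proof (hNbig n i hi); unfold Nm in *; lra|].
  exists P. auto. }
set (P := fun n i => proj1_sig (constructive_indefinite_description _ (hPex n i))).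
assert (hP : forall n i, (i < l)%nat -> NoDup (P n i) /\
    (forall p, In p (P n i) -> prime (Z.of_nat p) /\ N n i <= INR p <= Rpower (N n i) (1 + eps)) /\
    N n i <= INR (length (P n i))).
{ intros n i. unfold P. destruct constructive_indefinite_description; auto. }
clearbody P. clear hPex.
set (Z0 := Zsum M m t) in *. assert (hZ0 : 0 < Z0) by lra.
set (c := 64 / Z0).
assert (hc : 0 < c <= / (4 * Y)).
{ unfold c. split; [apply Rdiv_lt_0_compat; lra|].
  apply (Rmult_le_reg_r (Z0 * (4 * Y))); [nra|]. replace (64 / Z0 * (Z0 * (4 * Y))) with (256 * Y) by (field; lra).
  replace (/ (4 * Y) * (Z0 * (4 * Y))) with Z0 by (field; lra). auto. }
set (F := (2 * 3 ^ p) * (2 * 3 ^ p)).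
assert (hF : 0 < F) by (assert (0 < 3 ^ p) by (apply pow_lt; lra); unfold F; nra).
(* From [pos] to the block at n there are n - 1 - pos digits to fill. One of them is set aside
   first, so that the filler, of length [rn], is never empty. *)
set (jn := fun pos n => ((n - 1 - pos - 1) / p)%nat).
set (rn := fun pos n => S ((n - 1 - pos - 1) mod p)).
(* the next block starts so far away that the chunks before it gain more than the block costs *)
assert (hsel : forall pos, exists n, (pos + 2 <= n)%nat /\
   c ^ jn pos n * F <= / 4 ^ l * Rpower (Phi n) (- f)).
{ intros pos.
  (* All that depends on the starting point [pos], but not on n, is gathered here; n is chosen
     afterwards. *)
  set (C1 := F * Rpower K f * z ^ p * Y ^ (pos + 1) * 4 ^ l).
  destruct (square_vs_pow4 C1 p (pos + 2)) as [J0 hJ0].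
  destruct (hio (pos + 2 + J0 * p)%nat) as [n [M' [hn1 [hn2 hn3]]]].
  exists n. split; [lia|].
  set (j := jn pos n).
  assert (hp0 : p <> 0%nat) by (unfold p; lia).
  pose proof (Nat.div_mod_eq (n - 1 - pos - 1) p) as hdm. fold (jn pos n) in hdm. fold j in hdm.
  pose proof (Nat.mod_upper_bound (n - 1 - pos - 1) p hp0) as hmb.
  assert (hj : (J0 <= j)%nat).
  { unfold j, jn. apply Nat.div_le_lower_bound; auto. lia. }
  specialize (hJ0 j hj).
  assert (hnle : INR n <= INR (S j * p + (pos + 2))) by (apply le_INR; nia).
  set (J := ((n - 1) / p)%nat).
  pose proof (Nat.div_mod_eq (n - 1) p) as hdm2. fold J in hdm2.
  pose proof (Nat.mod_upper_bound (n - 1) p hp0) as hmb2.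
  assert (hJj : (J <= j + (pos + 1))%nat) by nia.
  assert (hZn : Zsum M' (n - 1) s <= Y ^ j * Y ^ (pos + 1) * z ^ p).
  { replace (n - 1)%nat with (J * p + (n - 1) mod p)%nat by lia.
    eapply Rle_trans; [apply (Zsum_pow M' p Y z s); try lra; [apply hYs|intros; apply Zsum_le_zeta; lra]|].
    rewrite <- pow_add. apply Rmult_le_compat; try (apply pow_le; lra); apply Rle_pow; auto; lia. }
  assert (hKf : 1 <= Rpower K f) by (apply Rpower_ge1; lra).
  assert (hYj : 1 <= Y ^ j) by (apply pow_R1_Rle; auto).
  assert (hYp : 1 <= Y ^ (pos + 1)) by (apply pow_R1_Rle; auto).
  assert (hzp : 1 <= z ^ p) by (apply pow_R1_Rle; auto).
  pose proof (INR_ge1 n hn2) as hn1'.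
  set (B := INR n * INR n * (Y ^ j * Y ^ (pos + 1) * z ^ p)).
  assert (hB : 1 <= B).
  { unfold B. assert (1 <= INR n * INR n) by nra.
    assert (1 <= Y ^ j * Y ^ (pos + 1)) by nra. assert (1 <= Y ^ j * Y ^ (pos + 1) * z ^ p) by nra. nra. }
  assert (hPf : Rpower (Phi n) f <= Rpower K f * B).
  { unfold Phi, Rmax. destruct (Rle_dec (phi n) K).
    - nra.
    - apply Rle_trans with B; [|nra]. fold f in hn3.
      apply Rlt_le, Rlt_le_trans with (1 := hn3). apply Rmult_le_compat_l; [nra|auto]. }
  rewrite Rpower_Ropp. pose proof (Rpower_gt0 (Phi n) f) as hPp.
  apply (Rmult_le_reg_r (Rpower (Phi n) f)); auto. rewrite Rmult_assoc, (Rmult_assoc (/ 4 ^ l)), Rinv_l, Rmult_1_r by lra.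
  assert (h4l : 0 < 4 ^ l) by (apply pow_lt; lra).
  apply (Rmult_le_reg_l (4 ^ l)); auto. rewrite Rinv_r by lra.
  (* The chunks gain (4Y)^(-j): here Y^j pays for [Zsum], and 4^j for n^2 and all constants, by
     [square_vs_pow4]. *)
  assert (hcj : c ^ j <= / 4 ^ j * / Y ^ j).
  { rewrite <- Rinv_mult, <- Rpow_mult_distr, <- pow_inv. apply pow_incr; lra. }
  assert (hcj0 : 0 < c ^ j) by (apply pow_lt; lra).
  assert (h4j : 0 < 4 ^ j) by (apply pow_lt; lra).
  apply Rle_trans with (4 ^ l * (/ 4 ^ j * / Y ^ j * (F * (Rpower K f * B)))).
  { apply Rmult_le_compat_l; [lra|]. apply Rmult_le_compat; [lra| |auto|].
    - apply Rmult_le_pos; lra.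
    - apply Rmult_le_compat_l; lra. }
  apply (Rmult_le_reg_l (4 ^ j)); auto. rewrite Rmult_1_r.
  eapply Rle_trans; [|exact hJ0].
  unfold B. replace (4 ^ j * (4 ^ l * (/ 4 ^ j * / Y ^ j * (F * (Rpower K f * (INR n * INR n *
     (Y ^ j * Y ^ (pos + 1) * z ^ p))))))) with (C1 * (INR n * INR n)) by (unfold C1; field; split; lra).
  apply Rmult_le_compat_l; [|apply Rmult_le_compat; lra].
  unfold C1. repeat (apply Rmult_le_pos; [|lra]); lra. }
set (sel := fun pos => proj1_sig (constructive_indefinite_description _ (hsel pos))).
assert (hsel' : forall pos, (pos + 2 <= sel pos)%nat /\
   c ^ jn pos (sel pos) * F <= / 4 ^ l * Rpower (Phi (sel pos)) (- f)).
{ intros pos. unfold sel. destruct constructive_indefinite_description; auto. }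
clearbody sel. clear hsel hio.
set (D := fun n i => digit_step_of t eps (N n i) (P n i)).
set (head := fun pos => repeat (chunk_step t M m) (jn pos (sel pos)) ++ [filler_step (rn pos (sel pos)) p]).
set (plan := fun pos => head pos ++ map (D (sel pos)) (seq 0 l)).
(* [pos ka] is the number of digits before plan ka. A plan starting at b ends with the block, whose
   digits have the indices sel b - 1, ..., sel b + l - 2 counted from 0. *)
set (pos := fun ka => Nat.iter ka (fun b => sel b - 1 + l)%nat 0%nat).
set (G := fun ka => plan (pos ka)).
set (A := flat (chunk_step t M m) G).
assert (hGlen : forall ka, (1 <= length (G ka))%nat).
{ intros ka. unfold G, plan. rewrite !length_app, length_map, length_seq. lia. }
assert (hnth : forall ka j, (j < length (G ka))%nat -> nth_error (G ka) j = Some (A (length (cat G ka) + j)%nat)).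
{ intros ka j hj. unfold A. rewrite flat_block by auto. apply nth_error_nth'. auto. }
assert (hstep : forall b S, In S (plan b) -> step_ok M p t S).
{ intros b S hS. unfold plan, head in hS. rewrite !in_app_iff in hS. destruct hS as [[hS|hS]|hS].
  - apply repeat_spec in hS. subst S. apply chunk_step_ok; auto; lra.
  - destruct hS as [<-|[]]. apply filler_step_ok; auto; [lra|].
    unfold rn. pose proof (Nat.mod_upper_bound (sel b - 1 - b - 1) p ltac:(unfold p; lia)). lia.
  - apply in_map_iff in hS. destruct hS as [i [<- hi]]. apply in_seq in hi.
    destruct (hP (sel b) i ltac:(lia)) as [h1 [h2 h3]]. apply digit_step_ok; auto; [lra| |].
    + pose proof (hNbig (sel b) i ltac:(lia)). unfold Nm in *. lra.
    + intros r hr. apply h2; auto. }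
assert (hrun : forall b, run_ok 1 (plan b)).
{ intros b. unfold plan, head. rewrite <- app_assoc. apply (run_ok_repeat 1 c); auto; try lra.
  - split; [lra|]. eapply Rle_trans; [apply hc|]. rewrite <- Rinv_1. apply Rinv_le_contravar; lra.
  - destruct (hsel' b) as [h1 h2]. rewrite Rmult_1_l. cbn [app run_ok].
    assert (hcj0 : 0 < c ^ jn b (sel b)) by (apply pow_lt; lra).
    split.
    + simpl slim. rewrite <- (pow1 (jn b (sel b))). apply pow_incr. split; [lra|].
      eapply Rle_trans; [apply hc|]. rewrite <- Rinv_1. apply Rinv_le_contravar; lra.
    + simpl sfac. fold F. unfold D.
      apply (digits_run_ok s t eps l (Phi (sel b))); auto; try lra; [nra|].
      simpl pow. rewrite Rmult_1_r.
      replace (s * alpha s l 0) with f; auto.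
      rewrite alpha_identity, acum_0 by auto. unfold f. ring. }
assert (hsum : forall b, list_sum (map slen (head b)) = (sel b - 1 - b)%nat).
{ intros b. unfold head. rewrite map_app, map_repeat, list_sum_app. cbn [map list_sum fold_right slen].
  simpl slen.
  assert (e : forall x k, list_sum (repeat x k) = (k * x)%nat) by (induction k; simpl; auto).
  rewrite e. fold p. destruct (hsel' b) as [h1 _].
  pose proof (Nat.div_mod_eq (sel b - 1 - b - 1) p) as hdm.
  unfold jn, rn. generalize dependent ((sel b - 1 - b - 1) mod p)%nat.
  generalize ((sel b - 1 - b - 1) / p)%nat. intros q1 q2 hdm. rewrite (Nat.mul_comm p) in hdm. lia. }
assert (hAok : forall k, step_ok M p t (A k)).
{ intros k. destruct (flat_decomp G k hGlen) as [ka [j [hj ->]]].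
  pose proof (hnth ka j hj) as e. apply nth_error_In in e. apply (hstep (pos ka)); auto. }
assert (hfac : forall k, 0 <= sfac (A k)).
{ intros k. pose proof (hAok k) as h.
  assert (hne : exists w, In w (sW (A k))).
  { pose proof (ok_sum M p t _ h) as e. destruct (sW (A k)) as [|w L]; [simpl in e; lra|].
    exists w. simpl. auto. }
  destruct hne as [w hw]. eapply Rle_trans; [|apply (ok_fac M p t _ h w hw)].
  apply Rmult_le_pos; [apply (ok_sp M p t _ h)|apply Rlt_le, Rpower_gt0]. }
assert (hpf : forall ka, pfac A (length (cat G ka)) <= 1).
{ induction ka as [|ka IH]; [simpl; lra|]. rewrite cat_S, length_app.
  apply (run_ok_stream A (G ka) _ 1); auto. apply hrun. }
apply (tree_dim A M p t 1); auto; [lra|lia|lra| |].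
- intros k. destruct (flat_decomp G k hGlen) as [ka [j [hj ->]]]. rewrite Rmult_1_l.
  apply (run_ok_stream A (G ka) _ 1); auto. apply hrun.
- intros om hv.
  assert (hlen : forall k, length (om k) = slen (A k)) by (intros k; apply (ok_word M p t _ (hAok k) _ (hv k))).
  assert (hlen1 : forall k, (1 <= length (om k))%nat) by (intros k; rewrite hlen; apply (ok_len M p t _ (hAok k))).
  assert (hd1 : forall i, (1 <= dig om i)%nat) by (apply (dig_pos A M p t); auto).
  assert (hDlen : forall n L, list_sum (map slen (map (D n) L)) = length L)
    by (intros n L; induction L; simpl; auto).
  assert (hpos : forall ka, length (cat om (length (cat G ka))) = pos ka).
  { induction ka as [|ka IH]; auto. rewrite cat_S, length_app.
    rewrite (cat_length_stream A om (G ka)); auto. rewrite IH.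
    unfold G at 1, plan. rewrite map_app, list_sum_app, hsum, hDlen, length_seq.
    simpl pos. destruct (hsel' (pos ka)). fold (pos ka). lia. }
  assert (hinc : forall ka, (ka <= pos ka)%nat).
  { induction ka as [|ka IH]; [lia|]. simpl. fold (pos ka). destruct (hsel' (pos ka)). lia. }
  assert (hdigits : forall ka i, (i < l)%nat -> In (dig om (sel (pos ka) - 1 + i)) (P (sel (pos ka)) i)).
  (* [L] is the part of the plan before the i-th digit of the block; its total length puts this
     digit at index sel b - 1 + i. *)
  { intros ka i hi. set (b := pos ka). set (L := head b ++ map (D (sel b)) (seq 0 i)).
    assert (hLG : exists R', G ka = L ++ D (sel b) i :: R').
    { exists (map (D (sel b)) (seq (S i) (l - S i))). unfold G, plan, L. fold b. rewrite <- app_assoc. f_equal.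
      replace l with (i + S (l - S i))%nat at 1 by lia. rewrite seq_app, map_app. reflexivity. }
    destruct hLG as [R' hLG].
    set (k := (length (cat G ka) + length L)%nat).
    assert (hAk : A k = D (sel b) i).
    { pose proof (hnth ka (length L)) as e. rewrite hLG in e. rewrite nth_error_app2, Nat.sub_diag in e by lia.
      simpl in e. specialize (e ltac:(rewrite length_app; simpl; lia)). injection e as e. auto. }
    assert (hk : length (cat om k) = (sel b - 1 + i)%nat).
    { unfold k. rewrite (cat_length_stream A om L); auto.
      - rewrite hpos. fold b. unfold L. rewrite map_app, list_sum_app, hsum, hDlen, length_seq.
        destruct (hsel' b). lia.
      - intros j hj. pose proof (hnth ka j) as e. rewrite hLG in e. rewrite nth_error_app1 in e by auto.
        apply e. rewrite length_app. lia. }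
    pose proof (hv k) as hin. rewrite hAk in hin. simpl in hin. apply in_map_iff in hin.
    destruct hin as [x [ex hx]]. rewrite <- hk, <- (Nat.add_0_r (length (cat om k))).
    unfold dig. rewrite flat_block by (auto; lia). rewrite <- ex. exact hx. }
  apply E'_of_digits; auto. intros N1. exists (sel (pos N1) - 1)%nat.
  destruct (hsel' (pos N1)) as [h1 _]. specialize (hinc N1).
  split; [lia|]. split.
  + intros i hi. destruct (hP (sel (pos N1)) i hi) as [_ [h2 _]]. apply h2. apply hdigits; auto.
  + replace (S (sel (pos N1) - 1)) with (sel (pos N1)) by lia.
    set (n := sel (pos N1)) in *.
    assert (hw : forall k, (k <= l)%nat -> Rpower (Phi n) (acum s l k) <= wprod (map (dig om) (seq (n - 1) k))).
    { induction k as [|k IH]; intros hk.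
      - simpl. rewrite acum_0, Rpower_O; [lra|]. specialize (hPhi n). lra.
      - rewrite seq_S, map_app, wprod_app, acum_S, Rpower_plus. cbn [map wprod]. rewrite Rmult_1_r.
        destruct (hP n k ltac:(lia)) as [_ [h2 _]].
        destruct (h2 _ (hdigits N1 k ltac:(lia))) as [_ [h3 _]].
        apply Rmult_le_compat; try apply Rlt_le, Rpower_gt0; [apply IH; lia|exact h3]. }
    specialize (hw l (le_n _)). specialize (hPhi n). rewrite acum_l, Rpower_1 in hw by (auto; lra).
    eapply Rle_trans; [|exact hw]. apply Rmax_l.
Qed.

(** * Comparison of the dimensions *)

Lemma block_prod_pq'_eq x n l : 0 < block_prod (fun m => pq' m x) n l ->
  block_prod (fun m => pq' m x) n l = block_prod (fun m => pq m x) n l.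
Proof.
revert n; induction l as [|l IH]; intros n; simpl; auto. unfold pq' at 1 3.
destruct prime_dec as [hp|hp]; [|rewrite Rmult_0_l; lra]. intros h.
assert (0 < IZR (pq n x)) by (apply IZR_lt; destruct hp; lia).
rewrite IH; auto. apply (Rmult_lt_reg_l (IZR (pq n x))); lra.
Qed.

Lemma E'_subset_E phi l x : (forall n, (1 <= n)%nat -> 0 < phi n) -> E'_set phi l x -> E_set phi l x.
Proof.
intros hphi [h1 [h2 h3]]. split; auto. split; auto. intros N.
destruct (h3 N) as [n [n1 [n2 n3]]]. exists n. split; auto. split; auto.
rewrite <- block_prod_pq'_eq; auto. specialize (hphi n n2). lra.
Qed.

Theorem theorem1p10 (phi : nat -> R) (l : nat) :
  (forall n : nat, (1 <= n)%nat -> 0 < phi n) ->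
  (1 <= l)%nat ->
  hausdorff_dim (E'_set phi l) = hausdorff_dim (E_set phi l).
Proof.
intros hphi hl.
assert (hmono : Rbar_le (hausdorff_dim (E'_set phi l)) (hausdorff_dim (E_set phi l)))
  by (apply dim_mono; intros x; apply E'_subset_E; auto).
assert (hd1 : Rbar_le (hausdorff_dim (E_set phi l)) 1) by (apply dim_unit_le1; intros x [h _]; auto).
assert (hd0 : Rbar_le 0 (hausdorff_dim (E'_set phi l))) by (apply dim_ge; intros; lra).
assert (hupE : forall s, 0 < s -> hausdorff_measure s (E_set phi l) = Finite 0 ->
   Rbar_le (hausdorff_dim (E_set phi l)) s) by (intros; apply dim_le; auto).
destruct (hausdorff_dim (E'_set phi l)) as [d'| |] eqn:e';
destruct (hausdorff_dim (E_set phi l)) as [d| |] eqn:e; simpl in hmono, hd1, hd0; try tauto.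
f_equal. destruct hmono as [hlt|]; auto. exfalso.
destruct (Rlt_le_dec (/ 2) d) as [hd|hd].
(* The exponents are taken above both d' and 1/2, because the sums [Zsum] are bounded in M only for
   s > 1/2. *)
- set (u := Rmax d' (/ 2)).
  assert (hu : d' <= u /\ / 2 <= u < d).
  { unfold u. split; [apply Rmax_l|]. split; [apply Rmax_r|]. apply Rmax_lub_lt; auto. }
  set (s := (2 * u + d) / 3). set (s' := (u + 2 * d) / 3).
  assert (hs : u < s /\ s < s' /\ s' < d) by (unfold s, s'; lra).
  (* M is existential here, so that the negation bounds [Zsum] uniformly in M. *)
  destruct (classic (forall N, exists n M, (N <= n)%nat /\ (1 <= n)%nat /\
     Rpower (phi n) (fexp s l) < INR n * INR n * Zsum M (n - 1) s)) as [h|h].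
  + pose proof (lower_mid phi l s ((u + s) / 2) hphi hl ltac:(lra) ltac:(lra) h) as hc.
    rewrite e' in hc. simpl in hc. lra.
  + apply not_all_ex_not in h. destruct h as [N0 h].
    assert (hm : hausdorff_measure s' (E_set phi l) = Finite 0).
    { apply (upper_mid phi l s s' N0); auto; [lra|lra|]. intros n M hn1 hn0.
      apply Rnot_lt_le. intros hc. apply h. exists n, M. auto. }
    specialize (hupE s' ltac:(lra) hm). simpl in hupE. lra.
- set (s := (2 * d' + d) / 3). set (s' := (d' + 2 * d) / 3).
  assert (hs : d' < s /\ s < s' /\ s' < d) by (unfold s, s'; lra).
  set (beta := / s - 1).
  assert (hb : 1 < beta).
  { unfold beta. assert (/ / 2 < / s) by (apply Rinv_lt_contravar; [apply Rmult_lt_0_compat|]; lra).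
    rewrite Rinv_inv in H. lra. }
  assert (hsb : / (1 + beta) = s) by (unfold beta; replace (1 + (/ s - 1)) with (/ s) by ring; apply Rinv_inv).
  destruct (classic (forall N, exists n, (N <= S n)%nat /\ phi (S n) <= exp (beta ^ S n))) as [h|h].
  + pose proof (lower_low phi l beta ((d' + s) / 2) hl hb ltac:(lra) h) as hc.
    rewrite e' in hc. simpl in hc. lra.
  + apply not_all_ex_not in h. destruct h as [N0 h].
    assert (hm : hausdorff_measure s' (E_set phi l) = Finite 0).
    { apply (upper_low phi l beta s' N0); auto; [lra|]. intros n hn1 hn0.
      destruct n as [|n]; [lia|]. apply Rlt_le, Rnot_le_lt. intros hc. apply h. exists n. auto. }
    specialize (hupE s' ltac:(lra) hm). simpl in hupE. lra.
Qed.
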